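(* Let $a\in C^2(\mathbf{R})$ satisfy $a''(v)\ge\alpha_0>0$ for all $v\in\mathbf{R}$, and let $u^{in}\in L^\infty(\mathbf{R})$. Let $u\in L^\infty(\mathbf{R}_+\times\mathbf{R})$ be a bounded weak solution of the Cauchy problem $$\partial_t u+\partial_x a(u)=0\quad (t>0,\ x\in\mathbf{R}),\qquad u|_{t=0}=u^{in},$$ such that for each convex entropy $\eta\in C^1(\mathbf{R})$ one has, in the sense of distributions, $$\partial_t\eta(u)+\partial_x q(u)=-\mu,$$ where $q(v)=\int^v\eta'(w)a'(w)\,dw$ is the associated entropy flux and $\mu$ (which may depend on $\eta$) is a signed Radon measure on $\mathbf{R}_+\times\mathbf{R}$. Then $u\in B^{1/3,3}_{\infty,loc}((0,\infty)\times\mathbf{R})$.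
   Context: For an open set $\Omega\subset\mathbf{R}^2$, $0<s<1$ and $1\le p<\infty$, a function $g\in L^p_{loc}(\Omega)$ belongs to the local Besov space $B^{s,p}_{\infty,loc}(\Omega)$ if for every compact $K\subset\Omega$ there exist $C,h_0>0$ such that $\int_K|g(z+h)-g(z)|^p\,dz\le C|h|^{sp}$ for all $h\in\mathbf{R}^2$ with $|h|\le h_0$. The entropy production $\mu$ is not assumed to have a sign. *)

(* Defs.v *)
From HB Require Import structures.
From mathcomp Require Import all_boot all_order all_algebra.
From mathcomp Require Import all_classical all_reals all_analysis.
Set Implicit Arguments. Unset Strict Implicit. Unset Printing Implicit Defensive.
Import Order.TTheory GRing.Theory Num.Theory.
Import numFieldNormedType.Exports.
Local Open Scope classical_set_scope.
Local Open Scope ring_scope.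

Section Defs.
Variable R : realType.

Definition leb2 := ((@lebesgue_measure R) \x (@lebesgue_measure R))%E.

Definition norm2 (h : R * R) : R := Num.sqrt (h.1 ^+ 2 + h.2 ^+ 2).

Definition halfplane : set (R * R) := [set p | 0 < p.1].

Definition pderiv (b : bool) (f : R * R -> R) : R * R -> R :=
  fun p => if b then derive1 (fun s => f (s, p.2)) p.1
           else derive1 (fun y => f (p.1, y)) p.2.

Definition pderivable (b : bool) (f : R * R -> R) (p : R * R) : Prop :=
  if b then derivable (fun s => f (s, p.2)) p.1 1
  else derivable (fun y => f (p.1, y)) p.2 1.

Definition iter_pderiv (l : seq bool) (f : R * R -> R) : R * R -> R :=
  foldr pderiv f l.

Definition smooth2 (f : R * R -> R) : Prop :=
  forall l : seq bool,
    continuous (iter_pderiv l f) /\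
    forall (b : bool) (p : R * R), pderivable b (iter_pderiv l f) p.

Definition compact_support_in (D : set (R * R)) (f : R * R -> R) : Prop :=
  exists K : set (R * R), [/\ compact K, K `<=` D & forall p, ~ K p -> f p = 0].

Definition test_fun (D : set (R * R)) (f : R * R -> R) : Prop :=
  smooth2 f /\ compact_support_in D f.

(* signed Radon measure on the open set D, given by its Jordan decomposition
   mu = mup - mum, both nonnegative Borel measures finite on compacts of D *)
Definition locally_finite_on (D : set (R * R))
  (m : {measure set (R * R) -> \bar R}) : Prop :=
  forall K, compact K -> K `<=` D -> (m K < +oo)%E.

Definition Linfty2 (D : set (R * R)) (u : R * R -> R) : Prop :=
  measurable_fun D u /\
  exists M : R, leb2.-negligible [set p | D p /\ M < `|u p|].

Definition Linfty1 (f : R -> R) : Prop :=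
  measurable_fun setT f /\
  exists M : R, (@lebesgue_measure R).-negligible [set x | M < `|f x|].

Definition Lploc (p : R) (Om : set (R * R)) (g : R * R -> R) : Prop :=
  measurable_fun Om g /\
  forall K, compact K -> K `<=` Om ->
    (\int[leb2]_(z in K) ((`|g z| `^ p)%:E) < +oo)%E.

Definition Besov_loc (s p : R) (Om : set (R * R)) (g : R * R -> R) : Prop :=
  Lploc p Om g /\
  forall K, compact K -> K `<=` Om ->
    exists C h0 : R, [/\ 0 < C, 0 < h0 &
      forall h : R * R, norm2 h <= h0 ->
        (\int[leb2]_(z in K) ((`|g (z.1 + h.1, z.2 + h.2) - g z| `^ p)%:E)
          <= (C * (norm2 h `^ (s * p)))%:E)%E].

Definition weak_solution (a : R -> R) (uin : R -> R) (u : R * R -> R) : Prop :=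
  forall phi, test_fun setT phi ->
    (\int[leb2]_(z in halfplane)
        ((u z * pderiv true phi z + a (u z) * pderiv false phi z)%:E)
     + \int[@lebesgue_measure R]_(x in setT) ((uin x * phi (0, x))%:E) = 0)%E.

Definition entropy_measure (eta q : R -> R) (u : R * R -> R) : Prop :=
  exists mup mum : {measure set (R * R) -> \bar R},
    [/\ locally_finite_on halfplane mup, locally_finite_on halfplane mum &
      forall phi, test_fun halfplane phi ->
        (\int[leb2]_(z in halfplane)
            ((eta (u z) * pderiv true phi z + q (u z) * pderiv false phi z)%:E)
         = \int[mup]_(z in halfplane) (phi z)%:E
           - \int[mum]_(z in halfplane) (phi z)%:E)%E].

Definition C1 (f : R -> R) : Prop :=
  (forall v, derivable f v 1) /\ continuous (derive1 f).

Definition C2 (f : R -> R) : Prop :=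
  (forall v, derivable f v 1) /\ (forall v, derivable (derive1 f) v 1) /\
  continuous (derive1n 2 f).

End Defs.

(* Main.v *)
(* For two bounded fields A, B whose divergences are bounded on test functions, the
   determinant of their increments over a distance h, tested against psi and mollified in
   one factor, is a divergence up to terms of size O(h): moving the mollified increment
   under a derivative costs a factor h. Apply this to A_i = (eta_i, q_i)(u) and
   B_i = A_i - A_{i+1}, where eta_i are the Kruzhkov entropies (v - k_i)^+ of a fine grid
   k_i. Summation by parts in i keeps the bound O(h) uniform in the grid, while the
   uniform convexity of a bounds the sum of the determinants below by
   alpha0/6 |u(z+h) - u(z)|^3, up to an error vanishing with the mesh. This is the
   estimate for axis-parallel h; the triangle inequality gives all other h.

   The Kruzhkov entropies are not C^1, and each C^1 entropy has its own measure, so a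
   bound uniform in the entropy is needed. It follows from the finiteness for each single
   entropy by a gliding hump argument on the set of derivatives eta'. *)
Require Import Defs.
From HB Require Import structures.
From mathcomp Require Import all_boot all_order all_algebra.
From mathcomp Require Import all_classical all_reals all_analysis.
From mathcomp Require Import measurable_realfun.
From mathcomp Require Import ring lra.
Import Order.TTheory GRing.Theory Num.Theory.
Import numFieldNormedType.Exports.
Local Open Scope classical_set_scope.
Local Open Scope ring_scope.
Set Implicit Arguments. Unset Strict Implicit. Unset Printing Implicit Defensive.

(** * Smooth functions of one variable and smoothed steps *)

Section Smooth1.
Variable R : realType.
Implicit Types (f g : R -> R) (x : R).

(** The entropy measures may be singular where [u] jumps, so a product of [u] with them has no
    meaning and a determinant of two raw increments cannot be integrated by parts. Convolving one
    factor lets it enter a test function. The kernel is the increment over a length h of a smoothed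
    Heaviside function; a mollified increment is then the derivative of a function of size O(h),
    whatever the width of the mollifier, which can tend to 0 with h and the grid fixed.

    On a grid of mesh d there are O(1/d) levels, so each term of the sum must gain a factor d. The
    field B_i does, being O(d), but its divergence does not: it is bounded only by the sum of two
    divergences. This forces the summation by parts.

    The information on divergences concerns convex entropies only, whose slopes eta' are
    nondecreasing and form no vector space. Banach-Steinhaus is thus replaced by a construction that
    adds nonnegative multiples of slopes only.

    The exponent 1/3 balances a cubic lower bound and a linear upper bound: s p = 1 for p = 3. *)

Definition smooth1 f := forall n x, derivable (derive1n n f) x 1.

(** Formulas for n-th derivatives are rarely available, classes stable under differentiation are;
    the induction on the order never leaves such a class. *)
Lemma smooth1_class (C : set (R -> R)) :
  (forall f, C f -> exists2 g, C g & forall x : R, is_derive x 1 f (g x)) ->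
  forall f, C f -> smooth1 f.
Proof.
move=> CP f Cf n.
suff [g Cg ->] : exists2 g, C g & derive1n n f = g.
  by move=> x; have [h _ gh] := CP _ Cg; have [] := gh x.
elim: n => [|n [g Cg gE]]; first by exists f.
have [h Ch gh] := CP _ Cg; exists h => //.
by rewrite derive1nS gE; apply/funext => x; rewrite derive1E; have [_ ->] := gh x.
Qed.

Lemma smooth1_derive f : smooth1 f -> smooth1 (derive1 f).
Proof. by move=> sf n x; rewrite -derive1Sn; exact: (sf n.+1). Qed.

Lemma smooth1_is_derive f x : smooth1 f -> is_derive x 1 f (derive1 f x).
Proof. by move=> /(_ 0 x) /= fx; rewrite derive1E; exact/derivableP. Qed.

Lemma smooth1_prim f g : smooth1 g -> (forall x : R, is_derive x 1 f (g x)) ->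
  smooth1 f.
Proof.
move=> sg fg.
have fE : (derive1 f) = g by apply/funext => x; rewrite derive1E; have [_ ->] := fg x.
by case=> [x|n x]; [have [] := fg x|rewrite derive1Sn fE; exact: sg].
Qed.

(** The chain rule brings out the slope of the affine map and the Leibniz rule a sum of products;
    these constructors make the class stable under differentiation. *)
Inductive smooth1_alg : set (R -> R) :=
| Alg_smooth f a b : smooth1 f -> smooth1_alg (fun x => f (a * x + b))
| Alg_add f g : smooth1_alg f -> smooth1_alg g -> smooth1_alg (fun x => f x + g x)
| Alg_mul f g : smooth1_alg f -> smooth1_alg g -> smooth1_alg (fun x => f x * g x)
| Alg_cst a f : smooth1_alg f -> smooth1_alg (fun x => a * f x).

Lemma smooth1_alg_smooth f : smooth1_alg f -> smooth1 f.
Proof.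
apply: smooth1_class => {}f; elim => {f}.
- move=> f a b sf; exists (fun x => a * (derive1 f) (a * x + b)).
    by apply: Alg_cst; apply: Alg_smooth; exact: smooth1_derive.
  move=> x; rewrite mulrC; apply: (@is_derive1_comp _ f (fun x => a * x + b)).
    exact: smooth1_is_derive.
  by apply: is_derive_eq; rewrite /GRing.scale/=; ring.
- move=> f g _ [f' Cf' ff'] _ [g' Cg' gg']; exists (fun x => f' x + g' x).
    exact: Alg_add.
  by move=> x; apply: is_deriveD.
- move=> f g Cf [f' Cf' ff'] Cg [g' Cg' gg'].
  exists (fun x => f x * g' x + g x * f' x); last by move=> x; exact: is_deriveM.
  by apply: Alg_add; apply: Alg_mul.
- move=> a f _ [f' Cf' ff']; exists (fun x => a * f' x); first exact: Alg_cst.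
  by move=> x; apply: is_deriveZ.
Qed.

Lemma smooth1_affine f a b : smooth1 f -> smooth1 (fun x => f (a * x + b)).
Proof. by move=> sf; apply/smooth1_alg_smooth/Alg_smooth. Qed.

Lemma smooth1_id f : smooth1 f -> smooth1_alg f.
Proof.
move=> sf; rewrite (_ : f = fun x => f (1 * x + 0)); first exact: Alg_smooth.
by apply/funext => x; rewrite mul1r addr0.
Qed.

Lemma smooth1M f g : smooth1 f -> smooth1 g -> smooth1 (fun x => f x * g x).
Proof.
by move=> /smooth1_id sf /smooth1_id sg; apply: smooth1_alg_smooth; exact: Alg_mul.
Qed.

Lemma smooth1B f g : smooth1 f -> smooth1 g -> smooth1 (fun x => f x - g x).
Proof.
move=> /smooth1_id sf /smooth1_id sg; apply: smooth1_alg_smooth.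
rewrite (_ : (fun x => _) = (fun x => f x + (-1) * g x)).
  by apply: Alg_add => //; exact: Alg_cst.
by apply/funext => x; rewrite mulN1r.
Qed.

Lemma smooth1Z f a : smooth1 f -> smooth1 (fun x => a * f x).
Proof. by move=> /smooth1_id sf; apply/smooth1_alg_smooth/Alg_cst. Qed.

Lemma smooth1_continuous f : smooth1 f -> continuous f.
Proof. by move=> /(_ 0) sf x; apply/differentiable_continuous/derivable1_diffP. Qed.

(* t^n e^(-t) <= n^n, from (1 + t/n)^n <= e^t *)
Lemma expr_expRN_le n (t : R) : 0 <= t -> t ^+ n * expR (- t) <= (n%:R) ^+ n.
Proof.
case: n => [|n] t0; first by rewrite expr0 mul1r expR_le1 oppr_le0.
rewrite expRN ler_pdivrMr ?expR_gt0//.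
have -> : t = n.+1%:R * (t / n.+1%:R) by rewrite mulrC divfK.
rewrite exprMn ler_wpM2l ?exprn_ge0// expRM_natl.
rewrite lerXn2r ?nnegrE ?expR_ge0 ?divr_ge0//.
by rewrite (le_trans _ (expR_ge1Dx _))// lerDr.
Qed.

Lemma horner_expRN_bound (p : {poly R}) :
  exists C : R, forall t : R, 0 <= t -> `|p.[t] * expR (- t)| <= C.
Proof.
exists (\sum_(i < size p) `|p`_i| * (i%:R) ^+ i) => t t0.
rewrite horner_coef mulr_suml (le_trans (ler_norm_sum _ _ _))//.
apply: ler_sum => i _; rewrite -mulrA normrM ler_wpM2l//.
by rewrite ger0_norm ?mulr_ge0 ?expR_ge0 ?exprn_ge0// expr_expRN_le.
Qed.

(** For [p] = 1 this is the classical exp(-1/x), flat at 0. The polynomial factor makes the family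
    stable under differentiation. *)
Definition flat (p : {poly R}) (x : R) : R :=
  if 0 < x then p.[x^-1] * expR (- x^-1) else 0.

Lemma is_derive_flat p x :
  is_derive x 1 (flat p) (flat ('X ^+ 2 * (p - p^`())) x).
Proof.
have [x0|x0|<-] := ltgtP 0 x.
- apply: (@near_eq_is_derive _ _ _ (fun x => p.[x^-1] * expR (- x^-1))).
    by near=> y; rewrite /flat ifT//; near: y; exact: lt_nbhsr.
  rewrite /flat x0.
  have xN0 : x != 0 by rewrite gt_eqF.
  have dV : is_derive x 1 (fun y : R => y^-1) (- x ^- 2).
    apply: (is_derive_eq (is_deriveV xN0 (is_derive_id x 1))).
    by rewrite /GRing.scale/= mulr1.
  have dp := @is_derive1_comp _ (horner p) (fun y : R => y^-1) x _ _ _ dV.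
  have dN : is_derive x 1 (fun y : R => - y^-1) (- - x ^- 2).
    exact: is_deriveN.
  have de := @is_derive1_comp _ expR (fun y : R => - y^-1) x _ _ _ dN.
  apply: (is_derive_eq (is_deriveM (dp _ _) (de _ _))).
  by rewrite /GRing.scale/= hornerM hornerXn hornerD hornerN -exprVn; ring.
- apply: (@near_eq_is_derive _ _ _ (fun x => 0)).
    by near=> y; rewrite /flat ifF//; apply/negbTE; rewrite -leNgt ltW//; near: y; exact: lt_nbhsl.
  rewrite /flat ifF//; first exact: is_derive_cst.
  by apply/negbTE; rewrite -leNgt ltW.
- rewrite {2}/flat ltxx.
  (* For h > 0 the difference quotient at 0 is h times q(1/h) exp(-1/h) with q = X^2 p, and the
     factor after h stays bounded. *)
  have [C HC] := horner_expRN_bound ('X ^+ 2 * p).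
  suff H : (fun h : R => h^-1 *: (flat p (h *: 1 + 0) - flat p 0)) @ 0^' --> 0.
    by split; [exact: cvgP H|apply: cvg_lim H].
  apply/cvgr0Pnorm_le => e e0.
  have C0 : 0 <= C by apply: (le_trans _ (HC 0 _)).
  near=> h.
  rewrite {2}/flat ltxx subr0 /GRing.scale/= mulr1 addr0 /flat.
  case: ifPn => h0; last by rewrite mulr0 normr0 ltW.
  have := HC h^-1; rewrite invr_ge0 (ltW h0) => /(_ isT).
  rewrite hornerM hornerXn => H.
  rewrite (_ : h^-1 * _ = h * (h^-1 ^+ 2 * p.[h^-1] * expR (- h^-1))); last first.
    by rewrite expr2 !mulrA mulfV ?gt_eqF// mul1r.
  rewrite normrM (le_trans (ler_wpM2l _ H))//.
  rewrite (@le_trans _ _ (`|h| * (C + 1)))// ?ler_wpM2l ?lerDl//.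
  rewrite -ler_pdivlMr ?ltr_wpDl//.
  near: h; apply: dnbhs0_le; by rewrite divr_gt0// ltr_wpDl.
Unshelve. all: by end_near. Qed.

Lemma smooth1_flat p : smooth1 (flat p).
Proof.
apply: (@smooth1_class [set flat p | p in setT]); last by exists p.
move=> _ [q _ <-]; exists (flat ('X ^+ 2 * (q - q^`()))); first by exists ('X ^+ 2 * (q - q^`())).
by move=> x; exact: is_derive_flat.
Qed.

Lemma mvt f f' (a b : R) : (forall x : R, is_derive x 1 f (f' x)) -> a < b ->
  exists2 c, a < c < b & f b - f a = f' c * (b - a).
Proof.
move=> ff' ab; have cf : {within `[a, b], continuous f}.
  by apply: derivable_within_continuous => x _; exact: (@ex_derive _ _ _ _ _ _ _ (ff' x)).
have [c] := MVT ab (fun x _ => ff' x) cf.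
by rewrite in_itv/= => cab E; exists c.
Qed.

Lemma mvt_bound f f' (a b C : R) : (forall x : R, is_derive x 1 f (f' x)) ->
  (forall x, `|f' x| <= C) -> `|f b - f a| <= C * `|b - a|.
Proof.
move=> ff' Cf'.
have [ab|ba|->] := ltgtP a b; last by rewrite !subrr normr0 mulr0.
- by have [c _ ->] := mvt ff' ab; rewrite normrM ler_wpM2r.
- by have [c _] := mvt ff' ba; rewrite distrC (distrC b) => ->; rewrite normrM ler_wpM2r.
Qed.

Notation mu := (@lebesgue_measure R).

(** Integrating from -oo gives one formula on both sides of [m]; the integrand vanishes below [m],
    so only a segment contributes. *)
Lemma antiderivative f (m : R) : continuous f -> (forall x, x <= m -> f x = 0) ->
  exists2 F : R -> R, (forall x : R, is_derive x 1 F (f x)) &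
    forall x, x <= m -> F x = 0.
Proof.
move=> cf f0; exists (fun x => \int[mu]_(t in [set` `]-oo, x]]) f t); last first.
  move=> x xm; rewrite (@eq_Rintegral _ _ _ _ _ (cst 0)).
    by rewrite /Rintegral /= integral0.
  by move=> t; rewrite inE/= in_itv/= => tx; rewrite f0// (le_trans tx).
move=> x.
have fi (u : R) : mu.-integrable `]-oo, u] (EFin \o f).
  have mitv (i : interval R) : measurable [set` i] by [].
  apply: (@integrable_mkcond _ _ _ mu _ _ (mitv _)).2.
  have -> : (EFin \o f) \_ `]-oo, u] = (EFin \o f) \_ `[m, u].
    apply/funext => t; rewrite !patchE !mem_setE !in_itv/=.
    by case: (leP m t) => //= /ltW/f0 ->; rewrite if_same.
  apply: (@integrable_mkcond _ _ _ mu _ _ (mitv _)).1.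
  apply: continuous_compact_integrable; first exact: segment_compact.
  exact: continuous_subspaceT.
have xx : x < x + 1 by rewrite ltrDl.
have [] := @continuous_FTC1 _ f -oo%O x (x + 1) xx (fi _) _ (cf x).
  by rewrite ltNyr.
move=> dF <-; rewrite derive1E; exact: derivableP.
Qed.

(** [rho] is the product of [flat] at e + x and at e - x, divided by its total mass [T e]. The
    antiderivative is kept along with the mollifier because its increments will be the kernels that
    gain the factor h. *)
Lemma smooth_step (e : R) : 0 < e ->
  exists Theta rho : R -> R, smooth1 rho /\
    [/\ forall x : R, is_derive x 1 Theta (rho x), forall x, 0 <= rho x,
        forall x, e <= `|x| -> rho x = 0,
        forall x, x <= - e -> Theta x = 0 & forall x, e <= x -> Theta x = 1].
Proof.
move=> e0.
pose b x := flat 1 (1 * x + e) * flat 1 ((-1) * x + e).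
have sb : smooth1 b by apply: smooth1M; apply: smooth1_affine; exact: smooth1_flat.
have flat_ge0 x : 0 <= flat 1 x.
  by rewrite /flat; case: ifP => // _; rewrite hornerC mul1r expR_ge0.
have flat_gt0 x : 0 < x -> 0 < flat 1 x.
  by move=> x0; rewrite /flat x0 hornerC mul1r expR_gt0.
have flat0 x : x <= 0 -> flat 1 x = 0 by rewrite /flat leNgt => /negbTE ->.
have b_ge0 x : 0 <= b x by rewrite mulr_ge0.
have b0 x : e <= `|x| -> b x = 0.
  rewrite ler_normr /b => /orP[ex|ex].
    by rewrite [X in _ * X]flat0 ?mulr0//; lra.
  by rewrite flat0 ?mul0r//; lra.
have [||T Tb T0] := @antiderivative b (- e); first exact: smooth1_continuous.
  by move=> x xe; apply: b0; rewrite ler_normr; apply/orP; right; lra.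
have T1 x : e <= x -> T x = T e.
  rewrite le_eqVlt => /predU1P[->//|ex].
  have [c /andP[ec _]] := mvt Tb ex; rewrite b0 ?mul0r; first by lra.
  by rewrite ler_normr ltW.
have Te0 : 0 < T e.
  have [|c /andP[ec ce]] := @mvt T b (- e) e Tb; first by lra.
  rewrite (T0 (- e))// subr0 => ->; rewrite mulr_gt0//; last by lra.
  by rewrite mulr_gt0// flat_gt0//; lra.
exists (fun x => (T e)^-1 * T x), (fun x => (T e)^-1 * b x); split.
  exact: smooth1Z.
split.
- by move=> x; apply: is_deriveZ.
- by move=> x; rewrite mulr_ge0 ?invr_ge0// ltW.
- by move=> x /b0 ->; rewrite mulr0.
- by move=> x /T0 ->; rewrite mulr0.
- by move=> x /T1 ->; rewrite mulVf ?gt_eqF.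
Qed.

End Smooth1.

(** * Integration over the plane: bounded functions, translations, Fubini *)

Section Integral2.
Variable R : realType.
Notation mu := (@lebesgue_measure R).
Notation mu2 := ((@lebesgue_measure R) \x (@lebesgue_measure R))%E.
Implicit Types (f g : R * R -> R) (z h : R * R) (L C : R).

Lemma bounded_integrable d (T : measurableType d) (m : {measure set T -> \bar R})
    (A : set T) (f : T -> R) (C : R) :
  measurable A -> (m A < +oo)%E -> measurable_fun setT f ->
  (forall x, `|f x| <= C) -> (forall x, ~ A x -> f x = 0) ->
  m.-integrable setT (EFin \o f).
Proof.
move=> mA Aoo mf fC fA.
have -> : EFin \o f = (EFin \o f) \_ A.
  apply/funext => x; rewrite patchE; case: ifPn => //.
  by rewrite notin_setE => /fA /= ->.
apply: (@integrable_mkcond _ _ _ m _ _ mA).1.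
apply: measurable_bounded_integrable => //; first exact: measurable_funTS.
by exists C; split; [exact: num_real|move=> y Cy x Ax /=; rewrite (le_trans (fC x))// ltW].
Qed.

(** The norm of a pair is the maximum norm, so a ball is a product of two intervals. *)
Definition cube (L : R) : set (R * R) := [set z | `|z| <= L].

Lemma cubeE L : cube L = `[- L, L]%classic `*` `[- L, L]%classic.
Proof.
apply/seteqP; split=> -[x y]; rewrite /cube/= prod_normE/= ge_max !in_itv/= -!ler_norml.
  by move=> /andP[].
by move=> [-> ->].
Qed.

Lemma measurable_cube L : measurable (cube L).
Proof. by rewrite cubeE; exact: measurableX. Qed.

Lemma leb2_cube L : 0 <= L -> mu2 (cube L) = ((2 * L) ^+ 2)%:E.
Proof.
move=> L0; rewrite cubeE product_measure1E//= lebesgue_measure_itv/= lte_fin.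
case: ifPn => [_|]; first by rewrite -EFinM; congr EFin; ring.
rewrite -leNgt => LL; have -> : L = 0 by lra.
by rewrite mul0e mulr0 expr0n.
Qed.

Lemma leb2_cube_lty L : (mu2 (cube L) < +oo)%E.
Proof.
have [L0|L0] := leP 0 L; first by rewrite leb2_cube// ltry.
rewrite (_ : cube L = set0); first by rewrite measure0.
by apply/seteqP; split => // z; rewrite /cube/= leNgt (lt_le_trans L0).
Qed.

(** Bounded, compactly supported, measurable: such functions are integrable and stable under sums,
    translations and products with [bmf], so the integral acts on them as a linear real-valued
    functional. *)
Definition bcs f := [/\ measurable_fun setT f, exists C : R, forall z, `|f z| <= C &
  exists L : R, forall z, L < `|z| -> f z = 0].

Definition bmf f := measurable_fun setT f /\ exists C : R, forall z, `|f z| <= C.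

(** Locked so that rewriting and unification treat the integral as an opaque functional. *)
Definition I2 : (R * R -> R) -> R := locked (fun f => \int[mu2]_z f z).

Lemma I2E f : I2 f = \int[mu2]_z f z. Proof. by rewrite /I2 -lock. Qed.

Lemma I2_cst0 : I2 (fun=> 0) = 0.
Proof. by rewrite I2E /Rintegral integral0. Qed.

Lemma bcs_bmf f : bcs f -> bmf f. Proof. by case. Qed.

Lemma bcs_integrable f : bcs f -> mu2.-integrable setT (EFin \o f).
Proof.
move=> [mf [C fC] [L fL]].
apply: (@bounded_integrable _ _ mu2 (cube L) _ C) => //.
- exact: measurable_cube.
- exact: leb2_cube_lty.
- by move=> z /negP; rewrite -ltNge => /fL.
Qed.

Lemma bmf_norm f : bmf f -> exists2 C : R, 0 <= C & forall z, `|f z| <= C.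
Proof. by move=> [_ [C fC]]; exists C => //; exact: le_trans (fC 0). Qed.

Lemma bmfD f g : bmf f -> bmf g -> bmf (fun z => f z + g z).
Proof.
move=> [mf [C fC]] [mg [D gD]]; split; first exact: measurable_funD.
by exists (C + D) => z; rewrite (le_trans (ler_normD _ _))// lerD.
Qed.

Lemma bmfM f g : bmf f -> bmf g -> bmf (fun z => f z * g z).
Proof.
move=> [mf [C fC]] [mg [D gD]]; split; first exact: measurable_funM.
by exists (C * D) => z; rewrite normrM ler_pM.
Qed.

Lemma bmf_cst C : bmf (fun=> C).
Proof. by split; [exact: measurable_cst|exists `|C|]. Qed.

Lemma bmfN f : bmf f -> bmf (fun z => - f z).
Proof.
move=> [mf [C fC]]; split; first exact: measurableT_comp.
by exists C => z; rewrite normrN.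
Qed.

Lemma bmfB f g : bmf f -> bmf g -> bmf (fun z => f z - g z).
Proof. by move=> bf bg; apply: bmfD => //; exact: bmfN. Qed.

Lemma measurable_shift h : measurable_fun setT (fun z : R * R => z + h).
Proof.
apply/measurable_fun_pairP; split; apply: measurable_funD => //.
Qed.

Lemma bmf_shift f h : bmf f -> bmf (fun z => f (z + h)).
Proof.
move=> [mf [C fC]]; split; first by apply: measurableT_comp => //; exact: measurable_shift.
by exists C.
Qed.

Lemma bcsM f g : bmf f -> bcs g -> bcs (fun z => f z * g z).
Proof.
move=> bf bg; have [mM CM] := bmfM bf (bcs_bmf bg); split=> //.
by have [_ _ [L gL]] := bg; exists L => z /gL ->; rewrite mulr0.
Qed.

Lemma bcsMl f g : bcs f -> bmf g -> bcs (fun z => f z * g z).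
Proof.
move=> bf bg; have := bcsM bg bf.
by rewrite (_ : (fun z => _) = fun z => f z * g z)//; apply/funext => z; rewrite mulrC.
Qed.

Lemma bcsD f g : bcs f -> bcs g -> bcs (fun z => f z + g z).
Proof.
move=> bf bg; have [mD CD] := bmfD (bcs_bmf bf) (bcs_bmf bg); split=> //.
have [_ _ [L fL]] := bf; have [_ _ [M gM]] := bg; exists (Num.max L M) => z.
by rewrite gt_max => /andP[/fL -> /gM ->]; rewrite addr0.
Qed.

Lemma bcsZ f C : bcs f -> bcs (fun z => C * f z).
Proof. by apply: bcsM; exact: bmf_cst. Qed.

Lemma bcsN f : bcs f -> bcs (fun z => - f z).
Proof.
move=> bf; rewrite (_ : (fun z => _) = fun z => (-1) * f z); first exact: bcsZ.
by apply/funext => z; rewrite mulN1r.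
Qed.

Lemma bcsB f g : bcs f -> bcs g -> bcs (fun z => f z - g z).
Proof. by move=> bf bg; apply: bcsD => //; exact: bcsN. Qed.

Lemma bcs_shift f h : bcs f -> bcs (fun z => f (z + h)).
Proof.
move=> bf; have [mD CD] := bmf_shift h (bcs_bmf bf); split=> //.
have [_ _ [L fL]] := bf; exists (L + `|h|) => z Lz; apply: fL.
have := ler_normB (z + h) h; rewrite addrK; lra.
Qed.

Lemma bcs_norm f : bcs f -> bcs (fun z => `|f z|).
Proof.
move=> [mf [C fC] [L fL]]; split; first exact: measurableT_comp.
- by exists C => z; rewrite normr_id.
- by exists L => z /fL ->; rewrite normr0.
Qed.

Lemma bcs_cube L : bcs (\1_(cube L)).
Proof.
split.
- by apply: measurable_indic; exact: measurable_cube.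
- by exists 1 => z; rewrite indicE; case: (_ \in _); rewrite ?normr1 ?normr0.
- exists L => z Lz; rewrite indicE memNset// /cube/=; apply/negP; by rewrite -ltNge.
Qed.

Lemma I2D f g : bcs f -> bcs g -> I2 (fun z => f z + g z) = I2 f + I2 g.
Proof. by move=> bf bg; rewrite !I2E; apply: RintegralD => //; exact: bcs_integrable. Qed.

Lemma I2B f g : bcs f -> bcs g -> I2 (fun z => f z - g z) = I2 f - I2 g.
Proof. by move=> bf bg; rewrite !I2E; apply: RintegralB => //; exact: bcs_integrable. Qed.

Lemma I2Z f C : bcs f -> I2 (fun z => C * f z) = C * I2 f.
Proof. by move=> bf; rewrite !I2E; apply: RintegralZl => //; exact: bcs_integrable. Qed.

Lemma I2N f : bcs f -> I2 (fun z => - f z) = - I2 f.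
Proof. by move=> bf; rewrite -mulN1r -I2Z//; congr I2; apply/funext => z; rewrite mulN1r. Qed.

Lemma I2_ge0 f : (forall z, 0 <= f z) -> 0 <= I2 f.
Proof. by move=> f0; rewrite I2E; apply: Rintegral_ge0. Qed.

Lemma le_I2 f g : bcs f -> bcs g -> (forall z, f z <= g z) -> I2 f <= I2 g.
Proof. by move=> bf bg fg; rewrite !I2E; apply: le_Rintegral => //; exact: bcs_integrable. Qed.

Lemma le_norm_I2 f g : bcs f -> bcs g -> (forall z, `|f z| <= g z) -> `|I2 f| <= I2 g.
Proof.
move=> bf bg fg; rewrite I2E; apply: (le_trans (le_normr_Rintegral _ _)) => //.
  exact: bcs_integrable.
by rewrite -I2E; apply: le_I2 => //; exact: bcs_norm.
Qed.

Lemma I2_sum n (F : nat -> R * R -> R) : (forall i, bcs (F i)) ->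
  I2 (fun z => \sum_(0 <= i < n) F i z) = \sum_(0 <= i < n) I2 (F i).
Proof.
move=> bF; elim: n => [|n IH].
  rewrite big_geq//; under [in X in I2 X]eq_fun do rewrite big_geq//.
  exact: I2_cst0.
rewrite big_nat_recr//= -IH -I2D//; last first.
  elim: n {IH} => [|n IH]; last first.
    under eq_fun do rewrite big_nat_recr//=; exact: bcsD.
  under eq_fun do rewrite big_geq//.
  by split; [exact: measurable_cst|exists 0 => z; rewrite normr0|exists 0].
by congr I2; apply/funext => z; rewrite big_nat_recr.
Qed.

(** The translated measure agrees with Lebesgue measure on half-open intervals, and these determine
    it. *)
Lemma leb1_shift (a : R) (A : set R) : measurable A ->
  mu ((fun x => x + a) @^-1` A) = mu A.
Proof.
have ms : measurable_fun setT (fun x : measurableTypeR R => x + a : measurableTypeR R).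
  exact: measurable_funD.
move=> mA; rewrite [RHS](@lebesgue_measure_unique R (pushforward mu (fun x : measurableTypeR R => x + a : measurableTypeR R)))//.
move=> _ [[x y] _ <-]; have E : (fun z : R => z + a) @^-1` `]x, y]%classic = `]x - a, y - a]%classic.
  by apply/seteqP; split=> z; rewrite /= !in_itv/= ltrBlDr lerBrDr.
transitivity (mu `]x - a, y - a]); last exact: (congr1 mu (esym E)).
rewrite [LHS]lebesgue_measure_itv [RHS]lebesgue_measure_itv/= !lte_fin ltrD2r.
by case: ifP => // _; rewrite -!EFinB; congr EFin; ring.
Qed.

Lemma leb2_shift h (A : set (R * R)) : measurable A ->
  mu2 ((fun z => z + h) @^-1` A) = mu2 A.
Proof.
move=> mA; have ms := measurable_shift h.
apply/esym; have := @product_measure_unique _ _ (measurableTypeR R) (measurableTypeR R) R mu mu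
  (pushforward mu2 (fun z : measurableTypeR R * measurableTypeR R => (z : R * R) + h
    : measurableTypeR R * measurableTypeR R)).
apply => //.
move=> B C mB mC.
change (mu2 (((fun x : R => x + h.1) @^-1` B) `*` ((fun x : R => x + h.2) @^-1` C)) = (mu B * mu C)%E).
have mD (c : R) : measurable_fun setT (fun x : measurableTypeR R => x + c : measurableTypeR R).
  exact: measurable_funD.
rewrite product_measure1E; last 2 first.
- by rewrite -[X in measurable X]setTI; exact: mD.
- by rewrite -[X in measurable X]setTI; exact: mD.
by congr (_ * _)%E; exact: leb1_shift.
Qed.

Lemma I2_shift f h : bcs f -> I2 (fun z => f (z + h)) = I2 f.
Proof.
move=> bf; rewrite !I2E; congr fine; have ms := measurable_shift h.
have [mf _ _] := bf.
pose T := measurableTypeR R; pose sh (z : T * T) : T * T := (z : R * R) + h.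
have -> : (\int[mu2]_z (f z)%:E = \int[pushforward mu2 sh]_z (f z)%:E)%E.
  by apply: (@eq_measure_integral _ (T * T)%type) => A mA _; rewrite [RHS]leb2_shift.
have mf' : measurable_fun [set: T * T] (EFin \o f) by exact/measurable_EFinP.
rewrite (@integral_pushforward _ _ _ _ _ sh ms mu2 setT _ mf')//.
exact: (bcs_integrable (bcs_shift h bf)).
Qed.

(** The sigma-algebra of the plane is the product one; an open set belongs to it as a countable
    union of squares with rational centre and half-width. *)
Lemma open2_measurable (U : set (R * R)) : open U -> measurable U.
Proof.
move=> oU.
pose B (p q r : rat) : set (R * R) := `]ratr p - ratr r, ratr p + ratr r[%classic `*`
  `]ratr q - ratr r, ratr q + ratr r[%classic.
pose F p q r := if pselect (B p q r `<=` U) then B p q r else set0.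
have -> : U = \bigcup_p \bigcup_q \bigcup_r F p q r.
  apply/seteqP; split=> [[x y] Uxy|z [p _ [q _ [r _]]]]; last first.
    by rewrite /F; case: pselect => // BU; exact: BU.
  move: oU; rewrite openE => /(_ _ Uxy); rewrite /interior/= => /nbhs_ballP[e /= e0 eU].
  have /rat_in_itvoo[r] : 0 < e / 2 by rewrite divr_gt0.
  rewrite in_itv/= => /andP[r0 re].
  have /rat_in_itvoo[p] : x - ratr r < x + ratr r by rewrite ltrBlDr -addrA ltrDl addr_gt0.
  have /rat_in_itvoo[q] : y - ratr r < y + ratr r by rewrite ltrBlDr -addrA ltrDl addr_gt0.
  rewrite !in_itv/= => /andP[yq qy] /andP[xp px].
  have BU : B p q r `<=` U.
    move=> -[a b]; rewrite /B/= !in_itv/= => -[/andP[? ?] /andP[? ?]].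
    apply: eU; split; rewrite /ball/= ltr_norml; apply/andP; split; lra.
  exists p => //; exists q => //; exists r => //.
  have -> : F p q r = B p q r by rewrite /F; case: pselect.
  by rewrite /B/= !in_itv/=; split; apply/andP; split; lra.
do 3 (apply: bigcupT_measurable_rat => ?).
by rewrite /F; case: pselect => ? //=; rewrite /B; apply: measurableX.
Qed.

Lemma continuous2_measurable f : continuous f -> measurable_fun setT f.
Proof.
move=> /continuousP cf; apply: (measurability _ (RGenOpens.measurableE R)).
move=> _ [_ [a [b ->] <-]]; apply: measurableI => //; apply: open2_measurable.
exact/cf/interval_open.
Qed.

Lemma compact2_measurable (K : set (R * R)) : compact K -> measurable K.
Proof.
move=> /compact_closed cK.
have hK : hausdorff_space (R * R)%type by exact: norm_hausdorff.
rewrite -[K]setCK; apply: measurableC; apply: open2_measurable.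
exact/closed_openC/cK.
Qed.

Lemma I2_iter f : bcs f -> I2 f = \int[mu]_x \int[mu]_y f (x, y).
Proof.
move=> bf; have [mf [C fC] [L fL]] := bf.
rewrite I2E /Rintegral -(integral12_prod_meas1 (bcs_integrable bf)); congr fine.
apply: eq_integral => x _; rewrite fineK//; apply: integrable_fin_num => //.
apply: (@bounded_integrable _ _ mu `[- L, L]%classic _ C) => //.
- by rewrite /= lebesgue_measure_itv/=; case: ifP => // _; rewrite -EFinB ltry.
- exact: measurable_fun_pair2.
- move=> y /= /negP; rewrite in_itv/= -ler_norml -ltNge => Ly; apply: fL.
  by rewrite prod_normE/= lt_max Ly orbT.
Qed.

(** Fubini on an abstract space, because it will be used with the plane itself as [T]. *)
Lemma Rintegral_swap d (T : measurableType d) (m : {sigma_finite_measure set T -> \bar R})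
    (A : set T) (F : T * T -> R) (C : R) :
  measurable A -> (m A < +oo)%E -> measurable_fun setT F -> (forall p, `|F p| <= C) ->
  (forall p q : T, ~ A p -> F (p, q) = 0) -> (forall p q : T, ~ A q -> F (p, q) = 0) ->
  \int[m]_p \int[m]_q F (p, q) = \int[m]_q \int[m]_p F (p, q).
Proof.
move=> mA Aoo mF FC F1 F2.
have b1 p : m.-integrable setT (EFin \o (fun q : T => F (p, q))).
  apply: (@bounded_integrable _ _ m A _ C) => //.
  - exact: measurable_fun_pair2.
  - by move=> w; exact: F2.
have b2 q : m.-integrable setT (EFin \o (fun p : T => F (p, q))).
  apply: (@bounded_integrable _ _ m A _ C) => //.
  - exact: measurable_fun_pair1.
  - by move=> z; exact: F1.
have iF : (m \x m)%E.-integrable setT (EFin \o F).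
  apply: (@bounded_integrable _ _ (m \x m)%E (A `*` A) _ C) => //.
  - exact: measurableX.
  - have P : (m A * m A < +oo)%E by rewrite lte_mul_pinfty// ge0_fin_numE.
    by rewrite -product_measure1E// in P.
  - by move=> [z w] /= /not_andP[]; [exact: F1|exact: F2].
have E1 : (\int[m]_p (\int[m]_q F (p, q))%R%:E = \int[m]_p \int[m]_q (F (p, q))%:E)%E.
  by apply: eq_integral => z _; rewrite fineK//; exact: (integrable_fin_num measurableT (b1 z)).
have E2 : (\int[m]_q (\int[m]_p F (p, q))%R%:E = \int[m]_q \int[m]_p (F (p, q))%:E)%E.
  by apply: eq_integral => z _; rewrite fineK//; exact: (integrable_fin_num measurableT (b2 z)).
rewrite {1}/Rintegral E1 [in RHS]/Rintegral E2; congr fine.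
exact: (Fubini iF).
Qed.

(* A name for the product measure, on which the sigma-finite structure can be declared. *)
Definition leb2s : set (measurableTypeR R * measurableTypeR R) -> \bar R := mu2.

HB.instance Definition _ := Measure.on leb2s.

Lemma leb2s_sigma_finite : sigma_finite setT leb2s.
Proof.
exists (fun n => cube n%:R).
  apply/seteqP; split=> // z _; exists (Num.truncn `|z|).+1 => //=.
  by rewrite /cube/= ltW// truncnS_gt.
by move=> n; split; [exact: measurable_cube|exact: leb2_cube_lty].
Qed.

HB.instance Definition _ := Measure_isSigmaFinite.Build _ _ _ leb2s leb2s_sigma_finite.

Lemma I2_swap (F : (R * R) * (R * R) -> R) (C L : R) : measurable_fun setT F ->
  (forall p, `|F p| <= C) -> (forall z w, L < `|z| -> F (z, w) = 0) ->
  (forall z w, L < `|w| -> F (z, w) = 0) ->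
  I2 (fun z => I2 (fun w => F (z, w))) = I2 (fun w => I2 (fun z => F (z, w))).
Proof.
move=> mF FC F1 F2; pose T := (measurableTypeR R * measurableTypeR R)%type.
rewrite !I2E; under eq_fun do rewrite I2E; under [in RHS]eq_fun do rewrite I2E.
apply: (@Rintegral_swap _ T leb2s (cube L) (F : T * T -> R) C (measurable_cube L) (leb2_cube_lty L) mF FC).
- by move=> z w /negP; rewrite -ltNge; exact: F1.
- by move=> z w /negP; rewrite -ltNge; exact: F2.
Qed.
End Integral2.

(** * Smooth functions of two variables and convolution *)

Section Smooth2.
Variable R : realType.
Implicit Types (f g k : R * R -> R) (z h p : R * R) (L C t : R) (b : bool).

Definition ev b : R * R := if b then (1, 0) else (0, 1).

Lemma add_evT z t : z + t *: ev true = (z.1 + t, z.2).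
Proof.
by case: z => x y; congr pair; rewrite /= /GRing.scale/= ?mulr1 ?mulr0 ?addr0.
Qed.

Lemma add_evF z t : z + t *: ev false = (z.1, z.2 + t).
Proof.
by case: z => x y; congr pair; rewrite /= /GRing.scale/= ?mulr1 ?mulr0 ?addr0.
Qed.

(** A relation carries existence and value of the derivative at once, and the rules of calculus
    apply to it directly. *)
Definition has_pd b f g := forall p : R * R, if b
  then is_derive p.1 1 (fun s : R => f (s, p.2)) (g p)
  else is_derive p.2 1 (fun y : R => f (p.1, y)) (g p).

Lemma has_pdE b f g : has_pd b f g -> pderiv b f = g.
Proof.
move=> fg; apply/funext => p; have := fg p; rewrite /pderiv; case: b {fg} => fg;
  by rewrite derive1E; have [_ ->] := fg.
Qed.

Lemma has_pd_pderivable b f g p : has_pd b f g -> pderivable b f p.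
Proof. by move=> /(_ p); rewrite /pderivable; case: b => -[]. Qed.

Lemma has_pd_pderiv b f : (forall p, pderivable b f p) -> has_pd b f (pderiv b f).
Proof.
move=> bf p; have := bf p; rewrite /pderivable /pderiv; case: b {bf} => bf;
  by rewrite derive1E; exact: derivableP.
Qed.

Lemma smooth2_class (P : set (R * R -> R)) :
  (forall f, P f -> continuous f /\ forall b, exists2 g, P g & has_pd b f g) ->
  forall f, P f -> smooth2 f.
Proof.
move=> HP f Pf l.
suff [g Pg ->] : exists2 g, P g & iter_pderiv l f = g.
  have [cg dg] := HP _ Pg; split=> // b p; have [k _ gk] := dg b.
  exact: has_pd_pderivable gk.
elim: l => [|b l [g Pg gE]]; first by exists f.
have [_ dg] := HP _ Pg; have [k Pk gk] := dg b; exists k => //.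
by rewrite /= gE; exact: has_pdE.
Qed.

Lemma smooth2_continuous f : smooth2 f -> continuous f.
Proof. by move=> /(_ [::])[]. Qed.

Lemma smooth2_has_pd b f : smooth2 f -> has_pd b f (pderiv b f).
Proof. by move=> /(_ [::])[_ /(_ b)]; exact: has_pd_pderiv. Qed.

Lemma smooth2_pderiv b f : smooth2 f -> smooth2 (pderiv b f).
Proof.
move=> sf l; have := sf (rcons l b); rewrite /iter_pderiv -cats1 foldr_cat/=.
by [].
Qed.

Lemma has_pdM b f g f' g' : has_pd b f f' -> has_pd b g g' ->
  has_pd b (fun z => f z * g z) (fun z => f z * g' z + g z * f' z).
Proof.
move=> ff gg [x y]; have := ff (x, y); have := gg (x, y); case: b {ff gg} => /= gg ff;
  exact: is_deriveM.
Qed.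

Lemma has_pdD b f g f' g' : has_pd b f f' -> has_pd b g g' ->
  has_pd b (fun z => f z + g z) (fun z => f' z + g' z).
Proof.
move=> ff gg [x y]; have := ff (x, y); have := gg (x, y); case: b {ff gg} => /= gg ff;
  exact: is_deriveD.
Qed.

Lemma has_pdZ b f f' C : has_pd b f f' ->
  has_pd b (fun z => C * f z) (fun z => C * f' z).
Proof.
move=> ff [x y]; have := ff (x, y); case: b {ff} => /= ff; exact: is_deriveZ.
Qed.

Lemma is_derive_addr (f : R -> R) (x c d : R) : is_derive (x + c) 1 f d ->
  is_derive x 1 (fun y => f (y + c)) d.
Proof.
move=> fd; have dc : is_derive x 1 (fun y : R => y + c) 1.
  by apply: is_derive_eq; rewrite addr0.
rewrite -[d]mulr1.
exact: (@is_derive1_comp _ f (fun y => y + c)).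
Qed.

Lemma has_pd_shift b f f' h : has_pd b f f' ->
  has_pd b (fun z => f (z + h)) (fun z => f' (z + h)).
Proof.
move=> ff [x y]; have := ff ((x, y) + h); case: h => h1 h2.
case: b {ff} => /= ff.
- exact: (@is_derive_addr (fun s => f (s, y + h2))).
- exact: (@is_derive_addr (fun s => f (x + h1, s))).
Qed.

(** Sums of products of smooth functions: the form that the Leibniz rule preserves. *)
Inductive smooth2_alg : set (R * R -> R) :=
| Alg2_mul f g : smooth2 f -> smooth2 g -> smooth2_alg (fun z => f z * g z)
| Alg2_add f g : smooth2_alg f -> smooth2_alg g -> smooth2_alg (fun z => f z + g z).

Lemma smooth2_alg_smooth f : smooth2_alg f -> smooth2 f.
Proof.
apply: smooth2_class => {}f; elim => {f}.
- move=> f g sf sg; split.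
    by move=> z; apply: cvgM; exact: smooth2_continuous.
  move=> b; exists (fun z => f z * pderiv b g z + g z * pderiv b f z).
    by apply: Alg2_add; (apply: Alg2_mul; [assumption|exact: smooth2_pderiv]).
  by apply: has_pdM; exact: smooth2_has_pd.
- move=> f g _ [cf df] _ [cg dg]; split; first by move=> z; exact: (cvgD (cf z) (cg z)).
  move=> b; have [f' Pf' ff'] := df b; have [g' Pg' gg'] := dg b.
  exists (fun z => f' z + g' z); [exact: Alg2_add|exact: has_pdD].
Qed.

Lemma smooth2M f g : smooth2 f -> smooth2 g -> smooth2 (fun z => f z * g z).
Proof. by move=> sf sg; apply/smooth2_alg_smooth/Alg2_mul. Qed.

Lemma smooth2_cst C : smooth2 (fun=> C).
Proof.
apply: (@smooth2_class [set f | exists C, f = fun=> C]); last by exists C.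
move=> _ [c ->]; split; first by move=> z; exact: cvg_cst.
by move=> b; exists (fun=> 0); [exists 0|case: b => p; exact: is_derive_cst].
Qed.

Lemma smooth2Z f C : smooth2 f -> smooth2 (fun z => C * f z).
Proof. by apply: smooth2M; exact: smooth2_cst. Qed.

Lemma smooth2D f g : smooth2 f -> smooth2 g -> smooth2 (fun z => f z + g z).
Proof.
move=> sf sg; apply: smooth2_alg_smooth.
rewrite (_ : (fun z => _) = fun z => 1 * f z + 1 * g z).
  by apply: Alg2_add; (apply: Alg2_mul; [exact: smooth2_cst|assumption]).
by apply/funext => z; rewrite !mul1r.
Qed.

Lemma smooth2B f g : smooth2 f -> smooth2 g -> smooth2 (fun z => f z - g z).
Proof.
move=> sf sg; rewrite (_ : (fun z => _) = fun z => f z + (-1) * g z).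
  by apply: smooth2D; [assumption|exact: smooth2Z].
by apply/funext => z; rewrite mulN1r.
Qed.

Lemma smooth2_shift f h : smooth2 f -> smooth2 (fun z => f (z + h)).
Proof.
move=> sf; apply: (@smooth2_class [set g | exists2 f, smooth2 f & g = fun z => f (z + h)]); last by exists f.
move=> _ [g sg ->]; split.
  move=> z; apply: (@continuous_comp _ _ _ (fun z => z + h) g); last exact: smooth2_continuous.
  exact: (cvgD cvg_id (cvg_cst _)).
move=> b; exists (fun z => pderiv b g (z + h)); last exact/has_pd_shift/smooth2_has_pd.
by exists (pderiv b g); [exact: smooth2_pderiv|].
Qed.

(** Continuity is derived rather than required: bounded first partial derivatives make every
    derivative Lipschitz. *)
Definition smoothb k := forall l : seq bool,
  (forall b p, pderivable b (iter_pderiv l k) p) /\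
  exists C : R, forall p, `|iter_pderiv l k p| <= C.

Lemma smoothb_has_pd b k : smoothb k -> has_pd b k (pderiv b k).
Proof. by move=> /(_ [::])[/(_ b) kb _]; exact: has_pd_pderiv. Qed.

Lemma smoothb_bound k : smoothb k -> exists2 C : R, 0 <= C & forall p, `|k p| <= C.
Proof.
by move=> /(_ [::])[_ [C kC]]; exists C => //; exact: le_trans (kC 0).
Qed.

Lemma smoothb_pderiv b k : smoothb k -> smoothb (pderiv b k).
Proof. by move=> sk l; have := sk (rcons l b); rewrite /iter_pderiv -cats1 foldr_cat. Qed.

Lemma is_derive_line b f g z t : has_pd b f g ->
  is_derive t 1 (fun s : R => f (z + s *: ev b)) (g (z + t *: ev b)).
Proof.
move=> fg; case: b fg => fg.
- have -> : (fun s : R => f (z + s *: ev true)) = fun s => f (s + z.1, z.2).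
    by apply/funext => s; rewrite add_evT addrC.
  rewrite add_evT (addrC z.1); apply: (@is_derive_addr (fun s => f (s, z.2))).
  exact: (fg (t + z.1, z.2)).
- have -> : (fun s : R => f (z + s *: ev false)) = fun s => f (z.1, s + z.2).
    by apply/funext => s; rewrite add_evF addrC.
  rewrite add_evF (addrC z.2); apply: (@is_derive_addr (fun s => f (z.1, s))).
  exact: (fg (z.1, t + z.2)).
Qed.

Lemma line_mvt_bound b f g z t C : has_pd b f g -> (forall p, `|g p| <= C) ->
  `|f (z + t *: ev b) - f z| <= C * `|t|.
Proof.
move=> fg gC; have := @mvt_bound _ (fun s => f (z + s *: ev b)) (fun s => g (z + s *: ev b)) 0 t C.
by rewrite scale0r addr0 subr0; apply => // x; exact: is_derive_line.
Qed.

Lemma line_mvt2_bound b f g z t C : has_pd b f g ->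
  (forall p s, `|g (p + s *: ev b) - g p| <= C * `|s|) ->
  `|f (z + t *: ev b) - f z - t * g z| <= C * t ^+ 2.
Proof.
move=> fg gC.
have d (s : R) : is_derive s 1 (fun s : R => f (z + s *: ev b)) (g (z + s *: ev b)).
  exact: is_derive_line.
have C0 : 0 <= C.
  by have := gC 0 1; rewrite normr1 mulr1; exact: le_trans.
suff [c ct E] : exists2 c, `|c| <= `|t| & f (z + t *: ev b) - f z = g (z + c *: ev b) * t.
  rewrite E (mulrC t) -mulrBl normrM (le_trans (ler_wpM2r _ (gC _ _)))//.
  by rewrite -mulrA ler_wpM2l// -[leRHS]real_normK ?num_real// expr2 ler_wpM2r.
have [t0|t0|<-] := ltgtP 0 t.
- have [c /andP[c0 ct] E] := mvt d t0; exists c; first by rewrite !ger0_norm ?ltW.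
  by move: E; rewrite scale0r addr0 subr0.
- have [c /andP[c0 ct] E] := mvt d t0; exists c; first by rewrite !ltr0_norm// lerN2 ltW.
  by move: E; rewrite scale0r addr0 sub0r mulrN -opprB => /eqP; rewrite eqr_opp => /eqP.
- by exists 0 => //; rewrite scale0r addr0 subrr mulr0.
Qed.

(** A quadratic remainder can be integrated in a parameter, so this criterion does the work of a
    theorem on differentiation under the integral sign. *)
Lemma is_derive_quadratic (f : R -> R) (x d C : R) :
  (forall t, `|f (x + t) - f x - t * d| <= C * t ^+ 2) -> is_derive x 1 f d.
Proof.
move=> H.
suff cv : (fun h : R => h^-1 *: (f (h *: 1 + x) - f x)) @ 0^' --> d.
  by split; [exact: cvgP cv|apply: cvg_lim cv].
apply/cvgrPdist_le => e e0.
have C0 : 0 <= C by have := H 1; rewrite expr1n mulr1; exact: le_trans.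
near=> t.
have t0 : t != 0 by near: t; exact: nbhs_dnbhs_neq.
rewrite /GRing.scale/= mulr1 (_ : d - _ = - (t^-1 * (f (x + t) - f x - t * d))); last first.
  by rewrite [t + x]addrC [in RHS]mulrBr mulKf// opprB.
rewrite normrN normrM (le_trans (ler_wpM2l _ (H t)))//.
rewrite normfV -[t ^+ 2]real_normK ?num_real// mulrCA expr2 mulKf ?normr_eq0//.
rewrite (@le_trans _ _ ((C + 1) * `|t|)) ?ler_wpM2r ?lerDl//.
rewrite mulrC -ler_pdivlMr ?ltr_wpDl//.
near: t; apply: dnbhs0_le; by rewrite divr_gt0// ltr_wpDl.
Unshelve. all: by end_near. Qed.

Lemma smoothb_lipschitz k : smoothb k ->
  exists2 C : R, 0 <= C & forall p q, `|k p - k q| <= C * `|p - q|.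
Proof.
move=> sk.
have [C C0 CP] := smoothb_bound (smoothb_pderiv true sk).
have [D D0 DP] := smoothb_bound (smoothb_pderiv false sk).
exists (C + D) => [|[p1 p2] [q1 q2]]; first exact: addr_ge0.
have := line_mvt_bound (q1, p2) (p1 - q1) (smoothb_has_pd true sk) CP.
have := line_mvt_bound (q1, q2) (p2 - q2) (smoothb_has_pd false sk) DP.
rewrite add_evT add_evF /= (addrC q1) subrK (addrC q2) subrK => H1 H2.
rewrite prod_normE/= mulrDl.
rewrite -[X in `|X|](subrKA (k (q1, p2))) (le_trans (ler_normD _ _))// lerD//.
  by rewrite (le_trans H2)// ler_wpM2l// le_max lexx.
by rewrite (le_trans H1)// ler_wpM2l// le_max lexx orbT.
Qed.

Lemma lipschitz_continuous2 f C : 0 <= C ->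
  (forall p q, `|f p - f q| <= C * `|p - q|) -> continuous f.
Proof.
move=> C0 H p; apply/cvgrPdist_le => e e0.
have /filterS : nbhs (p : R * R) (ball p (e / (C + 1))).
  by apply: nbhsx_ballx; rewrite divr_gt0// ltr_wpDl.
apply => q [/ltW b1 /ltW b2]; rewrite (le_trans (H _ _))//.
rewrite (@le_trans _ _ ((C + 1) * `|p - q|)) ?ler_wpM2r ?lerDl//.
rewrite mulrC -ler_pdivlMr ?ltr_wpDl//.
by rewrite prod_normE ge_max; apply/andP.
Qed.

Lemma smoothb_continuous k : smoothb k -> continuous k.
Proof. by move=> /smoothb_lipschitz[C C0 HC]; exact: lipschitz_continuous2 HC. Qed.

Lemma smoothb_smooth2 k : smoothb k -> smooth2 k.
Proof.
apply: smooth2_class => {}k sk; split; first exact: smoothb_continuous.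
by move=> b; exists (pderiv b k); [exact: smoothb_pderiv|exact: smoothb_has_pd].
Qed.

Lemma smoothb_bmf k : smoothb k -> bmf k.
Proof.
move=> sk; split; first (apply: continuous2_measurable; exact: smoothb_continuous).
by have [C _ kC] := smoothb_bound sk; exists C.
Qed.

Definition conv k g z : R := I2 (fun w => k (z - w) * g w).

Lemma measurable_reflect z : measurable_fun setT (fun w : R * R => z - w).
Proof.
by apply/measurable_fun_pairP; split; apply: measurable_funB => //; exact: measurable_cst.
Qed.

Lemma bmf_reflect k z : bmf k -> bmf (fun w => k (z - w)).
Proof.
move=> [mk [C kC]]; split; last by exists C.
by apply: measurableT_comp => //; exact: measurable_reflect.
Qed.

Lemma bcs_conv_integrand k g z : bmf k -> bcs g -> bcs (fun w => k (z - w) * g w).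
Proof. by move=> bk bg; apply: bcsM => //; exact: bmf_reflect. Qed.

Lemma conv_le k g z C : bmf k -> bcs g -> (forall p, `|k p| <= C) ->
  `|conv k g z| <= C * I2 (fun w => `|g w|).
Proof.
move=> bk bg kC; rewrite -I2Z; last exact: bcs_norm.
apply: le_norm_I2; first exact: bcs_conv_integrand.
  by apply: bcsZ; exact: bcs_norm.
by move=> w; rewrite normrM ler_wpM2r.
Qed.

Lemma conv_lipschitz k g : smoothb k -> bcs g ->
  exists2 C : R, 0 <= C & forall p q, `|conv k g p - conv k g q| <= C * `|p - q|.
Proof.
move=> sk bg; have [C C0 kC] := smoothb_lipschitz sk.
have bk := smoothb_bmf sk.
exists (C * I2 (fun w => `|g w|)) => [|p q].
  by rewrite mulr_ge0//; apply: I2_ge0.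
rewrite /conv -I2B; try exact: bcs_conv_integrand.
rewrite mulrAC -I2Z; last exact: bcs_norm.
apply: le_norm_I2.
- by apply: bcsB; exact: bcs_conv_integrand.
- by apply: bcsZ; exact: bcs_norm.
move=> w; rewrite -mulrBl normrM ler_wpM2r// (le_trans (kC _ _))//.
by rewrite opprB addrA subrK.
Qed.

(** Second derivatives of the kernel are bounded, so its Taylor remainder is quadratic uniformly in
    the integration variable; integrated against |g| it bounds the remainder of the convolution. *)
Lemma conv_has_pd b k g : smoothb k -> bcs g ->
  has_pd b (conv k g) (conv (pderiv b k) g).
Proof.
move=> sk bg.
have sk' := smoothb_pderiv b sk; have bk' := smoothb_bmf sk'.
have bk := smoothb_bmf sk.
have [C C0 kC] := smoothb_bound (smoothb_pderiv b sk').
have H z t : `|conv k g (z + t *: ev b) - conv k g z - t * conv (pderiv b k) g z|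
    <= (C * I2 (fun w => `|g w|)) * t ^+ 2.
  rewrite /conv -I2Z; last exact: bcs_conv_integrand.
  rewrite -!I2B; try exact: bcs_conv_integrand; last 2 first.
  - by apply: bcsB; exact: bcs_conv_integrand.
  - by apply: bcsZ; exact: bcs_conv_integrand.
  rewrite mulrAC -I2Z; last exact: bcs_norm.
  apply: le_norm_I2.
  - apply: bcsB; first by apply: bcsB; exact: bcs_conv_integrand.
    by apply: bcsZ; exact: bcs_conv_integrand.
  - by apply: bcsZ; exact: bcs_norm.
  move=> w; rewrite mulrA -!mulrBl normrM ler_wpM2r// (addrAC z).
  apply: line_mvt2_bound; first exact: smoothb_has_pd.
  by move=> p s; apply: line_mvt_bound kC; exact: smoothb_has_pd.
move=> p; case: b sk' bk' kC H => sk' bk' kC H.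
- apply: (@is_derive_quadratic _ _ _ (C * I2 (fun w => `|g w|))) => t.
  by have := H p t; rewrite add_evT -surjective_pairing.
- apply: (@is_derive_quadratic _ _ _ (C * I2 (fun w => `|g w|))) => t.
  by have := H p t; rewrite add_evF -surjective_pairing.
Qed.

Lemma conv_smooth2 k g : smoothb k -> bcs g -> smooth2 (conv k g).
Proof.
move=> sk bg; apply: (@smooth2_class [set f | exists2 k, smoothb k & f = conv k g]); last by exists k.
move=> _ [{sk}k sk ->]; split.
  by have [C C0 kC] := conv_lipschitz sk bg; exact: lipschitz_continuous2 kC.
move=> b; exists (conv (pderiv b k) g); last exact: conv_has_pd.
by exists (pderiv b k); [exact: smoothb_pderiv|].
Qed.

Lemma conv_bmf k g : smoothb k -> bcs g -> bmf (conv k g).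
Proof.
move=> sk bg; split.
  apply: continuous2_measurable; have [C C0 kC] := conv_lipschitz sk bg.
  exact: lipschitz_continuous2 kC.
have [C C0 kC] := smoothb_bound sk; exists (C * I2 (fun w => `|g w|)) => z.
by apply: conv_le => //; exact: smoothb_bmf.
Qed.

Lemma conv_support k g (r : R) (A : set (R * R)) z :
  (forall p, r < `|p| -> k p = 0) -> (forall w, ~ A w -> g w = 0) ->
  (forall w, A w -> r < `|z - w|) -> conv k g z = 0.
Proof.
move=> k0 g0 zA; rewrite /conv (_ : (fun w => _) = fun=> 0).
  exact: I2_cst0.
apply/funext => w; have [Aw|/g0 ->] := pselect (A w); last by rewrite mulr0.
by rewrite k0 ?mul0r//; exact: zA.
Qed.

Lemma conv_bcs k g : smoothb k -> bcs k -> bcs g -> bcs (conv k g).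
Proof.
move=> sk [_ _ [r kr]] bg; have [mc Cc] := conv_bmf sk bg; split=> //.
have [_ _ [L gL]] := bg; exists (L + r) => z Lz.
apply: (@conv_support _ _ r (cube L)) => //.
  by move=> w /negP; rewrite -ltNge; exact: gL.
move=> w; rewrite /cube/= => wL; have := ler_normD (z - w) w; rewrite subrK; lra.
Qed.

Lemma measurable_sub2 :
  measurable_fun setT (fun p : (R * R) * (R * R) => p.1 - p.2).
Proof.
by apply/measurable_fun_pairP; split; apply: measurable_funB; exact: measurableT_comp.
Qed.

Definition reflect k : R * R -> R := fun z => k (- z).

(** Fubini exchanges the two points in k(z - w), which reflects the kernel. *)
Lemma conv_dual k f g : smoothb k -> bcs f -> bcs g ->
  I2 (fun z => f z * conv k g z) = I2 (fun w => g w * conv (reflect k) f w).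
Proof.
move=> sk bf bg; have bk := smoothb_bmf sk.
have [mf [Cf fC] [Lf fL]] := bf; have [mg [Cg gC] [Lg gL]] := bg.
have [mk [Ck kC]] := bk.
pose F (p : (R * R) * (R * R)) := f p.1 * (k (p.1 - p.2) * g p.2).
rewrite (_ : (fun z => _) = fun z => I2 (fun w => F (z, w))); last first.
  by apply/funext => z; rewrite /conv -I2Z//; exact: bcs_conv_integrand.
rewrite (@I2_swap _ F (Cf * (Ck * Cg)) (Num.max Lf Lg)).
- congr I2; apply/funext => w; rewrite /conv -I2Z; last first.
    apply: bcs_conv_integrand => //; split; last by exists Ck => z; exact: kC.
    apply: measurableT_comp => //; have := measurable_reflect 0.
    by under eq_fun do rewrite sub0r.
  by congr I2; apply/funext => z; rewrite /F /reflect/= opprB; ring.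
- apply: measurable_funM; first exact: measurableT_comp.
  apply: measurable_funM; last exact: measurableT_comp.
  by apply: measurableT_comp => //; exact: measurable_sub2.
- by move=> [z w]; rewrite /F/= !normrM ler_pM ?mulr_ge0// ler_pM.
- by move=> z w; rewrite gt_max => /andP[/fL fz _]; rewrite /F/= fz mul0r.
- by move=> z w; rewrite gt_max => /andP[_ /gL gz]; rewrite /F/= gz !mulr0.
Qed.

End Smooth2.

(** * Mollifiers and increment kernels *)

Section Kernels.
Variable R : realType.
Implicit Types (f g k : R * R -> R) (p q T r : R -> R) (z : R * R) (L C t e : R) (y b : bool).
Notation mu := (@lebesgue_measure R).

Definition smoothb1 p := smooth1 p /\ forall n, exists C : R, forall x, `|derive1n n p x| <= C.

Definition tens p q : R * R -> R := fun z => p z.1 * q z.2.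

Lemma tens_has_pdT p q p' : (forall x : R, is_derive x 1 p (p' x)) ->
  has_pd true (tens p q) (tens p' q).
Proof.
move=> pp z; rewrite /tens/=.
have := @is_deriveM _ _ p (fun=> q z.2) z.1 1 _ _ (pp z.1) (is_derive_cst _ _ _).
by move=> H; apply: (is_derive_eq H); rewrite scaler0 add0r /GRing.scale/= mulrC.
Qed.

Lemma tens_has_pdF p q q' : (forall x : R, is_derive x 1 q (q' x)) ->
  has_pd false (tens p q) (tens p q').
Proof.
move=> qq z; rewrite /tens/=.
have := @is_deriveM _ _ (fun=> p z.1) q z.2 1 _ _ (is_derive_cst _ _ _) (qq z.2).
by move=> H; apply: (is_derive_eq H); rewrite scaler0 addr0.
Qed.

Lemma tens_smooth2 p q : smooth1 p -> smooth1 q -> smooth2 (tens p q).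
Proof.
move=> sp sq.
apply: (@smooth2_class _ [set f | exists p q, [/\ smooth1 p, smooth1 q & f = tens p q]]); last first.
  by exists p, q; split.
move=> _ [{sp}p [{sq}q [sp sq ->]]]; split.
  move=> z; rewrite /tens; apply: cvgM.
    by apply: (@continuous_comp _ _ _ fst p); [exact: cvg_fst|exact: smooth1_continuous].
  by apply: (@continuous_comp _ _ _ snd q); [exact: cvg_snd|exact: smooth1_continuous].
case.
- exists (tens (derive1 p) q).
    by exists (derive1 p), q; split; [exact: smooth1_derive|assumption|].
  by apply: tens_has_pdT => x; exact: smooth1_is_derive.
- exists (tens p (derive1 q)).
    by exists p, (derive1 q); split; [assumption|exact: smooth1_derive|].
  by apply: tens_has_pdF => x; exact: smooth1_is_derive.
Qed.

Lemma smoothb1_derive p : smoothb1 p -> smoothb1 (derive1 p).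
Proof.
move=> [sp bp]; split; first exact: smooth1_derive.
by move=> n; have := bp n.+1; rewrite derive1Sn.
Qed.

Lemma smoothb1_bound p : smoothb1 p -> exists C : R, forall x, `|p x| <= C.
Proof. by move=> [_ /(_ 0)]. Qed.

Lemma tens_smoothb p q : smoothb1 p -> smoothb1 q -> smoothb (tens p q).
Proof.
move=> sp sq l.
suff [p' [q' [sp' sq' ->]]] : exists p' q', [/\ smoothb1 p', smoothb1 q' &
    iter_pderiv l (tens p q) = tens p' q'].
  split=> [b z|].
    have := @tens_smooth2 p' q' sp'.1 sq'.1 => /(_ [::])[_]; exact.
  have [C pC] := smoothb1_bound sp'; have [D qD] := smoothb1_bound sq'.
  by exists (C * D) => z; rewrite normrM ler_pM.
elim: l => [|b l [p' [q' [sp' sq' E]]]]; first by exists p, q.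
rewrite /= E; case: b.
- exists (derive1 p'), q'; split; [exact: smoothb1_derive|assumption|].
  by apply: has_pdE; apply: tens_has_pdT => x; apply: smooth1_is_derive; case: sp'.
- exists p', (derive1 q'); split; [assumption|exact: smoothb1_derive|].
  by apply: has_pdE; apply: tens_has_pdF => x; apply: smooth1_is_derive; case: sq'.
Qed.

Lemma compact_smoothb1 p L : 0 <= L -> smooth1 p -> (forall x, L <= `|x| -> p x = 0) -> smoothb1 p.
Proof.
move=> L0 sp p0; split=> // n.
have sn : smooth1 (derive1n n p).
  by elim: n => [|n IH]; [assumption|rewrite derive1nS; exact: smooth1_derive].
(* The strict inequality leaves a neighbourhood on which the function vanishes, so its derivative
   vanishes there too. *)
have n0 x : L < `|x| -> derive1n n p x = 0.
  elim: n {sn} x => [|n IH] x Lx; first by rewrite /= p0// ltW.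
  rewrite derive1nS derive1E.
  have H : \near x, derive1n n p x = cst 0 x.
    have : \forall w \near x, L < `|w|.
      apply/nbhs_ballP; exists (`|x| - L) => /=; first by rewrite subr_gt0.
      move=> w; rewrite /ball/= => xw; have := ler_normD (x - w) w.
      rewrite subrK; lra.
    by apply: filterS => w; exact: IH.
  by rewrite (near_eq_derive _ H)// derive_cst.
have cn : {within `[- L, L], continuous (fun x => `|derive1n n p x|)}.
  apply: continuous_subspaceT => x; apply: continuous_comp.
    exact: smooth1_continuous.
  exact: (@norm_continuous _ R^o).
have LL : - L <= L by lra.
have [c _ cmax] := EVT_max LL cn.
exists (`|derive1n n p c|) => x.
have [xL|Lx] := leP `|x| L; last by rewrite n0// normr0.
by apply: cmax; rewrite in_itv/= -ler_norml.
Qed.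

(** A Heaviside function [T] smoothed at scale [e], with density [r]; the density has mass 1 because
    [T] climbs from 0 to 1. *)
Definition is_step e T r := smooth1 r /\
    [/\ forall x : R, is_derive x 1 T (r x), forall x, 0 <= r x,
        forall x, e <= `|x| -> r x = 0,
        forall x, x <= - e -> T x = 0 & forall x, e <= x -> T x = 1].

(** Adjoints of convolutions reflect the kernel, and [r] is not assumed even, so the reflected
    density needs a step of its own. *)
Lemma is_step_reflect e T r : is_step e T r ->
  is_step e (fun x => 1 - T (- x)) (fun x => r (- x)).
Proof.
move=> [sr [Tr r0 re T0 T1]]; split.
  rewrite (_ : (fun x => _) = fun x => r ((-1) * x + 0)); first exact: smooth1_affine.
  by apply/funext => x; rewrite mulN1r addr0.
split.
- move=> x; have dN : is_derive x 1 (fun x : R => - x) (-1) by exact: is_deriveN.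
  have := is_deriveB (is_derive_cst (1 : R) x 1) (@is_derive1_comp _ T (fun x : R => - x) x _ _ (Tr _) dN).
  by move=> H; apply: (is_derive_eq H); rewrite mulrN1 opprK add0r.
- by move=> x; exact: r0.
- by move=> x ex; apply: re; rewrite normrN.
- by move=> x xe; rewrite T1 ?subrr//; lra.
- by move=> x xe; rewrite T0 ?subr0//; lra.
Qed.

Lemma is_step_smoothb1 e T r : 0 <= e -> is_step e T r -> smoothb1 r.
Proof. by move=> e0 [sr [_ _ re _ _]]; exact: (compact_smoothb1 e0). Qed.

Lemma is_step_smooth1 e T r : is_step e T r -> smooth1 T.
Proof. by move=> [sr [Tr _ _ _ _]]; exact: smooth1_prim Tr. Qed.

Lemma is_step_bound e T r x : is_step e T r -> 0 <= T x <= 1.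
Proof.
move=> [sr [Tr r0 re T0 T1]].
have mono (s t : R) : s <= t -> T s <= T t.
  rewrite le_eqVlt => /predU1P[->//|st]; have [c _ E] := mvt Tr st.
  by rewrite -subr_ge0 E mulr_ge0// subr_ge0 ltW.
apply/andP; split.
- have [xe|/ltW xe] := leP x (- e); first by rewrite T0.
  by rewrite -(T0 (- e))// mono.
- have [xe|/ltW xe] := leP e x; first by rewrite T1.
  by rewrite -(T1 e)// mono.
Qed.

Lemma is_step_smoothb1T e T r : 0 <= e -> is_step e T r -> smoothb1 T.
Proof.
move=> e0 sT; split; first exact: is_step_smooth1 sT.
have [_ br] := is_step_smoothb1 e0 sT.
case=> [|n].
  by exists 1 => x; have /andP[T0 T1] := is_step_bound x sT; rewrite /= ger0_norm.
have [C rC] := br n; exists C => x; rewrite derive1Sn (_ : derive1 T = r)//.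
by apply/funext => t; rewrite derive1E; have [_ [Tr _ _ _ _]] := sT; have [_ ->] := Tr t.
Qed.

Lemma is_step_integral e T r t : 0 < e -> is_step e T r ->
  \int[mu]_s r (t - s) = 1.
Proof.
move=> e0 sT; have [sr [Tr r0 re T0 T1]] := sT.
have lt : t - e < t + e by lra.
have E : (fun s => r (t - s)) = (fun s => r (t - s)) \_ `[t - e, t + e].
  apply/funext => s; rewrite patchE mem_setE in_itv/=; case: ifPn => // H.
  apply: re; rewrite ler_normr; move: H; rewrite negb_and -!ltNge => /orP[H|H].
    by apply/orP; left; lra.
  by apply/orP; right; lra.
rewrite E -Rintegral_mkcond /Rintegral.
have dF (s : R) : is_derive s 1 (fun s => - T (t - s)) (r (t - s)).
  have dN : is_derive s 1 (fun s : R => t - s) (-1).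
    by apply: (is_derive_eq (is_deriveB (is_derive_cst t s 1) (is_derive_id s 1))); rewrite sub0r.
  apply: (is_derive_eq (is_deriveN (@is_derive1_comp _ T (fun s : R => t - s) s _ _ (Tr _) dN))).
  by rewrite mulrN1 opprK.
rewrite (@continuous_FTC2 _ _ (fun s => - T (t - s)))//.
- rewrite -EFinB/= T0; last by lra.
  by rewrite T1; lra.
- apply: continuous_subspaceT => s; apply: (@continuous_comp _ _ _ (fun s => t - s) r).
    exact: (cvgB (cvg_cst t) cvg_id).
  exact: smooth1_continuous.
- have cF s : {for s, continuous (fun s => - T (t - s))}.
    by apply/differentiable_continuous/derivable1_diffP; have [] := dF s.
  split; first by move=> s _; have [] := dF s.
    exact: cvg_at_right_filter (cF _).
  exact: cvg_at_left_filter (cF _).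
- by move=> s _; rewrite derive1E; have [_ ->] := dF s.
Qed.

(** [p] acts along the direction [y] and [q] across it, so that both axes are treated at once. *)
Definition kern y p q := if y then tens p q else tens q p.

Lemma kern_smoothb y p q : smoothb1 p -> smoothb1 q -> smoothb (kern y p q).
Proof. by move=> sp sq; case: y; exact: tens_smoothb. Qed.

Lemma kern_has_pd y p q p' : (forall x : R, is_derive x 1 p (p' x)) ->
  has_pd y (kern y p q) (kern y p' q).
Proof. by case: y => pp; [exact: tens_has_pdT|exact: tens_has_pdF]. Qed.

Lemma kern_diff y p q t z :
  kern y (fun x => p (x + t) - p x) q z = kern y p q (z + t *: ev R y) - kern y p q z.
Proof.
by case: y; rewrite ?add_evT ?add_evF /kern /tens/=; [rewrite mulrBl|rewrite mulrBr].
Qed.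

Lemma tens_unit e T1 T2 r1 r2 z : 0 < e -> is_step e T1 r1 -> is_step e T2 r2 ->
  bcs (tens r1 r2) /\ I2 (fun w => tens r1 r2 (z - w)) = 1.
Proof.
move=> e0 s1 s2.
have b : bcs (tens r1 r2).
  have [m C] : bmf (tens r1 r2).
    apply/smoothb_bmf/tens_smoothb; first exact: (is_step_smoothb1 (ltW e0) s1).
    exact: (is_step_smoothb1 (ltW e0) s2).
  split => //; exists e => w; rewrite prod_normE/= lt_max /tens.
  have [_ [_ _ re1 _ _]] := s1; have [_ [_ _ re2 _ _]] := s2.
  by case/orP=> /ltW H; [rewrite re1 ?mul0r|rewrite re2 ?mulr0].
split=> //.
have bw : bcs (fun w => tens r1 r2 (z - w)).
  have [_ [C kC] [L kL]] := b; have [m _] := bmf_reflect z (bcs_bmf b).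
  split=> //; first by exists C.
  exists (L + `|z|) => w Lw; apply: kL.
  by have := ler_normB z (z - w); rewrite subKr; lra.
rewrite I2_iter// /tens/=.
have i1 (r : R -> R) T t : is_step e T r -> mu.-integrable setT (EFin \o (fun s => r (t - s))).
  move=> st; have [_ [_ _ re _ _]] := st.
  have sr := is_step_smoothb1 (ltW e0) st.
  have [C rC] := smoothb1_bound sr.
  apply: (@bounded_integrable _ _ _ mu `[t - e, t + e]%classic _ C) => //.
  - by rewrite /= lebesgue_measure_itv/=; case: ifP => // _; rewrite -EFinB ltry.
  - apply: continuous_measurable_fun => s; apply: (@continuous_comp _ _ _ (fun s => t - s) r).
      exact: (cvgB (cvg_cst t) cvg_id).
    by apply: smooth1_continuous; case: sr.
  - move=> s /= /negP; rewrite in_itv/= => H; apply: re; rewrite ler_normr.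
    move: H; rewrite negb_and -!ltNge => /orP[H|H]; apply/orP; [left|right]; lra.
transitivity (\int[mu]_x r1 (z.1 - x)); last exact: is_step_integral s1.
apply: eq_Rintegral => x _; rewrite RintegralZl//; last exact: i1 s2.
by rewrite (is_step_integral _ e0 s2) mulr1.
Qed.

Lemma kern_unit y e T1 T2 r1 r2 z : 0 < e -> is_step e T1 r1 -> is_step e T2 r2 ->
  bcs (kern y r1 r2) /\ I2 (fun w => kern y r1 r2 (z - w)) = 1.
Proof. by move=> e0 s1 s2; case: y; [exact: tens_unit s1 s2|exact: tens_unit s2 s1]. Qed.

Lemma kern_ge0 y p q z : (forall x, 0 <= p x) -> (forall x, 0 <= q x) -> 0 <= kern y p q z.
Proof. by move=> p0 q0; case: y; rewrite /kern /tens mulr_ge0. Qed.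

Lemma conv_unit_le k f z C : bmf k -> (forall w, 0 <= k w) -> bcs (fun w => k (z - w)) ->
  I2 (fun w => k (z - w)) = 1 -> bcs f -> (forall w, `|f w| <= C) -> `|conv k f z| <= C.
Proof.
move=> bk k0 bz k1 bf fC; rewrite -[C]mulr1 -k1 -I2Z//.
apply: le_norm_I2; [exact: bcs_conv_integrand|exact: bcsZ|].
by move=> w; rewrite normrM (ger0_norm (k0 _)) mulrC ler_wpM2r.
Qed.

Lemma bcs_reflect k z : bcs k -> bcs (fun w => k (z - w)).
Proof.
move=> [mk [C kC] [L kL]]; split; first by have [] := @bmf_reflect _ k z (conj mk (ex_intro _ C kC)).
  by exists C.
exists (L + `|z|) => w Lw; apply: kL.
by have := ler_normB z (z - w); rewrite subKr; lra.
Qed.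

Lemma kern_conv_le y e T1 T2 r1 r2 f z C : 0 < e -> is_step e T1 r1 -> is_step e T2 r2 ->
  bcs f -> (forall w, `|f w| <= C) -> `|conv (kern y r1 r2) f z| <= C.
Proof.
move=> e0 s1 s2 bf fC; have [bk k1] := kern_unit y z e0 s1 s2.
apply: conv_unit_le fC => //; [exact: bcs_bmf| |exact: bcs_reflect].
by move=> w; apply: kern_ge0; [have [_ []] := s1|have [_ []] := s2].
Qed.

(** For t >= 0 the factor along [y] is a mollified indicator of [-t, 0]. Its derivative is the
    increment of the mollifier, so convolution with this kernel produces an antiderivative of the
    mollified increment. *)
Definition stepk y t T r := kern y (fun x => T (x + t) - T x) r.

Lemma stepk_smoothb y e t T1 T2 r1 r2 : 0 < e -> is_step e T1 r1 -> is_step e T2 r2 ->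
  smoothb (stepk y t T1 r2).
Proof.
move=> e0 s1 s2; apply: kern_smoothb; last exact: (is_step_smoothb1 (ltW e0) s2).
have [_ [Tr _ _ T0 T1']] := s1.
apply: (@compact_smoothb1 _ (e + `|t|)); first by rewrite addr_ge0// ltW.
  apply: smooth1B; last exact: is_step_smooth1 s1.
  have := @smooth1_affine _ T1 1 t (is_step_smooth1 s1).
  by under eq_fun do rewrite mul1r.
have tn := normr_ge0 t; move=> x; rewrite ler_normr => /orP[H|H].
- by have := ler_norm (- t); rewrite normrN => Ht; rewrite !T1' ?subrr//; lra.
- by have := ler_norm t => Ht; rewrite !T0 ?subrr//; lra.
Qed.

Lemma stepk_support y e t T1 T2 r1 r2 z : 0 <= t -> is_step e T1 r1 -> is_step e T2 r2 ->
  e + t < `|z| -> stepk y t T1 r2 z = 0.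
Proof.
move=> t0 [_ [_ _ _ T0 T1']] [_ [_ _ r0 _ _]].
have A x : e + t < `|x| -> T1 (x + t) - T1 x = 0.
  rewrite ltNge ler_norml negb_and -!ltNge => /orP[H|H]; last first.
    by rewrite !T1' ?subrr//; lra.
  by rewrite !T0 ?subrr//; lra.
have B x : e + t < `|x| -> r2 x = 0.
  by move=> H; apply: r0; lra.
rewrite prod_normE/= lt_max /stepk; case: y; rewrite /kern /tens => /orP[H|H].
- by rewrite A// mul0r.
- by rewrite [X in _ * X]B// mulr0.
- by rewrite B// mul0r.
- by rewrite A// mulr0.
Qed.

Lemma stepk_bcs y e t T1 T2 r1 r2 : 0 < e -> 0 <= t -> is_step e T1 r1 -> is_step e T2 r2 ->
  bcs (stepk y t T1 r2).
Proof.
move=> e0 t0 s1 s2; have [m C] := smoothb_bmf (stepk_smoothb y t e0 s1 s2).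
by split => //; exists (e + t) => z; exact: stepk_support s1 s2.
Qed.

(* The kernel is the increment over [0, t] of an antiderivative of the mollifier,
   so the mean value theorem turns its mass into t. *)
Lemma stepk_conv_le y e t T1 T2 r1 r2 f z C : 0 < e -> 0 <= t ->
  is_step e T1 r1 -> is_step e T2 r2 -> bcs f -> (forall w, `|f w| <= C) ->
  `|conv (stepk y t T1 r2) f z| <= C * t.
Proof.
move=> e0 t0 s1 s2 bf fC.
have [_ [Tr _ _ _ _]] := s1.
have sP : smoothb (kern y T1 r2).
  apply: kern_smoothb; [exact: (is_step_smoothb1T (ltW e0) s1)|exact: (is_step_smoothb1 (ltW e0) s2)].
have bP := smoothb_bmf sP.
have -> : conv (stepk y t T1 r2) f z =
    conv (kern y T1 r2) f (z + t *: ev R y) - conv (kern y T1 r2) f z.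
  rewrite /conv -I2B; [|exact: bcs_conv_integrand|exact: bcs_conv_integrand].
  by congr I2; apply/funext => w; rewrite -mulrBl (addrAC z) /stepk kern_diff.
rewrite -[X in C * X](ger0_norm t0).
apply: (@line_mvt_bound _ y _ (conv (kern y r1 r2) f)); last first.
  by move=> p; exact: (kern_conv_le _ _ e0 s1 s2).
by rewrite -(has_pdE (kern_has_pd y r2 Tr)); exact: conv_has_pd.
Qed.

Lemma stepk_pderiv y t T1 r1 r2 : (forall x : R, is_derive x 1 T1 (r1 x)) ->
  pderiv y (stepk y t T1 r2) =
  (fun z => kern y r1 r2 (z + t *: ev R y) - kern y r1 r2 z).
Proof.
move=> Tr; rewrite (has_pdE (g := kern y (fun x => r1 (x + t) - r1 x) r2)).
  by apply/funext => z; exact: kern_diff.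
apply: kern_has_pd => x; apply: is_deriveB; exact: is_derive_addr.
Qed.

(** With U(x) = 1 - T(-x), the reflected difference T(t - x) - T(-x) equals U(x) - U(x - t): again a
    step kernel, moved by t. Bounds for step kernels thus pass to their reflections. *)
Lemma stepk_reflect y t T1 r2 z : reflect (stepk y t T1 r2) z =
  stepk y t (fun x => 1 - T1 (- x)) (fun x => r2 (- x)) (z + (- t) *: ev R y).
Proof.
rewrite /reflect /stepk /kern /tens; case: y; rewrite ?add_evT ?add_evF/=.
- by congr (_ * _); rewrite subrK (opprB z.1) (addrC t); ring.
- by congr (_ * _); rewrite subrK (opprB z.2) (addrC t); ring.
Qed.

Lemma stepk_conv_reflect_le y e t T1 T2 r1 r2 f z C : 0 < e -> 0 <= t ->
  is_step e T1 r1 -> is_step e T2 r2 -> bcs f -> (forall w, `|f w| <= C) ->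
  `|conv (reflect (stepk y t T1 r2)) f z| <= C * t.
Proof.
move=> e0 t0 /is_step_reflect s1 /is_step_reflect s2 bf fC.
have -> : conv (reflect (stepk y t T1 r2)) f z =
    conv (stepk y t (fun x => 1 - T1 (- x)) (fun x => r2 (- x))) f (z + (- t) *: ev R y).
  by congr I2; apply/funext => w; rewrite stepk_reflect (addrAC z).
exact: (stepk_conv_le _ _ e0 t0 s1 s2).
Qed.

Lemma has_pd_reflect b k k' : has_pd b k k' -> has_pd b (reflect k) (fun z => - reflect k' z).
Proof.
move=> kk z; have := kk (- z); rewrite /reflect; case: b {kk} => /= kk.
- have dN : is_derive z.1 1 (fun x : R => - x) (-1) by exact: is_deriveN.
  apply: (is_derive_eq (@is_derive1_comp _ (fun s => k (s, - z.2)) (fun x : R => - x) z.1 _ _ kk dN)).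
  by rewrite mulrN1.
- have dN : is_derive z.2 1 (fun x : R => - x) (-1) by exact: is_deriveN.
  apply: (is_derive_eq (@is_derive1_comp _ (fun s => k (- z.1, s)) (fun x : R => - x) z.2 _ _ kk dN)).
  by rewrite mulrN1.
Qed.

Lemma smoothb_reflect k : smoothb k -> smoothb (reflect k).
Proof.
move=> sk l.
suff [s Es] : exists s : R, iter_pderiv l (reflect k) = fun z => s * reflect (iter_pderiv l k) z.
  have [dk [C kC]] := sk l; split; last first.
    by exists (`|s| * C) => p; rewrite Es normrM ler_wpM2l//; exact: kC.
  move=> b p; rewrite Es; apply: has_pd_pderivable.
  apply: has_pdZ; apply: has_pd_reflect; exact: has_pd_pderiv.
elim: l => [|b l [s Es]]; first by exists 1; apply/funext => z; rewrite mul1r.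
exists (- s); rewrite /= Es; apply: has_pdE.
have [dk _] := sk l.
have := has_pdZ s (has_pd_reflect (has_pd_pderiv (dk b))).
by under [in X in has_pd _ _ X]eq_fun do rewrite mulrN -mulNr.
Qed.

End Kernels.

(** * Divergences in weak form *)

Section Interaction.
Variable R : realType.
Implicit Types (f g k phi psi : R * R -> R) (z : R * R) (A B : bool -> R * R -> R)
  (L C t e : R) (y b c : bool).

Definition tst phi := smooth2 phi /\ exists L : R, forall z, L < `|z| -> phi z = 0.

Lemma norm_ev (s : R) b : `|s *: ev R b| = `|s|.
Proof.
rewrite normrZ (_ : `|ev R b| = 1) ?mulr1//.
by rewrite prod_normE/ev; case: b => /=; rewrite normr0 normr1; [rewrite max_l|rewrite max_r].
Qed.

Lemma tst_pderiv b phi : tst phi -> tst (pderiv b phi).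
Proof.
move=> [sp [L pL]]; split; first exact: smooth2_pderiv.
exists L => z Lz.
have := is_derive_line z 0 (smooth2_has_pd b sp); rewrite scale0r addr0 => -[_ <-].
suff d0 : is_derive (0 : R) 1 (fun s : R => phi (z + s *: ev R b)) 0 by have [_ ->] := d0.
apply: (@near_eq_is_derive R R R (fun=> 0)).
apply/nbhs_ballP; exists (`|z| - L) => /=; first by rewrite subr_gt0.
move=> s; rewrite /ball/= sub0r normrN => sL; apply/esym/pL.
have := ler_normB (z + s *: ev R b) (s *: ev R b); rewrite addrK norm_ev; lra.
Qed.

Lemma compact_cube L : compact (cube (R := R) L).
Proof. by rewrite cubeE; apply: compact_setX; exact: segment_compact. Qed.

Lemma tst_bcs phi : tst phi -> bcs phi.
Proof.
move=> [sp [L pL]]; have cp := smooth2_continuous sp.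
split; [exact: continuous2_measurable| |by exists L].
have cc : {within cube L, continuous phi} by exact: continuous_subspaceT.
have := continuous_compact cc (@compact_cube L).
move=> /compact_bounded[M [_ Mb]]; exists (`|M + 1|) => z.
have [zL|Lz] := leP `|z| L; last by rewrite pL// normr0.
rewrite (le_trans _ (ler_norm _))//; apply: (Mb (M + 1)); first by rewrite ltrDl.
by exists z.
Qed.

Lemma tst_shift phi h : tst phi -> tst (fun z => phi (z + h)).
Proof.
move=> tp; split; first by apply: smooth2_shift; case: tp.
by have [_ _] := bcs_shift h (tst_bcs tp).
Qed.

Lemma tstB phi psi : tst phi -> tst psi -> tst (fun z => phi z - psi z).
Proof.
move=> tp tq; split; first by apply: smooth2B; [case: tp|case: tq].
by have [_ _] := bcsB (tst_bcs tp) (tst_bcs tq).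
Qed.

Lemma tstMl phi psi : tst phi -> smooth2 psi -> tst (fun z => phi z * psi z).
Proof.
move=> [sp [L pL]] sq; split; first exact: smooth2M.
by exists L => z /pL ->; rewrite mul0r.
Qed.

(* A field A is a pair of components, indexed like the partial derivatives of Defs:
   A true goes with t (density), A false with x (flux). pair2 A phi = - <div A, phi>. *)
Definition pair2 A phi : R :=
  I2 (fun z => A true z * pderiv true phi z + A false z * pderiv false phi z).

Lemma pair2E y A phi : pair2 A phi =
  I2 (fun z => A y z * pderiv y phi z + A (~~ y) z * pderiv (~~ y) phi z).
Proof. by case: y; [exact: erefl|congr I2; apply/funext => z; rewrite addrC]. Qed.

Lemma pair2_integrand A phi : (forall c, bcs (A c)) -> tst phi ->
  bcs (fun z => A true z * pderiv true phi z + A false z * pderiv false phi z).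
Proof.
move=> bA tp; apply: bcsD; apply: bcsM; try exact: bcs_bmf.
  by apply: tst_bcs; exact: tst_pderiv.
by apply: tst_bcs; exact: tst_pderiv.
Qed.

Lemma pair2Br A phi psi : (forall c, bcs (A c)) -> tst phi -> tst psi ->
  pair2 A (fun z => phi z - psi z) = pair2 A phi - pair2 A psi.
Proof.
move=> bA tp tq; rewrite /pair2 -I2B; try exact: pair2_integrand.
congr I2; apply/funext => z.
have E c : pderiv c (fun z => phi z - psi z) = fun z => pderiv c phi z - pderiv c psi z.
  apply: has_pdE.
  have := has_pdD (smooth2_has_pd c tp.1) (has_pdZ (-1) (smooth2_has_pd c tq.1)).
  by under eq_fun do rewrite mulN1r; under [in X in has_pd _ _ X]eq_fun do rewrite mulN1r.
by rewrite !E; ring.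
Qed.

Lemma pair2Bl A B phi : (forall c, bcs (A c)) -> (forall c, bcs (B c)) -> tst phi ->
  pair2 (fun c z => A c z - B c z) phi = pair2 A phi - pair2 B phi.
Proof.
move=> bA bB tp; rewrite /pair2 -I2B; try exact: pair2_integrand.
by congr I2; apply/funext => z; ring.
Qed.

Definition incr t y f z : R := f (z + t *: ev R y) - f z.

Lemma bcs_incr t y f : bcs f -> bcs (incr t y f).
Proof. by move=> bf; apply: bcsB => //; exact: bcs_shift. Qed.

(** A change of variables moves the increment from the field to the test function, where the shift
    changes sign. *)
Lemma pair2_incr t y A phi : (forall c, bcs (A c)) -> tst phi ->
  pair2 (fun c => incr t y (A c)) phi =
  pair2 A (fun z => phi (z - t *: ev R y) - phi z).
Proof.
move=> bA tp.
rewrite (pair2Br bA (tst_shift _ tp) tp).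
rewrite /incr (pair2Bl (fun c => bcs_shift _ (bA c)) bA tp); congr (_ - _).
rewrite {2}/pair2 -(I2_shift (t *: ev R y)); last exact: (pair2_integrand bA (tst_shift _ tp)).
congr I2; apply/funext => z.
by rewrite !(has_pdE (has_pd_shift _ (smooth2_has_pd _ tp.1))) addrK.
Qed.

Lemma conv_incr t y k f z : smoothb k -> bcs f ->
  conv k (incr t y f) z = conv (fun p => k (p + t *: ev R y) - k p) f z.
Proof.
move=> sk bf; have bk := smoothb_bmf sk; have bk' := bmf_shift (t *: ev R y) bk.
pose F w := k (z + t *: ev R y - w) * f w.
have bF : bcs F by exact: bcs_conv_integrand.
transitivity (I2 (fun w => F (w + t *: ev R y)) - I2 (fun w => k (z - w) * f w)).
  rewrite -I2B; [|exact: bcs_shift|exact: bcs_conv_integrand].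
  by congr I2; apply/funext => w; rewrite /F/incr opprD addrACA subrr addr0 mulrBr.
rewrite (I2_shift _ bF) -(I2B bF (bcs_conv_integrand _ bk bf)).
by congr I2; apply/funext => w; rewrite /F (addrAC z) mulrBl.
Qed.

(** All derivatives fall on the kernel, so [g] may be discontinuous; passing to the adjoint, it is
    the mollified [g] that becomes the test function. *)
Lemma pair2_conv k B g : smoothb k -> bcs k -> (forall c, bcs (B c)) -> bcs g ->
  I2 (fun z => g z * (conv (pderiv true k) (B true) z + conv (pderiv false k) (B false) z)) =
  - pair2 B (conv (reflect k) g).
Proof.
move=> sk bk bB bg.
have bc c : bcs (fun z => g z * conv (pderiv c k) (B c) z).
  by apply: bcsMl => //; apply: conv_bmf => //; exact: smoothb_pderiv.
have sr := smoothb_reflect sk.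
have E c : I2 (fun z => g z * conv (pderiv c k) (B c) z) =
    - I2 (fun z => B c z * pderiv c (conv (reflect k) g) z).
  rewrite (conv_dual (smoothb_pderiv c sk) bg (bB c)).
  have dr : pderiv c (reflect k) = fun z => - reflect (pderiv c k) z.
    by apply/has_pdE/has_pd_reflect; exact: smoothb_has_pd.
  rewrite -I2N; last first.
    apply: bcsMl => //; rewrite (has_pdE (conv_has_pd c sr bg)).
    by apply: conv_bmf => //; exact: smoothb_pderiv.
  congr I2; apply/funext => z; rewrite (has_pdE (conv_has_pd c sr bg)) dr -mulrN; congr (_ * _).
  rewrite /conv -I2N.
    by congr I2; apply/funext => w; rewrite mulNr opprK.
  apply: bcsM => //; rewrite (_ : (fun w => _) = fun w => pderiv c (reflect k) (z - w)).
    by apply/bmf_reflect/smoothb_bmf/smoothb_pderiv.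
  by rewrite dr.
under eq_fun do rewrite mulrDr.
rewrite (I2D (bc true) (bc false)) !E /pair2 I2D; first by rewrite opprD.
- apply: bcsMl => //; rewrite (has_pdE (conv_has_pd true sr bg)).
  by apply: conv_bmf => //; exact: smoothb_pderiv.
- apply: bcsMl => //; rewrite (has_pdE (conv_has_pd false sr bg)).
  by apply: conv_bmf => //; exact: smoothb_pderiv.
Qed.

End Interaction.

(** * Upper bound for sums of mollified determinants *)

Section InteractionBound.
Variable R : realType.
Implicit Types (f g k phi psi : R * R -> R) (z : R * R) (A B : bool -> R * R -> R)
  (L C t e N m : R) (y b c : bool).

(* The determinant of the increments of A and of the mollified increments of B. *)
Definition wedge t y A B r psi : R :=
  I2 (fun z => psi z * (incr t y (A y) z * conv r (incr t y (B (~~ y))) z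
                        - incr t y (A (~~ y)) z * conv r (incr t y (B y)) z)).

Section Identity.
Variables (y : bool) (t e : R) (T r : R -> R) (A B : bool -> R * R -> R) (psi : R * R -> R).
Hypotheses (e0 : 0 < e) (t0 : 0 <= t) (sT : is_step e T r).
Hypotheses (bA : forall c, bcs (A c)) (bB : forall c, bcs (B c)) (tpsi : tst psi).

Let K := stepk y t T r.
Let sK : smoothb K. Proof. exact: stepk_smoothb e0 sT sT. Qed.
Let bK : bcs K. Proof. exact: stepk_bcs e0 t0 sT sT. Qed.
Let beta c := conv K (B c).

Let bbeta c : bcs (beta c). Proof. exact: conv_bcs. Qed.
Let sbeta c : smooth2 (beta c). Proof. exact: conv_smooth2. Qed.
Let bdbeta b c : bcs (pderiv b (beta c)).
Proof.
rewrite /beta (has_pdE (conv_has_pd b sK (bB c))); apply: conv_bcs.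
- exact: smoothb_pderiv.
- by apply: tst_bcs; apply: tst_pderiv; split; [exact: smoothb_smooth2|case: bK].
- exact: bB.
Qed.

(** The increment passes from the field to the mollifier, and the increment of the mollifier is the
    [y]-derivative of [K]. This is what [K] was built for. *)
Let mollE c z : conv (kern y r r) (incr t y (B c)) z = pderiv y (beta c) z.
Proof.
have [_ [Tr _ _ _ _]] := sT.
have sr := is_step_smoothb1 (ltW e0) sT.
rewrite conv_incr; [|exact: kern_smoothb|exact: bB].
by rewrite /beta (has_pdE (conv_has_pd y sK (bB c))) /K (stepk_pderiv y t r Tr).
Qed.

(* The increments of B mollified by r are derivatives of beta: the derivative falling on A
   and the one falling on B both produce divergences, and only psi gets differentiated otherwise. *)
Lemma wedgeE : wedge t y A B (kern y r r) psi =
  pair2 A (fun z => psi (z - t *: ev R y) * beta (~~ y) (z - t *: ev R y) - psi z * beta (~~ y) z)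
  - I2 (fun z => beta (~~ y) z * (incr t y (A y) z * pderiv y psi z
                                  + incr t y (A (~~ y)) z * pderiv (~~ y) psi z))
  + pair2 B (conv (reflect K) (fun z => psi z * incr t y (A (~~ y)) z)).
Proof.
have tb : tst (fun z => psi z * beta (~~ y) z) by exact: tstMl.
have bi c : bcs (incr t y (A c)) by exact: bcs_incr.
have bp : bcs psi by exact: tst_bcs.
have bg : bcs (fun z => psi z * incr t y (A (~~ y)) z).
  by apply: bcsM => //; exact: bcs_bmf.
rewrite -(pair2_incr t y bA tb).
have := pair2_conv sK bK bB bg.
move=> /(congr1 -%R); rewrite opprK => <-.
have E : forall z, conv (pderiv true K) (B true) z + conv (pderiv false K) (B false) z =
    pderiv (~~ y) (beta (~~ y)) z + pderiv y (beta y) z.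
  move=> z; rewrite /beta !(has_pdE (conv_has_pd _ sK (bB _))).
  by case: (y) => //; rewrite addrC.
have bd c : bcs (pderiv c psi) by apply: tst_bcs; exact: tst_pderiv.
rewrite (pair2E y) /wedge -[X in _ + X]I2N; last first.
  apply: bcsMl => //; under eq_fun do rewrite E.
  by apply: bmfD; exact: bcs_bmf.
rewrite -I2B; last 2 first.
- apply: bcsD; apply: bcsM; try exact: bcs_bmf.
    by apply: tst_bcs; exact: tst_pderiv.
  by apply: tst_bcs; exact: tst_pderiv.
- apply: bcsM; first exact: bcs_bmf.
  by apply: bcsD; apply: bcsM => //; exact: bcs_bmf.
rewrite -I2D; last 2 first.
- apply: bcsB.
    apply: bcsD; apply: bcsM; try exact: bcs_bmf.
      by apply: tst_bcs; exact: tst_pderiv.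
    by apply: tst_bcs; exact: tst_pderiv.
  apply: bcsM; first exact: bcs_bmf.
  by apply: bcsD; apply: bcsM => //; exact: bcs_bmf.
- apply: bcsN; apply: bcsMl => //; under eq_fun do rewrite E.
  by apply: bmfD; exact: bcs_bmf.
congr I2; apply/funext => z; rewrite E !mollE.
rewrite !(has_pdE (has_pdM (smooth2_has_pd _ tpsi.1) (smooth2_has_pd _ (sbeta _)))).
ring.
Qed.

End Identity.

(** In dual form: the divergence of [A] has total variation at most [N] as seen by test functions
    supported in [S]. *)
Definition tbound (S : set (R * R)) N A := forall phi m, tst phi ->
  (forall z, ~ S z -> phi z = 0) -> (forall z, `|phi z| <= m) -> `|pair2 A phi| <= N * m.

Section Bound.
Variables (y : bool) (t e kappa : R) (T r : R -> R) (psi : R * R -> R).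
Variables (S0 S : set (R * R)) (N P G cA cB : R).
Hypotheses (e0 : 0 < e) (t0 : 0 <= t) (sT : is_step e T r) (tpsi : tst psi).
Hypotheses (psi0 : forall z, ~ S0 z -> psi z = 0) (psiP : forall z, `|psi z| <= P).
Hypothesis S0S : forall z w, S0 w -> `|z - w| <= kappa -> S z.
Hypothesis te_kappa : e + t <= kappa.
Hypothesis GE : G = I2 (fun z => `|pderiv true psi z| + `|pderiv false psi z|).

Let K := stepk y t T r.
Let sK : smoothb K. Proof. exact: stepk_smoothb e0 sT sT. Qed.
Let bK : bcs K. Proof. exact: stepk_bcs e0 t0 sT sT. Qed.

(** The term with the divergence of [B] is set aside, because for a difference of consecutive fields
    it has no small bound. The two other terms of [wedgeE] contain [beta], of size cB t. [S]
    contains the points within kappa of [S0], so shifts by t and kernels of radius e + t keep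
    supports in [S]; [G] is the L^1 size of the gradient of [psi]. *)
Lemma wedge_near A B : (forall c, bcs (A c)) -> (forall c, bcs (B c)) ->
  (forall c z, `|A c z| <= cA) -> (forall c z, `|B c z| <= cB) -> tbound S N A ->
  `|wedge t y A B (kern y r r) psi
    - pair2 B (conv (reflect K) (fun z => psi z * incr t y (A (~~ y)) z))|
  <= t * cB * (2 * N * P + 2 * cA * G).
Proof.
move=> bA bB AcA BcB tbA.
rewrite (wedgeE y e0 t0 sT bA bB tpsi) addrK.
have P0 : 0 <= P by apply: le_trans (psiP 0).
pose beta := conv K (B (~~ y)).
have beta_le z : `|beta z| <= cB * t by exact: (stepk_conv_le _ _ e0 t0 sT sT).
have bb : bcs beta by exact: conv_bcs.
have tb : tst (fun z => psi z * beta z) by apply: tstMl => //; exact: conv_smooth2.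
have tE : `|t *: ev R y| <= kappa.
  by rewrite norm_ev ger0_norm//; apply: le_trans te_kappa; rewrite lerDr ltW.
rewrite (le_trans (ler_normB _ _))//.
(* The first summand pays for two test functions, one of them shifted, in the divergence of [A]; the
   second for the derivatives of [psi]. *)
rewrite (_ : t * cB * _ = N * (P * (cB * t) + P * (cB * t)) + (cB * t) * (2 * cA) * G); last by ring.
apply: lerD.
- apply: tbA.
  + exact: (tstB (tst_shift (- (t *: ev R y)) tb) tb).
  + move=> z nSz; rewrite (psi0 (z := z)).
      rewrite (psi0 (z := z - t *: ev R y)) ?mul0r ?subrr// => S0z; apply: nSz.
      by apply: (S0S S0z); rewrite subKr.
    move=> S0z; apply: nSz; apply: (S0S S0z).
    by rewrite subrr normr0 (le_trans _ tE).
  + move=> z; rewrite (le_trans (ler_normB _ _))//.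
    by apply: lerD; rewrite normrM ler_pM.
- have bd c : bcs (pderiv c psi) by apply: tst_bcs; exact: tst_pderiv.
  have bi c : bcs (incr t y (A c)) by exact: bcs_incr.
  have i_le c z : `|incr t y (A c) z| <= 2 * cA.
    by rewrite (le_trans (ler_normB _ _))// mulr_natl mulr2n lerD.
  have GE' : G = I2 (fun z => `|pderiv y psi z| + `|pderiv (~~ y) psi z|).
    by rewrite GE; congr I2; apply/funext => z; case: (y); [exact: erefl|exact: addrC].
  have bG : bcs (fun z => `|pderiv y psi z| + `|pderiv (~~ y) psi z|).
    by apply: bcsD; exact: bcs_norm.
  rewrite GE' -I2Z//; apply: le_norm_I2.
  + apply: bcsM; first exact: bcs_bmf.
    by apply: bcsD; apply: bcsM => //; exact: bcs_bmf.
  + exact: bcsZ.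
  + move=> z; rewrite normrM -mulrA ler_pM// (le_trans (ler_normD _ _))// mulrDr.
    by apply: lerD; rewrite normrM ler_wpM2r.
Qed.

Lemma conv_reflect_support g z : (forall w, ~ S0 w -> g w = 0) -> ~ S z ->
  conv (reflect K) g z = 0.
Proof.
move=> g0 nSz; apply: (@conv_support _ _ _ (e + t) S0) => //.
  by move=> p Lp; rewrite /reflect; apply: (stepk_support y t0 sT sT); rewrite normrN.
move=> w S0w; rewrite ltNge; apply/negP => zw; apply: nSz.
by apply: (S0S S0w); exact: le_trans te_kappa.
Qed.

Lemma conv_reflect_tst g : bcs g -> tst (conv (reflect K) g).
Proof.
move=> bg; split; first by apply: conv_smooth2 => //; exact: smoothb_reflect.
have bR : bcs (reflect K).
  have [mr Cr] := smoothb_bmf (smoothb_reflect sK); split => //.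
  exists (e + t) => z Lz; rewrite /reflect; apply: (stepk_support y t0 sT sT).
  by rewrite normrN.
by have [_ _] := conv_bcs (smoothb_reflect sK) bR bg.
Qed.

(* Summation by parts moves the difference of consecutive fields from the functionals
   pair2 (A i), which have no small bound, to the test functions. *)
Lemma wedge_sum (n : nat) (A : nat -> bool -> R * R -> R) :
  (forall i c, bcs (A i c)) -> (forall i c z, `|A i c z| <= cA) ->
  (forall i c z, `|A i c z - A i.+1 c z| <= cB) ->
  (forall i, (i <= n)%N -> tbound S N (A i)) ->
  `|\sum_(0 <= i < n) wedge t y (A i) (fun c z => A i c z - A i.+1 c z) (kern y r r) psi|
  <= t * (n%:R * cB * (2 * N * P + 2 * cA * G) + N * P * (4 * cA + 2 * n%:R * cB)).
Proof.
move=> bA AcA AcB tbA.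
have P0 : 0 <= P by apply: le_trans (psiP 0).
pose B i c z := A i c z - A i.+1 c z.
have bB i c : bcs (B i c) by exact: bcsB.
pose g i z := psi z * incr t y (A i (~~ y)) z.
have bp : bcs psi by exact: tst_bcs.
have bg i : bcs (g i) by apply: bcsMl => //; exact/bcs_bmf/bcs_incr.
pose phi i := conv (reflect K) (g i).
have tphi i : tst (phi i) by exact: conv_reflect_tst.
have g0 i w : ~ S0 w -> g i w = 0 by move=> /psi0; rewrite /g => ->; rewrite mul0r.
have phi0 i z : ~ S z -> phi i z = 0 by move=> nSz; exact: (conv_reflect_support (g0 i) nSz).
have phi_le i z : `|phi i z| <= P * (2 * cA) * t.
  apply: (stepk_conv_reflect_le _ _ e0 t0 sT sT) => // w; rewrite normrM ler_pM//.
  by rewrite (le_trans (ler_normB _ _))// mulr_natl mulr2n lerD.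
(* [g] depends linearly on the field, so a difference of consecutive test functions is governed by
   [cB] instead of [cA]. *)
have phiB i z : `|phi i.+1 z - phi i z| <= P * (2 * cB) * t.
  have -> : phi i.+1 z - phi i z = conv (reflect K) (fun w => g i.+1 w - g i w) z.
    rewrite /phi /conv -I2B; try (apply: bcs_conv_integrand => //; exact/smoothb_bmf/smoothb_reflect).
    by congr I2; apply/funext => w; rewrite mulrBr.
  apply: (stepk_conv_reflect_le _ _ e0 t0 sT sT); first exact: bcsB.
  move=> w; rewrite /g -mulrBr normrM ler_pM// /incr.
  set a := A i _ _; set a' := A i _ _; set d := A _ _ _; set d' := A _ _ _.
  rewrite (_ : _ - _ = (a' - d') - (a - d)); last by ring.
  rewrite (le_trans (ler_normB _ _))// mulr_natl mulr2n.
  by apply: lerD; exact: AcB.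
(* Abel summation: two boundary terms governed by [cA] and n interior terms governed by [cB], so n
   enters the bound only through n cB. *)
have tele : \sum_(0 <= i < n) pair2 (B i) (phi i) =
    pair2 (A 0%N) (phi 0%N) - pair2 (A n) (phi n)
    + \sum_(0 <= i < n) pair2 (A i.+1) (fun z => phi i.+1 z - phi i z).
  elim: (n) => [|k IH]; first by rewrite !big_geq// subrr addr0.
  rewrite !big_nat_recr//= IH (pair2Bl (bA k) (bA k.+1) (tphi k)).
  by rewrite (pair2Br (bA k.+1) (tphi k.+1) (tphi k)); ring.
rewrite (_ : \sum_(0 <= i < n) _ = \sum_(0 <= i < n) (wedge t y (A i) (B i) (kern y r r) psi
   - pair2 (B i) (phi i)) + \sum_(0 <= i < n) pair2 (B i) (phi i)); last first.
  by rewrite -big_split/=; apply: eq_bigr => i _; rewrite subrK.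
rewrite mulrDr (le_trans (ler_normD _ _))//; apply: lerD.
- rewrite (le_trans (ler_norm_sum _ _ _))//.
  rewrite (_ : t * _ = \sum_(0 <= i < n) (t * cB * (2 * N * P + 2 * cA * G))); last first.
    by rewrite big_const_nat subn0 iter_addr addr0 -mulr_natl; ring.
  rewrite big_seq [X in _ <= X]big_seq; apply: ler_sum => i; rewrite mem_index_iota => /andP[_ ni].
  by apply: wedge_near => //; [exact: AcB|apply: tbA; exact: ltnW].
- rewrite tele.
  have S1 : `|\sum_(0 <= i < n) pair2 (A i.+1) (fun z => phi i.+1 z - phi i z)| <=
      n%:R * (N * (P * (2 * cB) * t)).
    rewrite (le_trans (ler_norm_sum _ _ _))//.
    rewrite (_ : n%:R * _ = \sum_(0 <= i < n) (N * (P * (2 * cB) * t))); last first.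
      by rewrite big_const_nat subn0 iter_addr addr0 mulr_natl.
    rewrite big_seq [X in _ <= X]big_seq; apply: ler_sum => i; rewrite mem_index_iota => /andP[_ ni].
    apply: tbA => //; first exact: (tstB (tphi _) (tphi _)).
    by move=> z nSz; rewrite !phi0// subrr.
  have S2 i : (i <= n)%N -> `|pair2 (A i) (phi i)| <= N * (P * (2 * cA) * t).
    by move=> ni; apply: tbA => // z; exact: phi0.
  rewrite (_ : t * _ = N * (P * (2 * cA) * t) + N * (P * (2 * cA) * t) + n%:R * (N * (P * (2 * cB) * t))); last by ring.
  rewrite (le_trans (ler_normD _ _))// lerD// (le_trans (ler_normB _ _))// lerD//; exact: S2.
Qed.

End Bound.
End InteractionBound.

(** * Continuity of translations in L^1 *)

Section TranslationContinuity.
Variable R : realType.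
Implicit Types (f g k : R * R -> R) (z w : R * R) (L C M e : R).
Notation mu := (@lebesgue_measure R).

Lemma leb_seg_lty (a b : R) : (mu `[a, b]%classic < +oo)%E.
Proof. by rewrite /= lebesgue_measure_itv/=; case: ifP => // _; rewrite -EFinB ltry. Qed.

Lemma integral1_shift (f : R -> R) (s : R) : measurable_fun setT f -> (forall x, 0 <= f x) ->
  (\int[mu]_x (f (x + s)%R)%:E = \int[mu]_x (f x)%:E)%E.
Proof.
move=> mf f0; pose T := measurableTypeR R; pose sh (x : T) : T := (x : R) + s.
have ms : measurable_fun [set: T] sh by exact: measurable_funD.
have -> : (\int[mu]_x (f x)%:E = \int[pushforward mu sh]_x (f x)%:E)%E.
  by apply: (@eq_measure_integral _ T) => A mA _; rewrite [RHS]leb1_shift.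
rewrite (ge0_integral_pushforward ms)//; first exact/measurable_EFinP.
by move=> x _; rewrite lee_fin.
Qed.

(** The indicator is locally constant away from the two end points of the interval. *)
Lemma cvg_itv_indic (g : R -> R) (s : R ^nat) (L x : R) : continuous g ->
  s @ \oo --> 0 -> `|x| != L ->
  (g (x + s n) * \1_(`[- L, L]%classic : set R) (x + s n)) @[n --> \oo] -->
  g x * \1_(`[- L, L]%classic : set R) x.
Proof.
move=> cg s0 xL.
have xs : x + s n @[n --> \oo] --> x.
  by rewrite -[X in _ --> X]addr0; apply: cvgD => //; exact: cvg_cst.
have gx : g (x + s n) @[n --> \oo] --> g x by apply: continuous_cvg => //; exact: cg.
apply: cvgM; first exact: gx.
apply: cvg_near_cst.
have ax : `|x + s n| @[n --> \oo] --> `|x| by exact: cvg_norm.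
move: xL; rewrite neq_lt => /orP[xL|xL].
- near=> n; rewrite !indicE !mem_setE !in_itv/= -!ler_norml (ltW xL) ltW//.
  by near: n; exact: (cvgr_lt `|x|).
- near=> n; rewrite !indicE !mem_setE !in_itv/= -!ler_norml [in RHS]leNgt xL/=.
  rewrite leNgt (_ : L < _)//.
  by near: n; exact: (cvgr_gt `|x|).
Unshelve. all: by end_near. Qed.

Lemma cvg_Rintegral0 d (T : measurableType d) (m : {measure set T -> \bar R})
    (F : nat -> T -> R) (g : T -> R) :
  (forall n, measurable_fun setT (F n)) -> m.-integrable setT (EFin \o g) ->
  (forall n x, `|F n x| <= g x) -> {ae m, forall x, F n x @[n --> \oo] --> 0} ->
  (\int[m]_x F n x) @[n --> \oo] --> 0.
Proof.
move=> mF ig Fg F0.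
have [||||_ _ H] := @dominated_convergence _ T R m setT measurableT
  (fun n x => (F n x)%:E) (cst 0%E) (EFin \o g) _ _ _ ig.
- by move=> n; exact/measurable_EFinP.
- exact: measurable_cst.
- apply: filterS F0 => x F0 _; by apply/fine_cvgP; split; [exact: nearW|exact: F0].
- by apply: aeW => x n _; rewrite /= lee_fin.
by move: H; rewrite integral0 => /fine_cvg.
Qed.

Lemma integrable_seg (f : R -> R) (C L : R) : measurable_fun setT f ->
  (forall x, `|f x| <= C) -> (forall x, L < `|x| -> f x = 0) ->
  mu.-integrable setT (EFin \o f).
Proof.
move=> mf fC fL; apply: (@bounded_integrable _ _ _ mu `[- L, L]%classic _ C) => //.
  exact: leb_seg_lty.
by move=> x /= /negP; rewrite in_itv/= -ler_norml -ltNge => /fL.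
Qed.

(** Density of continuous functions in L^1 and a splitting into three thirds. Cutting the
    approximant off at [-L, L] creates two jumps, which are negligible for dominated convergence;
    shifts of length at most 1 keep all supports in one segment. *)
Lemma L1_translation1 (f : R -> R) (C L : R) (s : R ^nat) : 0 <= L ->
  measurable_fun setT f -> (forall x, `|f x| <= C) -> (forall x, L < `|x| -> f x = 0) ->
  s @ \oo --> 0 -> (forall n, `|s n| <= 1) ->
  (\int[mu]_x `|f (x + s n) - f x|) @[n --> \oo] --> 0.
Proof.
move=> L0 mf fC fL s0 s1.
pose E : set R := `[- L, L]%classic.
have mE : measurable E by exact: measurable_itv.
have mEf : mu.-integrable E (EFin \o f).
  apply: measurable_bounded_integrable => //; [exact: leb_seg_lty|exact: measurable_funTS|].
  by exists C; split; [exact: num_real|move=> y Cy x Ax /=; rewrite (le_trans (fC x))// ltW].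
have [g_ [cg_ ig_ fg_]] := approximation_continuous_integrable mE (leb_seg_lty _ _) mEf.
have msh (h : R -> R) (t : R) : measurable_fun setT h -> measurable_fun setT (fun x : R => h (x + t)).
  by move=> mh; apply: (measurableT_comp mh); exact: measurable_funD.
apply/cvgr0Pnorm_le => d d0.
have [g [cg fg]] : exists g : R -> R, continuous g /\
    (\int[mu]_(x in E) `|(f x - g x)%:E| < (d / 3)%:E)%E.
  have d3 : 0 < d / 3 by rewrite divr_gt0.
  have /fine_cvgP[fin /cvgr0Pnorm_lt/(_ _ d3) lt3] := fg_.
  have [n _ /(_ n (leqnn n))[finn ltn]] := filterI fin lt3; exists (g_ n); split=> //.
  by rewrite -(fineK finn) lte_fin (le_lt_trans _ ltn)// ler_norm.
pose h x := g x * \1_E x.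
have [D gD] : exists D : R, forall x, `|h x| <= D.
  have cn : {within `[- L, L], continuous (fun x => `|g x|)}.
    apply: continuous_subspaceT => x; apply: continuous_comp; first exact: cg.
    exact: (@norm_continuous _ R^o).
  have LL : - L <= L by lra.
  have [c _ cmax] := EVT_max LL cn; exists `|g c| => x; rewrite /h indicE mem_setE.
  by case: (boolP (x \in _)) => xE; rewrite ?mulr1 ?mulr0 ?normr0//; exact: cmax.
have hL x : L < `|x| -> h x = 0.
  move=> Lx; rewrite /h indicE mem_setE in_itv/= -ler_norml leNgt Lx mulr0//.
have mh : measurable_fun setT h.
  by apply: measurable_funM; [exact: continuous_measurable_fun|exact: measurable_indic].
have sup3 (u v : R -> R) t x : (forall x, L < `|x| -> u x = 0) -> (forall x, L < `|x| -> v x = 0) ->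
    `|t| <= 1 -> L + 1 < `|x| -> `|u (x + t) - v x| = 0.
  move=> u0 v0 t1 Lx; rewrite u0 ?v0 ?subrr ?normr0//; first lra.
  by have := ler_normB (x + t) t; rewrite addrK; lra.
have bd3 (u v : R -> R) (c c' : R) t x : (forall x, `|u x| <= c) -> (forall x, `|v x| <= c') ->
    `| `|u (x + t) - v x| | <= c + c'.
  by move=> uc vc; rewrite normr_id (le_trans (ler_normB _ _))// lerD.
have int3 (u v : R -> R) (c c' t : R) : measurable_fun setT u -> measurable_fun setT v ->
    (forall x, `|u x| <= c) -> (forall x, `|v x| <= c') ->
    (forall x, L < `|x| -> u x = 0) -> (forall x, L < `|x| -> v x = 0) -> `|t| <= 1 ->
    mu.-integrable setT (EFin \o (fun x => `|u (x + t) - v x|)).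
  move=> mu' mv uc vc u0 v0 t1; apply: (@integrable_seg _ (c + c') (L + 1)).
  - by apply: measurableT_comp => //; apply: measurable_funB => //; exact: msh.
  - by move=> x; exact: bd3.
  - by move=> x; exact: sup3.
have H1 : (\int[mu]_x `|h (x + s n) - h x|) @[n --> \oo] --> 0.
  apply: (@cvg_Rintegral0 _ _ mu _ (fun x => (D + D) * \1_(`[- (L + 1), L + 1]%classic : set R) x)).
  - by move=> n; apply: measurableT_comp => //; apply: measurable_funB => //; exact: msh.
  - apply: (@integrable_seg _ `|D + D| (L + 1)).
    + by apply: measurable_funM => //; exact: measurable_indic.
    + move=> x; rewrite indicE normrM ler_piMr//; case: (_ \in _); rewrite ?normr1 ?normr0//.
    + by move=> x Lx; rewrite indicE mem_setE in_itv/= -ler_norml leNgt Lx mulr0.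
  - move=> n x; rewrite indicE mem_setE in_itv/= -ler_norml.
    case: (leP `|x| (L + 1)) => Lx; first by rewrite mulr1; exact: bd3.
    by rewrite mulr0 (sup3 h h)// normr0.
  - have N0 : mu.-negligible [set x | `|x| = L].
      apply: (@negligibleS _ _ _ mu ([set L] `|` [set - L])).
        move=> x /= /eqP; rewrite eqr_norml => /andP[/orP[/eqP ->|/eqP ->] _]; [by left|by right].
      have n1 (c : R) : mu.-negligible [set c].
        by exists [set c]; split => //; exact: lebesgue_measure_set1.
      by apply: negligibleU; exact: n1.
    apply: negligibleS N0 => x /= nc; apply: contrapT => /eqP xL; apply: nc.
    have hc := cvg_itv_indic cg s0 xL.
    rewrite -(normr0 R) -[X in `|X|](subrr (h x)); apply: cvg_norm.
    by apply: cvgB; [exact: hc|exact: cvg_cst].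
pose df := \int[mu]_x `|f x - h x|.
have mfh : measurable_fun setT (fun x => `|f x - h x|).
  by apply: measurableT_comp => //; exact: measurable_funB.
have ifh : mu.-integrable setT (EFin \o (fun x => `|f x - h x|)).
  have := int3 f h C D 0 mf mh fC gD fL hL; rewrite normr0 => /(_ ler01).
  by under eq_fun do rewrite addr0.
have dfd : df <= d / 3.
  rewrite /df -lee_fin fineK; last exact: (integrable_fin_num measurableT ifh).
  apply: le_trans (ltW fg); rewrite le_eqVlt; apply/orP; left; apply/eqP.
  rewrite [RHS]integral_mkcond; apply: eq_integral => x _; rewrite patchE/h indicE.
  case: (boolP (x \in E)) => xE; first by rewrite mulr1 abse_EFin.
  rewrite mulr0 subr0 fL ?normr0//; move: xE; rewrite notin_setE /E/= in_itv/=.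
  by move=> /negP; rewrite -ler_norml -ltNge.
have dfs t : \int[mu]_x `|f (x + t) - h (x + t)| = df.
  congr fine; apply: (@integral1_shift (fun x => `|f x - h x|)) => //.
move/cvgr0Pnorm_le: H1 => /(_ (d / 3)) => H1.
have /H1 : 0 < d / 3 by rewrite divr_gt0.
apply: filterS => n.
rewrite !ger0_norm; try by apply: Rintegral_ge0.
move=> hn; have -> : d = d / 3 + d / 3 + d / 3 by field.
have ifs : mu.-integrable setT (EFin \o (fun x => `|f (x + s n) - h (x + s n)|)).
  apply: (@integrable_seg _ (C + D) (L + 1)).
  - by apply: (msh (fun x => `|f x - h x|)).
  - by move=> x; rewrite normr_id (le_trans (ler_normB _ _))// lerD.
  - move=> x Lx; have := s1 n => sn1; rewrite fL ?hL ?subrr ?normr0//.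
      by have := ler_normB (x + s n) (s n); rewrite addrK; lra.
    by have := ler_normB (x + s n) (s n); rewrite addrK; lra.
have ihs : mu.-integrable setT (EFin \o (fun x => `|h (x + s n) - h x|)).
  exact: (int3 h h D D).
apply: (@le_trans _ _ (\int[mu]_x (`|f (x + s n) - h (x + s n)| + `|h (x + s n) - h x| + `|f x - h x|))).
  apply: le_Rintegral => //; first exact: (int3 f f C C).
    by apply: (integrableD measurableT (integrableD measurableT ifs ihs) ifh).
  move=> x _; rewrite (distrC (f x)).
  rewrite (_ : f (x + s n) - f x = (f (x + s n) - h (x + s n)) + (h (x + s n) - h x) + (h x - f x)); last by ring.
  by rewrite (le_trans (ler_normD _ _))// lerD// ler_normD.
rewrite RintegralD//; last exact: (integrableD measurableT ifs ihs).
rewrite (RintegralD measurableT ifs ihs) dfs.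
by apply: lerD; [apply: lerD; [exact: dfd|exact: hn]|exact: dfd].
Qed.

Definition swapf f : R * R -> R := fun z => f (z.2, z.1).

Lemma bcs_swap f : bcs f -> bcs (swapf f).
Proof.
move=> [mf [C fC] [L fL]]; split.
- apply: (measurableT_comp mf); apply/measurable_fun_pairP; split.
    exact: measurable_snd.
  exact: measurable_fst.
- by exists C => z; exact: fC.
- by exists L => z Lz; apply: fL; move: Lz; rewrite !prod_normE/= maxC.
Qed.

Lemma I2_swapf f : bcs f -> I2 (swapf f) = I2 f.
Proof.
move=> bf; rewrite (I2_iter (bcs_swap bf)) I2E /Rintegral.
rewrite -(integral21_prod_meas1 (bcs_integrable bf)); congr fine.
have [mf [C fC] [L fL]] := bf.
apply: eq_integral => x _; rewrite fineK//; apply: (integrable_fin_num measurableT).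
apply: (@integrable_seg (fun y => f (y, x)) C L).
- exact: measurable_fun_pair1.
- by move=> y; exact: fC.
- by move=> y Ly; apply: fL; rewrite prod_normE/= lt_max Ly.
Qed.

(** Dominated convergence in the outer variable, so that a one-dimensional result on each line is
    enough. *)
Lemma cvg_I2_slices (F : nat -> R * R -> R) C L : (forall n, measurable_fun setT (F n)) ->
  (forall n z, `|F n z| <= C) -> (forall n z, L < `|z| -> F n z = 0) ->
  (forall x, (\int[mu]_y F n (x, y)) @[n --> \oo] --> 0) ->
  I2 (F n) @[n --> \oo] --> 0.
Proof.
move=> mF FC FL F0.
have bF n : bcs (F n) by split => //; [exists C; exact: FC|exists L; exact: FL].
have iF n x : mu.-integrable setT (EFin \o (fun y => F n (x, y))).
  apply: (@integrable_seg _ C L).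
  - exact: measurable_fun_pair2.
  - by move=> y; exact: FC.
  - by move=> y Ly; apply: FL; rewrite prod_normE/= lt_max Ly orbT.
have C0 : 0 <= C by exact: le_trans (FC 0%N 0).
have miL : measurable_fun setT (\1_(`[- L, L]%classic : set R) : R -> R) by exact: measurable_indic.
have iL a : mu.-integrable setT (EFin \o (fun y => a * \1_(`[- L, L]%classic : set R) y)).
  apply: (@integrable_seg _ `|a| L).
  - exact: measurable_funM.
  - by move=> y; rewrite indicE normrM ler_piMr//; case: (_ \in _); rewrite ?normr1 ?normr0.
  - by move=> y Ly; rewrite indicE mem_setE in_itv/= -ler_norml leNgt Ly mulr0.
under eq_fun do rewrite (I2_iter (bF _)).
pose D := \int[mu]_y (C * \1_(`[- L, L]%classic : set R) y).
apply: (@cvg_Rintegral0 _ _ mu _ (fun x => D * \1_(`[- L, L]%classic : set R) x)) => //.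
- move=> n; apply/measurable_EFinP.
  have := measurable_fubini_F (bcs_integrable (bF n)).
  apply: eq_measurable_fun => x _; rewrite /= /Rintegral fineK//.
  exact: (integrable_fin_num measurableT (iF n x)).
- move=> n x; rewrite indicE mem_setE in_itv/= -ler_norml.
  have [xL|Lx] := leP `|x| L.
    rewrite mulr1 (le_trans (le_normr_Rintegral _ (iF n x)))//.
    apply: le_Rintegral => //.
    + apply: (@integrable_seg _ C L).
      * by apply: measurableT_comp => //; exact: measurable_fun_pair2.
      * by move=> y; rewrite normr_id; exact: FC.
      * by move=> y Ly; rewrite FL ?normr0// prod_normE/= lt_max Ly orbT.
    + move=> y _; rewrite indicE mem_setE in_itv/= -ler_norml.
      case: (leP `|y| L) => Ly; first by rewrite mulr1.
      by rewrite mulr0 FL ?normr0// prod_normE/= lt_max Ly orbT.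
  rewrite mulr0 (@eq_Rintegral _ _ _ _ _ (cst 0)); last first.
    by move=> y _; rewrite FL// prod_normE/= lt_max Lx.
  by rewrite /Rintegral integral0 normr0.
- by apply: aeW => x; exact: F0.
Qed.

Lemma L1_translation_axis f b (s : R ^nat) : bcs f ->
  s @ \oo --> 0 -> (forall n, `|s n| <= 1) ->
  I2 (fun z => `|f (z + s n *: ev R b) - f z|) @[n --> \oo] --> 0.
Proof.
move=> bf s0 s1.
(* Exchanging the coordinates reduces to the second axis, the variable of the inner integral. *)
wlog {b} -> : b f bf / b = false.
  move=> H; case: b; last exact: H.
  have := H false _ (bcs_swap bf) erefl.
  apply: cvg_trans; apply: near_eq_cvg; apply: nearW => n.
  rewrite -[RHS]I2_swapf; last by apply: bcs_norm; exact: bcs_incr.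
  by congr I2; apply/funext => z; rewrite /swapf add_evF add_evT.
have [mf [C fC] [L fL]] := bf.
apply: (@cvg_I2_slices _ (C + C) (L + 1)).
- move=> n; have [m _ _] := bcs_norm (bcs_incr (s n) false bf).
  exact: m.
- by move=> n z; rewrite normr_id (le_trans (ler_normB _ _))// lerD.
- move=> n z Lz; rewrite !fL ?subrr ?normr0//; first by lra.
  have := ler_normB (z + s n *: ev R false) (s n *: ev R false); have := s1 n.
  by rewrite addrK norm_ev; lra.
- move=> x; under eq_fun do under eq_Rintegral do rewrite add_evF/=.
  have [L0|L0] := leP 0 L.
    apply: (@L1_translation1 (fun y => f (x, y)) C L) => //.
    + exact: measurable_fun_pair2.
    + by move=> y Ly; apply: fL; rewrite prod_normE/= lt_max Ly orbT.
  have f0 z : f z = 0 by apply: fL; exact: lt_le_trans L0 _.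
  under eq_fun do under eq_Rintegral do rewrite !f0 subrr normr0.
  by rewrite /Rintegral integral0; exact: cvg_cst.
Qed.

(** Continuity of translations is known along sequences and axes: a contradiction supplies a
    sequence of bad shifts, and each shift is split into one step per axis. *)
Lemma correlation_continuous f g : bcs f -> bcs g -> forall d : R, 0 < d ->
  exists2 h : R, 0 < h & forall w, `|w| <= h ->
    `|I2 (fun z => g z * f (z + w)) - I2 (fun z => g z * f z)| <= d.
Proof.
move=> bf bg d d0; have [_ [G gG] _] := bg.
have G0 : 0 <= G by exact: le_trans (gG 0).
apply: contrapT => H.
have {}H n : exists w : R * R, `|w| <= n.+1%:R^-1 /\
    d < `|I2 (fun z => g z * f (z + w)) - I2 (fun z => g z * f z)|.
  apply: contrapT => Hw; apply: H; exists n.+1%:R^-1 => // w wn.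
  by rewrite leNgt; apply/negP => dw; apply: Hw; exists w.
pose w n := projT1 (cid (H n)).
have wn n : `|w n| <= n.+1%:R^-1 by have [] := projT2 (cid (H n)).
have wd n : d < `|I2 (fun z => g z * f (z + w n)) - I2 (fun z => g z * f z)|.
  by have [] := projT2 (cid (H n)).
have w1 n : `|(w n).1| <= n.+1%:R^-1 by have := wn n; rewrite prod_normE ge_max => /andP[].
have w2 n : `|(w n).2| <= n.+1%:R^-1 by have := wn n; rewrite prod_normE ge_max => /andP[].
have n1 n : (n.+1%:R^-1 : R) <= 1 by rewrite invf_le1// ler1n.
have to0 (s : R ^nat) : (forall n, `|s n| <= n.+1%:R^-1) -> s @ \oo --> 0.
  move=> sn; apply/norm_cvg0P; apply: (squeeze_cvgr (f := fun=> 0) (h := @harmonic R)).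
  - by apply: nearW => n; rewrite normr_ge0 sn.
  - exact: cvg_cst.
  - exact: cvg_harmonic.
have c1 := L1_translation_axis true bf (to0 _ w1) (fun n => le_trans (w1 n) (n1 n)).
have c2 := L1_translation_axis false bf (to0 _ w2) (fun n => le_trans (w2 n) (n1 n)).
have c : G * (I2 (fun z => `|f (z + (w n).1 *: ev R true) - f z|) +
   I2 (fun z => `|f (z + (w n).2 *: ev R false) - f z|)) @[n --> \oo] --> 0.
  rewrite -(mulr0 G) -(addr0 (0 : R)); apply: cvgM; first exact: cvg_cst.
  exact: cvgD c1 c2.
move/cvgr0Pnorm_le: c => /(_ d d0)[n _ /(_ n (leqnn n))].
rewrite leNgt => /negP; apply; apply: (lt_le_trans (wd n)).
rewrite -I2B; [|by apply: bcsMl => //; exact/bcs_bmf/bcs_shift|by apply: bcsM => //; exact: bcs_bmf].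
pose e1 := (w n).1 *: ev R true; pose e2 := (w n).2 *: ev R false.
have we : w n = e1 + e2.
  by rewrite /e2 add_evF -[e1]add0r add_evT/= !add0r -surjective_pairing.
have b1 : bcs (fun z => `|f (z + e1) - f z|) by apply: bcs_norm; exact: bcs_incr.
have b2 : bcs (fun z => `|f (z + e2) - f z|) by apply: bcs_norm; exact: bcs_incr.
rewrite (le_trans _ (ler_norm _))//.
rewrite -(I2_shift e1 b2) -(I2D b1 (bcs_shift e1 b2)).
rewrite -(I2Z _ (bcsD b1 (bcs_shift e1 b2))).
apply: le_norm_I2.
- apply: bcsB; first by apply: bcsMl => //; exact/bcs_bmf/bcs_shift.
  by apply: bcsM => //; exact: bcs_bmf.
- by apply: bcsZ; apply: bcsD => //; exact: (bcs_shift e1 b2).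
move=> z; rewrite -mulrBr normrM ler_pM// we addrA.
rewrite (_ : f (z + e1 + e2) - f z = (f (z + e1) - f z) + (f (z + e1 + e2) - f (z + e1))); last by ring.
exact: ler_normD.
Qed.

Lemma Rintegral_slice_measurable d (T : measurableType d)
    (m : {sigma_finite_measure set T -> \bar R}) (A : set T) (F : T * T -> R) (C : R) :
  measurable A -> (m A < +oo)%E -> measurable_fun setT F -> (forall p, `|F p| <= C) ->
  (forall p q : T, ~ A p -> F (p, q) = 0) -> (forall p q : T, ~ A q -> F (p, q) = 0) ->
  measurable_fun setT (fun q => \int[m]_p F (p, q)).
Proof.
move=> mA Aoo mF FC F1 F2.
have iF : (m \x m)%E.-integrable setT (EFin \o F).
  apply: (@bounded_integrable _ _ _ (m \x m)%E (A `*` A) _ C) => //.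
  - exact: measurableX.
  - have P : (m A * m A < +oo)%E by rewrite lte_mul_pinfty// ge0_fin_numE.
    by rewrite -product_measure1E// in P.
  - by move=> [p q] /= /not_andP[]; [exact: F1|exact: F2].
apply/measurable_EFinP; apply: eq_measurable_fun (measurable_fubini_G iF) => q _.
rewrite /= /Rintegral fineK//; apply: (integrable_fin_num measurableT).
apply: (@bounded_integrable _ _ _ m A _ C) => //.
- exact: measurable_fun_pair1.
- by move=> p; exact: F1.
Qed.

Lemma bcs_I2_slice (F : (R * R) * (R * R) -> R) (C L : R) : measurable_fun setT F ->
  (forall p, `|F p| <= C) -> (forall z w, L < `|z| -> F (z, w) = 0) ->
  (forall z w, L < `|w| -> F (z, w) = 0) -> bcs (fun w => I2 (fun z => F (z, w))).
Proof.
move=> mF FC F1 F2; pose T := (measurableTypeR R * measurableTypeR R)%type; split.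
- under eq_fun do rewrite I2E.
  have G1 (z w : T) : ~ cube L z -> F (z, w) = 0 by move=> /negP; rewrite -ltNge; exact: F1.
  have G2 (z w : T) : ~ cube L w -> F (z, w) = 0 by move=> /negP; rewrite -ltNge; exact: F2.
  have H := @Rintegral_slice_measurable _ T (@leb2s R) (cube L) (F : T * T -> R) C
    (measurable_cube L) (leb2_cube_lty L) mF FC G1 G2.
  exact: H.
- exists (I2 (fun z => C * \1_(cube L) z)) => w; apply: le_norm_I2.
  + split; first exact: measurable_fun_pair1.
      by exists C.
    by exists L => z; exact: F1.
  + by apply: bcsZ; exact: bcs_cube.
  + move=> z; rewrite indicE; have [zL|] := boolP (z \in cube L); first by rewrite mulr1.
    by rewrite notin_setE => /negP; rewrite -ltNge => Lz; rewrite F1// normr0 mulr0.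
- exists L => w Lw; under eq_fun do rewrite F2//.
  exact: I2_cst0.
Qed.

(** By Fubini the mollified integral is an average, with weight k(-w), of the correlation of [g] and
    [f] at lag w. The weight has mass 1 and sits in |w| <= e, where the correlation is close to its
    value at 0. *)
Lemma conv_kern_approx f g y : bcs f -> bcs g -> forall d : R, 0 < d ->
  exists2 h : R, 0 < h & forall e T r, 0 < e -> e <= h -> is_step e T r ->
    `|I2 (fun z => g z * conv (kern y r r) f z) - I2 (fun z => g z * f z)| <= d.
Proof.
move=> bf bg d d0; have [h h0 Hh] := correlation_continuous bf bg d0.
exists h => // e T r e0 eh sT.
have [bk k1] := kern_unit y 0 e0 sT sT.
set k := kern y r r.
have k0 w : 0 <= k w by apply: kern_ge0 => x; have [_ []] := sT.
have ksup w : e < `|w| -> k w = 0.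
  have [_ [_ _ re _ _]] := sT.
  by rewrite prod_normE lt_max /k/kern/tens; case: (y) => /orP[/ltW/re|/ltW/re] /= ->; rewrite ?mul0r ?mulr0.
have bcz z : bcs (fun w => k (- w) * f (w + z)).
  have [m C] : bmf (fun w => k (0 - w)) by exact/bmf_reflect/bcs_bmf.
  apply: bcsM; last exact: bcs_shift.
  by under eq_fun do rewrite -sub0r; split.
have E1 z : conv k f z = I2 (fun w => k (- w) * f (w + z)).
  rewrite /conv -(I2_shift z); last by apply: bcs_conv_integrand => //; exact: bcs_bmf.
  by congr I2; apply/funext => w; rewrite opprD addrCA subrr addr0.
pose c w := I2 (fun z => g z * f (z + w)).
have bkm : bcs (fun w => k (- w)).
  by have := bcs_reflect 0 bk; under eq_fun do rewrite sub0r.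
have [mf [Cf fC] [Lf fL]] := bf; have [mg [Cg gC] [Lg gL]] := bg.
have [mk [Ck kC] [Lk kL]] := bkm.
pose F (p : (R * R) * (R * R)) := g p.1 * (k (- p.2) * f (p.2 + p.1)).
have madd : measurable_fun setT (fun p : (R * R) * (R * R) => p.2 + p.1).
  by apply/measurable_fun_pairP; split; apply: measurable_funD; exact: measurableT_comp.
have mF : measurable_fun setT F.
  apply: measurable_funM; first exact: measurableT_comp.
  apply: measurable_funM; last exact: (measurableT_comp mf).
  exact: (measurableT_comp mk).
have FC p : `|F p| <= Cg * (Ck * Cf).
  by rewrite /F !normrM ler_pM ?mulr_ge0// ler_pM.
have F1 z w : Num.max Lg Lk < `|z| -> F (z, w) = 0.
  by rewrite gt_max => /andP[/gL gz _]; rewrite /F/= gz mul0r.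
have F2 z w : Num.max Lg Lk < `|w| -> F (z, w) = 0.
  by rewrite gt_max => /andP[_ /kL kz]; rewrite /F/= kz mul0r mulr0.
have Fc w : I2 (fun z => F (z, w)) = k (- w) * c w.
  rewrite /c -I2Z.
    by congr I2; apply/funext => z; rewrite /F/= (addrC w); ring.
  by apply: bcsMl => //; exact/bcs_bmf/bcs_shift.
have E2 : I2 (fun z => g z * conv k f z) = I2 (fun w => k (- w) * c w).
  rewrite (_ : (fun z => _) = fun z => I2 (fun w => F (z, w))); last first.
    by apply/funext => z; rewrite E1 -I2Z.
  rewrite (I2_swap mF FC F1 F2).
  by congr I2; apply/funext => w; exact: Fc.
have bFc := bcs_I2_slice mF FC F1 F2.
rewrite E2; set c0 := I2 (fun z => g z * f z).
have k1' : I2 (fun w => k (- w)) = 1.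
  by rewrite -k1; congr I2; apply/funext => w; rewrite sub0r.
rewrite (_ : I2 (fun w => k (- w) * c w) = I2 (fun w => I2 (fun z => F (z, w)))); last first.
  by congr I2; apply/funext => w; rewrite Fc.
rewrite -[X in _ - X]mulr1 -k1' -(I2Z _ bkm) -(I2B bFc (bcsZ _ bkm)).
rewrite -[leRHS]mulr1 -k1' -(I2Z _ bkm).
apply: le_norm_I2; [exact: (bcsB bFc (bcsZ _ bkm))|exact: (bcsZ _ bkm)|].
move=> w; rewrite Fc; have [we|we] := leP `|w| e; last first.
  by rewrite ksup ?normrN// mul0r !mulr0 subrr normr0.
rewrite mulrC -mulrBl normrM (ger0_norm (k0 _)) ler_wpM2r//.
by apply: Hh; exact: le_trans eh.
Qed.

End TranslationContinuity.

(** * Removal of the mollifier *)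

Section Coercivity.
Variable R : realType.
Implicit Types (f g psi W : R * R -> R) (z : R * R) (A B : bool -> R * R -> R)
  (L C t e N m M k : R) (y b c : bool).

Definition wedge0 t y A B psi : R :=
  I2 (fun z => psi z * (incr t y (A y) z * incr t y (B (~~ y)) z
                        - incr t y (A (~~ y)) z * incr t y (B y) z)).

Lemma wedge_approx t y A B psi : (forall c, bcs (A c)) -> (forall c, bcs (B c)) -> bcs psi ->
  forall d : R, 0 < d -> exists2 h : R, 0 < h &
    forall e T r, 0 < e -> e <= h -> is_step e T r ->
      `|wedge t y A B (kern y r r) psi - wedge0 t y A B psi| <= d.
Proof.
move=> bA bB bp d d0.
have bi c : bcs (incr t y (A c)) by exact: bcs_incr.
have bj c : bcs (incr t y (B c)) by exact: bcs_incr.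
have bg c : bcs (fun z => psi z * incr t y (A c) z) by apply: bcsMl => //; exact: bcs_bmf.
have d2 : 0 < d / 2 by rewrite divr_gt0.
have [h1 h10 H1] := conv_kern_approx y (bj (~~ y)) (bg y) d2.
have [h2 h20 H2] := conv_kern_approx y (bj y) (bg (~~ y)) d2.
exists (Num.min h1 h2) => [|e T r e0]; first by rewrite lt_min h10.
rewrite le_min => /andP[eh1 eh2] sT.
have {}H1 := H1 _ _ _ e0 eh1 sT; have {}H2 := H2 _ _ _ e0 eh2 sT.
have sk : smoothb (kern y r r).
  by apply: kern_smoothb; exact: (is_step_smoothb1 (ltW e0) sT).
have bc c : bmf (conv (kern y r r) (incr t y (B c))) by exact: conv_bmf.
have -> : wedge t y A B (kern y r r) psi =
    I2 (fun z => psi z * incr t y (A y) z * conv (kern y r r) (incr t y (B (~~ y))) z)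
    - I2 (fun z => psi z * incr t y (A (~~ y)) z * conv (kern y r r) (incr t y (B y)) z).
  rewrite -(I2B (bcsMl (bg y) (bc (~~ y))) (bcsMl (bg (~~ y)) (bc y))).
  by congr I2; apply/funext => z; ring.
have -> : wedge0 t y A B psi =
    I2 (fun z => psi z * incr t y (A y) z * incr t y (B (~~ y)) z)
    - I2 (fun z => psi z * incr t y (A (~~ y)) z * incr t y (B y) z).
  rewrite -(I2B (bcsMl (bg y) (bcs_bmf (bj (~~ y)))) (bcsMl (bg (~~ y)) (bcs_bmf (bj y)))).
  by congr I2; apply/funext => z; ring.
set x1 := I2 _ in H1 *; set x2 := I2 _ in H1 *; set x3 := I2 _ in H2 *; set x4 := I2 _ in H2 *.
rewrite (_ : _ - _ = (x1 - x2) - (x3 - x4)); last by ring.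
by rewrite (le_trans (ler_normB _ _))// [d]splitr lerD.
Qed.

Lemma wedge_sum_approx t y (n : nat) (A B : nat -> bool -> R * R -> R) psi :
  (forall i c, bcs (A i c)) -> (forall i c, bcs (B i c)) -> bcs psi ->
  forall d : R, 0 < d -> exists2 h : R, 0 < h &
    forall e T r, 0 < e -> e <= h -> is_step e T r ->
      `|\sum_(0 <= i < n) wedge t y (A i) (B i) (kern y r r) psi
        - \sum_(0 <= i < n) wedge0 t y (A i) (B i) psi| <= d.
Proof.
move=> bA bB bp; elim: n => [|n IH] d d0.
  by exists 1 => // e T r _ _ _; rewrite !big_geq// subrr normr0 ltW.
have d2 : 0 < d / 2 by rewrite divr_gt0.
have [h1 h10 H1] := IH _ d2.
have [h2 h20 H2] := wedge_approx t y (bA n) (bB n) bp d2.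
exists (Num.min h1 h2) => [|e T r e0]; first by rewrite lt_min h10.
rewrite le_min => /andP[eh1 eh2] sT.
rewrite !big_nat_recr//= opprD addrACA (le_trans (ler_normD _ _))// [d]splitr lerD//.
  exact: (H1 e T r).
exact: (H2 e T r).
Qed.

(** The bound of [wedge_sum] does not contain e, so e can tend to 0 with t and the grid fixed. *)
Lemma wedge0_sum y t kappa psi (S0 S : set (R * R)) (N P G cA cB : R) n
    (A : nat -> bool -> R * R -> R) :
  0 <= t -> t < kappa -> tst psi -> (forall z, ~ S0 z -> psi z = 0) ->
  (forall z, `|psi z| <= P) ->
  (forall z w, S0 w -> `|z - w| <= kappa -> S z) ->
  G = I2 (fun z => `|pderiv true psi z| + `|pderiv false psi z|) ->

  (forall i c, bcs (A i c)) -> (forall i c z, `|A i c z| <= cA) ->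
  (forall i c z, `|A i c z - A i.+1 c z| <= cB) ->
  (forall i, (i <= n)%N -> tbound S N (A i)) ->
  `|\sum_(0 <= i < n) wedge0 t y (A i) (fun c z => A i c z - A i.+1 c z) psi|
  <= t * (n%:R * cB * (2 * N * P + 2 * cA * G) + N * P * (4 * cA + 2 * n%:R * cB)).
Proof.
move=> t0 tk tp psi0 psiP S0S GE bA AcA AcB tbA.
apply/ler_addgt0Pr => d d0.
have bB i c : bcs (fun z => A i c z - A i.+1 c z) by exact: bcsB.
have [h h0 H] := wedge_sum_approx t y n bA bB (tst_bcs tp) d0.
(* The second entry keeps the kernels inside [S]; it is positive because t < kappa is strict. *)
pose e := Num.min h (kappa - t).
have e0 : 0 < e by rewrite lt_min h0 subr_gt0.
have [T [r sT]] := smooth_step e0.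
have {}sT : is_step e T r by [].
have eh : e <= h by rewrite ge_min lexx.
have ek : e + t <= kappa by rewrite -lerBrDr ge_min lexx orbT.
have := wedge_sum y e0 t0 sT tp psi0 psiP S0S ek GE bA AcA AcB tbA.
have := H e T r e0 eh sT.
set x := \sum_(0 <= i < n) _; set x' := \sum_(0 <= i < n) _ => H1 H2.
rewrite -[x'](subKr x) (le_trans (ler_normB _ _))//.
exact: lerD.
Qed.

End Coercivity.

(** * Kruzhkov entropies and the cubic lower bound *)

Section SlopeGap.
Variable R : realType.
Implicit Types (k v w alpha M d Lam : R) (c : bool).

(* The gap between the chord slopes of a from q to v and from p to v; the bound is an equality
   for a x = alpha x^2 / 2. *)
Definition slope_gap (a : R -> R) (alpha : R) := forall p q v : R, p <= q -> q <= v ->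
  alpha / 2 * ((v - p) * (v - q) * (q - p)) <= (v - p) * (a v - a q) - (v - q) * (a v - a p).

(** Equality holds for alpha x^2 / 2, so subtracting this parabola leaves a function [b] with
    nondecreasing derivative. Its gap is (q - p)(v - q)(b'(c1) - b'(c0)) with mean value points c0
    <= q <= c1. *)
Lemma slope_gap_derive (a a' : R -> R) alpha : (forall x : R, is_derive x 1 a (a' x)) ->
  (forall x y : R, x <= y -> alpha * (y - x) <= a' y - a' x) -> slope_gap a alpha.
Proof.
move=> da ga p q v pq qv.
pose b x := a x - alpha / 2 * (x * x); pose b' x := a' x - alpha * x.
have db (x : R) : is_derive x 1 b (b' x).
  have d2 : is_derive x 1 (fun s : R => alpha / 2 * (s * s)) (alpha * x).
    have dX := is_deriveM (is_derive_id x 1) (is_derive_id x 1).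
    apply: (is_derive_eq (is_deriveZ (alpha / 2) dX)).
    by rewrite /GRing.scale/= mulr1; field.
  exact: is_deriveB.
have b'm (x y : R) : x <= y -> b' x <= b' y.
  by move=> /ga H; rewrite /b'; move: H; rewrite mulrBr; lra.
have diff (x y : R) : x <= y -> exists2 c, x <= c <= y & b y - b x = b' c * (y - x).
  rewrite le_eqVlt => /predU1P[->|xy].
    by exists y; rewrite ?lexx// !subrr mulr0.
  by have [c /andP[c1 c2] E] := mvt db xy; exists c; rewrite // !ltW.
have [c0 /andP[_ c0q] E0] := diff _ _ pq.
have [c1 /andP[qc1 _] E1] := diff _ _ qv.
have c01 : b' c0 <= b' c1 by apply: b'm; exact: le_trans qc1.
have K : 0 <= (q - p) * (v - q) * (b' c1 - b' c0).
  by rewrite !mulr_ge0 ?subr_ge0.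
rewrite -subr_ge0; apply: le_trans K _; rewrite le_eqVlt; apply/orP; left; apply/eqP.
have -> : a v - a q = (b v - b q) + alpha / 2 * (v * v - q * q) by rewrite /b; ring.
have -> : a v - a p = (b v - b q) + (b q - b p) + alpha / 2 * (v * v - p * p) by rewrite /b; ring.
by rewrite E0 E1; field.
Qed.

(* Kruzhkov's entropy (v - k)^+ and its flux. *)
Definition ent (a : R -> R) k c (v : R) : R :=
  if c then Num.max v k - k else a (Num.max v k) - a k.

(** The increment between w and v sees the level k only through its projection onto [w, v]. All
    positions of k are thus covered by one formula, in the shape that [slope_gap] needs. *)
Lemma ent_clamp (a : R -> R) k c v w : w <= v ->
  ent a k c v - ent a k c w =
  if c then v - Num.max w (Num.min v k) else a v - a (Num.max w (Num.min v k)).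
Proof.
move=> wv; rewrite /ent; case: (leP v k) => vk; case: (leP w k) => wk.
- by rewrite (max_r wv); case: c; ring.
- by have := lt_le_trans wk (le_trans wv vk); rewrite ltxx.
- by case: c; ring.
- by case: c; ring.
Qed.

Lemma clamp_mono k k' v w : k <= k' -> w <= v ->
  let c := fun k => Num.max w (Num.min v k) in [/\ c k <= c k', c k' <= v & c k' - c k <= k' - k].
Proof.
move=> kk wv c; rewrite /c; case: (leP v k) => vk; case: (leP v k') => vk'.
- by rewrite (max_r wv); split; lra.
- lra.
- by rewrite (max_r wv); case: (leP w k) => wk; split; lra.
- by case: (leP w k) => wk; case: (leP w k') => wk'; split; lra.
Qed.

(* With X_i = v - clamp (k_i), slope_gap bounds each term below by alpha/2 X_i X_{i+1} (X_i - X_{i+1}),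
   and 3 X Y (X - Y) = X^3 - Y^3 - (X - Y)^3 makes the sum telescope. *)
Lemma coercive (a : R -> R) alpha d (n : nat) (k : nat -> R) v w : 0 <= alpha ->
  slope_gap a alpha -> k 0%N <= w -> w <= v -> v <= k n ->
  (forall i, k i <= k i.+1) -> (forall i, k i.+1 - k i <= d) ->
  alpha / 6 * ((v - w) ^+ 3 - d ^+ 2 * (v - w)) <=
  \sum_(0 <= i < n)
    ((ent a (k i) true v - ent a (k i) true w) * (ent a (k i.+1) false v - ent a (k i.+1) false w)
    - (ent a (k i) false v - ent a (k i) false w) * (ent a (k i.+1) true v - ent a (k i.+1) true w)).
Proof.
move=> al0 ga k0 wv kn km kd.
pose c i := Num.max w (Num.min v (k i)); pose X i := v - c i.
have X0 : X 0%N = v - w.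
  by rewrite /X /c min_r ?max_l// (le_trans k0).
have Xn : X n = 0 by rewrite /X /c min_l// max_r// subrr.
have step i : alpha / 6 * (X i ^+ 3 - X i.+1 ^+ 3 - d ^+ 2 * (X i - X i.+1)) <=
    (ent a (k i) true v - ent a (k i) true w) * (ent a (k i.+1) false v - ent a (k i.+1) false w)
    - (ent a (k i) false v - ent a (k i) false w) * (ent a (k i.+1) true v - ent a (k i.+1) true w).
  rewrite !ent_clamp// -/(c i) -/(c i.+1).
  have [c1 c2 c3] := clamp_mono (km i) wv.
  rewrite -/(c i) -/(c i.+1) in c1 c2 c3.
  rewrite [X in _ <= _ - X]mulrC; apply: le_trans _ (ga _ _ _ c1 c2).
  rewrite -/(X i) -/(X i.+1).
  have XX : c i.+1 - c i = X i - X i.+1 by rewrite /X; ring.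
  have D0 : 0 <= X i - X i.+1 by rewrite -XX subr_ge0.
  have Dd : X i - X i.+1 <= d by rewrite -XX; exact: le_trans (kd i).
  rewrite XX.
  (* The cube of a step costs at most d^2 times the step, and the steps add up to v - w; this is the
     mesh error. *)
  have K : (X i - X i.+1) ^+ 3 <= d ^+ 2 * (X i - X i.+1).
    by rewrite exprSr ler_wpM2r// lerXn2r// nnegrE (le_trans D0).
  have -> : alpha / 2 * (X i * X i.+1 * (X i - X i.+1)) =
      alpha / 6 * (X i ^+ 3 - X i.+1 ^+ 3 - (X i - X i.+1) ^+ 3) by field.
  by rewrite ler_wpM2l ?divr_ge0// lerD2l lerN2.
apply: le_trans _ (ler_sum_nat (fun i _ => step i)).
rewrite -mulr_sumr ler_wpM2l ?divr_ge0//.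
rewrite (@telescope_sumr_eq _ 0 n (fun i => d ^+ 2 * X i - X i ^+ 3))// => [|i _]; last by ring.
by rewrite Xn X0 expr0n/= mulr0 subr0 sub0r opprB.
Qed.

Lemma coercive_norm (a : R -> R) alpha M d (n : nat) (k : nat -> R) v w : 0 <= alpha ->
  slope_gap a alpha -> k 0%N = - M -> k n = M -> `|v| <= M -> `|w| <= M ->
  (forall i, k i <= k i.+1) -> (forall i, k i.+1 - k i <= d) ->
  alpha / 6 * (`|v - w| ^+ 3 - d ^+ 2 * (2 * M)) <=
  \sum_(0 <= i < n)
    ((ent a (k i) true v - ent a (k i) true w) * (ent a (k i.+1) false v - ent a (k i.+1) false w)
    - (ent a (k i) false v - ent a (k i) false w) * (ent a (k i.+1) true v - ent a (k i.+1) true w)).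
Proof.
move=> al0 ga k0 kn; rewrite !ler_norml => /andP[v1 v2] /andP[w1 w2] km kd.
have [wv|/ltW vw] := leP w v.
  have := @coercive a alpha d n k v w al0 ga; rewrite k0 kn => /(_ w1 wv v2 km kd).
  apply: le_trans; rewrite ger0_norm ?subr_ge0// ler_wpM2l ?divr_ge0// lerD2l lerN2 ler_wpM2l ?sqr_ge0//; lra.
(* Each term of the sum is a product of two increments, so exchanging v and w does not change it. *)
apply: (@le_trans _ _ (alpha / 6 * ((w - v) ^+ 3 - d ^+ 2 * (w - v)))).
  rewrite distrC ger0_norm ?subr_ge0// ler_wpM2l ?divr_ge0// lerD2l lerN2 ler_wpM2l ?sqr_ge0//; lra.
have := @coercive a alpha d n k w v al0 ga; rewrite k0 kn => /(_ v1 vw w2 km kd).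
move=> /le_trans; apply; rewrite le_eqVlt; apply/orP; left; apply/eqP; apply: eq_bigr => i _; ring.
Qed.

Lemma ent_le (a : R -> R) k c v M Lam :
  (forall x y, `|x| <= M -> `|y| <= M -> `|a x - a y| <= Lam * `|x - y|) ->
  `|k| <= M -> `|v| <= M -> `|ent a k c v| <= 2 * M * (1 + Lam).
Proof.
move=> aL kM vM; have M0 : 0 <= M by exact: le_trans kM.
have mk : `|Num.max v k - k| <= 2 * M.
  by move: kM vM; rewrite !ler_norml => /andP[? ?] /andP[? ?]; case: (leP v k) => ?; apply/andP; split; lra.
have mM : `|Num.max v k| <= M by case: (leP v k).
have L0 : 0 <= 2 * M * Lam.
  have := aL M (- M); rewrite normrN (ger0_norm M0) lexx opprK => /(_ isT isT).
  rewrite (ger0_norm (addr_ge0 M0 M0)) => H; have := le_trans (normr_ge0 _) H; lra.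
rewrite /ent; case: c; first by lra.
rewrite (le_trans (aL _ _ mM kM))//.
have [LL|LL] := leP 0 Lam; first by have := ler_wpM2l LL mk; lra.
have : Lam * `|Num.max v k - k| <= 0 by rewrite nmulr_rle0.
lra.
Qed.

(** The level enters the flux twice, in the maximum and in the constant a k; hence the factor 2. *)
Lemma ent_diff_le (a : R -> R) k k' c v M Lam d : 0 <= Lam ->
  (forall x y, `|x| <= M -> `|y| <= M -> `|a x - a y| <= Lam * `|x - y|) ->
  `|k| <= M -> `|k'| <= M -> `|v| <= M -> k <= k' -> k' - k <= d ->
  `|ent a k c v - ent a k' c v| <= d * (1 + 2 * Lam).
Proof.
move=> L0 aL kM k'M vM kk kd.
have mM : `|Num.max v k| <= M by case: (leP v k).
have mM' : `|Num.max v k'| <= M by case: (leP v k').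
have Ld : Lam * (k' - k) <= Lam * d by exact: ler_wpM2l.
have L0' : 0 <= Lam * (k' - k) by rewrite mulr_ge0// subr_ge0.
rewrite /ent; case: c.
  have : `|Num.max v k - k - (Num.max v k' - k')| <= k' - k.
    by rewrite ler_norml; case: (leP v k) => ?; case: (leP v k') => ?; apply/andP; split; lra.
  lra.
have m1 : `|Num.max v k - Num.max v k'| <= k' - k.
  by rewrite ler_norml; case: (leP v k) => ?; case: (leP v k') => ?; apply/andP; split; lra.
have m2 : `|k - k'| <= k' - k by rewrite distrC ger0_norm ?subr_ge0.
rewrite (_ : _ - _ = (a (Num.max v k) - a (Num.max v k')) - (a k - a k')); last by ring.
rewrite (le_trans (ler_normB _ _))//.
have := le_trans (aL _ _ mM mM') (ler_wpM2l L0 m1).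
have := le_trans (aL _ _ kM k'M) (ler_wpM2l L0 m2).
have d0 : 0 <= d by apply: le_trans kd; rewrite subr_ge0.
lra.
Qed.

(** Stopping the grid at M makes monotonicity and the mesh bound hold at every natural index,
    without a restriction to i <= n. *)
Lemma min_grid M (x d : R) : 0 < M -> 0 <= x -> 0 <= d ->
  let k x := Num.min (- M + x) M in
  [/\ `|k x| <= M, k x <= k (x + d) & k (x + d) - k x <= d].
Proof.
move=> M0 x0 d0 k; rewrite /k ler_norml.
case: (leP (- M + x) M) => H; case: (leP (- M + (x + d)) M) => H'.
- split; [apply/andP; split|..]; lra.
- split; [apply/andP; split|..]; lra.
- lra.
- split; [apply/andP; split|..]; lra.
Qed.

End SlopeGap.

(** * The estimate along an axis *)

Section BesovAxis.
Variable R : realType.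
Variables (a : R -> R) (alpha M Lam : R) (W psi : R * R -> R) (S0 S : set (R * R)) (kappa L N : R).
Hypotheses (M0 : 0 < M) (al0 : 0 < alpha) (ga : slope_gap a alpha) (ca : continuous a).
Hypotheses (L0 : 0 <= Lam)
  (aL : forall x y, `|x| <= M -> `|y| <= M -> `|a x - a y| <= Lam * `|x - y|).
Hypotheses (mW : measurable_fun setT W) (WM : forall z, `|W z| <= M).
Hypotheses (tpsi : tst psi) (psi_ge0 : forall z, 0 <= psi z) (psi0 : forall z, ~ S0 z -> psi z = 0).
Hypotheses (kappa0 : 0 < kappa) (S0S : forall z w, S0 w -> `|z - w| <= kappa -> S z)
  (SL : S `<=` cube L).

(** The cut-off gives the fields bounded support; it is invisible on [S], which lies in the cube. *)
Definition entf (k : R) (c : bool) : R * R -> R := fun z => \1_(cube L) z * ent a k c (W z).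

Hypothesis tb : forall k, `|k| <= M -> tbound S N (entf k).

Lemma measurable_ent k c : measurable_fun setT (fun z => ent a k c (W z)).
Proof.
have mm : measurable_fun setT (fun z => Num.max (W z) k).
  by apply: measurable_maxr => //; exact: measurable_cst.
rewrite /ent; case: c; first by apply: measurable_funB => //; exact: measurable_cst.
apply: measurable_funB; last exact: measurable_cst.
by apply: measurableT_comp mm; exact: continuous_measurable_fun.
Qed.

Lemma bcs_entf k c : `|k| <= M -> bcs (entf k c).
Proof.
move=> kM; apply: bcsMl; first exact: bcs_cube.
split; first exact: measurable_ent.
by exists (2 * M * (1 + Lam)) => z; exact: ent_le.
Qed.

Lemma entf_in k c z : cube L z -> entf k c z = ent a k c (W z).
Proof. by move=> zL; rewrite /entf indicE mem_set// mul1r. Qed.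

Lemma besov_axis : exists C : R, forall y (t : R), 0 <= t -> t < kappa ->
  I2 (fun z => psi z * `|incr t y W z| ^+ 3) <= C * t.
Proof.
have [P P0 psiP] := bmf_norm (bcs_bmf (tst_bcs tpsi)).
pose G := I2 (fun z => `|pderiv true psi z| + `|pderiv false psi z|).
(* [cA] bounds every field. [Q] is n times the bound d (1 + 2 Lam) for consecutive differences, with
   mesh d = 2 M / n, so the constant [K] does not depend on n. *)
pose cA := 2 * M * (1 + Lam); pose Q := 2 * M * (1 + 2 * Lam).
pose K := Q * (2 * N * P + 2 * cA * G) + N * P * (4 * cA + 2 * Q).
exists (6 / alpha * K) => y t t0 tk.
have bp := tst_bcs tpsi.
have bW : bmf W by split => //; exists M.
have biW : bmf (fun z => `|incr t y W z| ^+ 3).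
  have [mi [D iD]] := bmfB (bmf_shift (t *: ev R y) bW) bW.
  have bn : bmf (fun z => `|incr t y W z|).
    split; [exact: (measurableT_comp _ mi)|exists D => z; rewrite normr_id; exact: iD].
  by under eq_fun do rewrite !exprS expr0 mulr1; exact: bmfM bn (bmfM bn bn).
have key (n : nat) : (0 < n)%N ->
    I2 (fun z => psi z * `|incr t y W z| ^+ 3) <=
    6 / alpha * K * t + (2 * M / n%:R) ^+ 2 * (2 * M) * I2 psi.
  move=> n0; have n0R : 0 < n%:R :> R by rewrite ltr0n.
  pose d := 2 * M / n%:R.
  have d0 : 0 < d by rewrite divr_gt0// mulr_gt0.
  pose k (i : nat) : R := Num.min (- M + i%:R * d) M.
  have id0 (i : nat) : 0 <= i%:R * d by rewrite mulr_ge0// ltW.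
  have kS i : k i.+1 = Num.min (- M + (i%:R * d + d)) M.
    by rewrite /k -natr1 mulrDl mul1r.
  have kM i : `|k i| <= M by have [] := min_grid M0 (id0 i) (ltW d0).
  have km i : k i <= k i.+1 by rewrite kS; have [] := min_grid M0 (id0 i) (ltW d0).
  have kd i : k i.+1 - k i <= d by rewrite kS; have [] := min_grid M0 (id0 i) (ltW d0).
  have MM : - M <= M by apply: (@le_trans _ _ 0); rewrite ?oppr_le0 ltW.
  have k0 : k 0%N = - M by rewrite /k mul0r addr0 min_l.
  have kn : k n = M.
    rewrite /k /d mulrCA mulfV ?gt_eqF// mulr1 (_ : - M + 2 * M = M) ?minxx//; ring.
  pose A i c := entf (k i) c.
  have bA i c : bcs (A i c) by exact: bcs_entf.
  have ind z : 0 <= (\1_(cube L) z : R) <= 1.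
    by rewrite indicE; case: (_ \in _); rewrite ?lexx ?ler01.
  have AcA i c z : `|A i c z| <= cA.
    have /andP[i0 i1] := ind z.
    rewrite normrM (ger0_norm i0) -[leRHS]mul1r ler_pM//; exact: ent_le.
  have AcB i c z : `|A i c z - A i.+1 c z| <= d * (1 + 2 * Lam).
    have /andP[i0 i1] := ind z.
    rewrite -mulrBr normrM (ger0_norm i0) -[leRHS]mul1r ler_pM//.
    exact: (ent_diff_le _ L0 aL).
  have Ab i : (i <= n)%N -> tbound S N (A i) by move=> _; exact: tb.
  have B0 := wedge0_sum y t0 tk tpsi psi0 psiP S0S erefl bA AcA AcB Ab.
  have nd : n%:R * (d * (1 + 2 * Lam)) = Q.
    by rewrite /d /Q mulrA mulrCA mulfV ?gt_eqF// mulr1.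
  rewrite -[2 * n%:R * _]mulrA nd -/G -/K in B0.
  pose tau z := \sum_(0 <= i < n) ((incr t y (A i true) z) * (incr t y (A i.+1 false) z)
    - (incr t y (A i false) z) * (incr t y (A i.+1 true) z)).
  have bi i c : bcs (incr t y (A i c)) by exact: bcs_incr.
  have btau i : bcs (fun z => (incr t y (A i true) z) * (incr t y (A i.+1 false) z)
    - (incr t y (A i false) z) * (incr t y (A i.+1 true) z)).
    by apply: bcsB; apply: bcsM => //; exact: bcs_bmf.
  have bpt i : bcs (fun z => psi z * ((incr t y (A i true) z) * (incr t y (A i.+1 false) z)
    - (incr t y (A i false) z) * (incr t y (A i.+1 true) z))).
    by apply: bcsMl => //; exact: bcs_bmf.
  have tauE : I2 (fun z => psi z * tau z) = \sum_(0 <= i < n) I2 (fun z => psi z *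
     ((incr t y (A i true) z) * (incr t y (A i.+1 false) z)
    - (incr t y (A i false) z) * (incr t y (A i.+1 true) z))).
    rewrite -(I2_sum _ bpt); congr I2; apply/funext => z; rewrite /tau mulr_sumr//.
  (* A vector has zero determinant with itself, so replacing A_i - A_{i+1} by A_{i+1} only changes
     the sign; the orientation of the pair of components depends on [y], hence the two cases. *)
  have tauB : I2 (fun z => psi z * tau z) <= t * K.
    rewrite (le_trans (ler_norm _))// (le_trans _ B0)// le_eqVlt; apply/orP; left; apply/eqP.
    rewrite tauE; have bpt_ := bpt; case: (y) bpt_ => bpt_.
      rewrite -normrN -sumrN; congr Num.norm; apply: eq_bigr => i _.
      rewrite -(I2N (bpt_ i)); congr I2; apply/funext => z; rewrite /incr/=; ring.
    congr Num.norm; apply: eq_bigr => i _.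
    congr I2; apply/funext => z; rewrite /incr/=; ring.
  have low : I2 (fun z => alpha / 6 * (psi z * `|incr t y W z| ^+ 3 - d ^+ 2 * (2 * M) * psi z)) <=
      I2 (fun z => psi z * tau z).
    apply: le_I2.
    - by apply: bcsZ; apply: bcsB; [exact: bcsMl|exact: bcsZ].
    - have -> : (fun z => psi z * tau z) = fun z => \sum_(0 <= i < n) psi z *
       ((incr t y (A i true) z) * (incr t y (A i.+1 false) z)
       - (incr t y (A i false) z) * (incr t y (A i.+1 true) z)).
        by apply/funext => z; rewrite /tau mulr_sumr.
      elim: (n) => [|j IH].
        under eq_fun do rewrite big_geq//.
        by split; [exact: measurable_cst|exists 0 => z; rewrite normr0|exists 0].
      by under eq_fun do rewrite big_nat_recr//=; exact: bcsD.
    (* Off [S0] both sides vanish. On [S0] both z and its shift lie in the cube, so the cut-off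
       equals 1 at both points. *)
    - move=> z; have [S0z|/psi0 p0] := pselect (S0 z); last first.
        by rewrite p0 !(mul0r, mulr0) subrr mulr0.
      rewrite (mulrC _ (psi z)) -mulrBr mulrCA ler_wpM2l//.
      have zL : cube L z by apply: SL; apply: (S0S S0z); rewrite subrr normr0 ltW.
      have zL' : cube L (z + t *: ev R y).
        by apply: SL; apply: (S0S S0z); rewrite addrC addKr norm_ev ger0_norm// ltW.
      have := coercive_norm (ltW al0) ga k0 kn (WM (z + t *: ev R y)) (WM z) km kd.
      move=> /le_trans; apply; rewrite le_eqVlt; apply/orP; left; apply/eqP.
      by apply: eq_bigr => i _; rewrite /incr /A !entf_in.
  have := le_trans low tauB.
  have bpW : bcs (fun z => psi z * `|incr t y W z| ^+ 3) by exact: bcsMl.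
  rewrite (I2Z _ (bcsB bpW (bcsZ _ bp))) (I2B bpW (bcsZ _ bp)) (I2Z _ bp).
  set x := I2 _; set c := d ^+ 2 * _ * _ => H.
  rewrite -lerBlDr.
  have -> : x - c = 6 / alpha * (alpha / 6 * (x - c)) by field; rewrite gt_eqF.
  by rewrite -(mulrA (6 / alpha) K) (mulrC K t) ler_wpM2l// divr_ge0// ltW.
apply/ler_addgt0Pr => eps eps0.
have Ip : 0 <= I2 psi by exact: I2_ge0.
pose c := (2 * M) ^+ 2 * (2 * M) * I2 psi.
have c0 : 0 <= c by rewrite !mulr_ge0 ?sqr_ge0// ltW.
(* With n >= c / eps the mesh error c / n^2 is at most eps / n. *)
pose n := (Num.truncn (c / eps)).+1.
have n0 : 0 < n%:R :> R by rewrite ltr0n.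
have cn : c <= eps * n%:R.
  by rewrite mulrC -ler_pdivrMr// ltW// truncnS_gt.
apply: le_trans (key n isT) _; rewrite lerD2l.
rewrite (_ : _ * _ = c / n%:R / n%:R); last by rewrite /c; field; rewrite gt_eqF.
rewrite ler_pdivrMr// (@le_trans _ _ eps)//; first by rewrite ler_pdivrMr.
by rewrite -[leLHS]mulr1 ler_wpM2l ?ler1n// ltW.
Qed.

End BesovAxis.

(** * Uniform boundedness on the set of slopes *)

Section GlidingHump.
Variable R : realType.
Implicit Types (G S : R -> R) (x c d M : R).

(* The derivatives of the normalized convex entropies. *)
Definition slopes M : set (R -> R) := [set G : R -> R | [/\ continuous G, {homo G : x y / x <= y},
  forall x, x <= - M -> G x = 0 & forall x, 0 <= G x <= 1]].

(** The completeness on which the gliding hump rests: [c] will be the room left at each stage, hence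
    a uniform error. *)
Lemma uniform_limit_slopes M (S : nat -> R -> R) (c : nat -> R) G :
  (forall n, slopes M (S n)) -> c @ \oo --> 0 ->
  (forall n x, S n x <= G x <= S n x + c n) -> slopes M G.
Proof.
move=> sS c0 SG.
have lim0 d : 0 < d -> exists n, c n <= d.
  by move=> d0; move/cvgr0Pnorm_le: c0 => /(_ d d0)[n _ /(_ n (leqnn n))] H;
     exists n; rewrite (le_trans (ler_norm _)).
have leG x (b : R) : (forall n, S n x <= b) -> G x <= b.
  move=> Sb; apply/ler_addgt0Pr => d /lim0[n cn].
  by have /andP[_] := SG n x; move=> /le_trans; apply; rewrite lerD.
split.
- move=> x; apply/cvgrPdist_le => e e0.
  have /lim0[n cn] : 0 < e / 3 by rewrite divr_gt0.
  have [cS _ _ _] := sS n.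
  have e3 : 0 < e / 3 by rewrite divr_gt0.
  move/cvgrPdist_le: (cS x) => /(_ _ e3); apply: filterS => z.
  have /andP[a1 a2] := SG n x; have /andP[b1 b2] := SG n z.
  by rewrite !ler_norml => /andP[? ?]; apply/andP; split; lra.
- move=> x y xy; apply: leG => n; have [_ mS _ _] := sS n.
  by rewrite (le_trans (mS _ _ xy))//; have /andP[] := SG n y.
- move=> x xM; apply/eqP; rewrite eq_le; apply/andP; split.
    by apply: leG => n; have [_ _ -> //] := sS n.
  by have /andP[+ _] := SG 0%N x; have [_ _ -> //] := sS 0%N.
- move=> x; apply/andP; split.
    have /andP[+ _] := SG 0%N x; apply: le_trans.
    by have [_ _ _ /(_ x)/andP[]] := sS 0%N.
  by apply: leG => n; have [_ _ _ /(_ x)/andP[]] := sS n.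
Qed.

Lemma slopesD M S G (c b : R) : slopes M S -> slopes M G -> 0 <= b -> 0 <= c ->
  (forall x, S x + c <= 1) -> b <= c -> slopes M (fun x => S x + b * G x).
Proof.
move=> [cS mS S0 S1] [cG mG G0 G1] b0 c0 Sc bc; split.
- move=> x; apply: cvgD; first exact: cS.
  by apply: cvgM; [exact: cvg_cst|exact: cG].
- by move=> x y xy; rewrite lerD ?mS// ler_wpM2l// mG.
- by move=> x xM; rewrite S0// G0// mulr0 addr0.
- move=> x; have /andP[s0 s1] := S1 x; have /andP[g0 g1] := G1 x.
  rewrite addr_ge0 ?mulr_ge0//= (le_trans _ (Sc x))// lerD2l (le_trans _ bc)//.
  by rewrite -[leRHS]mulr1 ler_wpM2l.
Qed.

Section UniformBoundedness.
Variables (M : R) (I : Type) (Lf : I -> (R -> R) -> R) (Nl : I -> R).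
Hypothesis Nl0 : forall i, 0 <= Nl i.
Hypothesis Llin : forall i S G b, slopes M S -> slopes M G ->
  Lf i (fun x => S x + b * G x) = Lf i S + b * Lf i G.
Hypothesis Llip : forall i S G d, slopes M S -> slopes M G -> 0 <= d ->
  (forall x, `|S x - G x| <= d) -> `|Lf i S - Lf i G| <= Nl i * d.
Hypothesis Lfin : forall G, slopes M G -> exists C : R, forall i, `|Lf i G| <= C.

(** The second component is the room left: all later additions together stay below it, so the limit
    is still at most 1. *)
Let state := {p : (R -> R) * R | [/\ slopes M p.1, 0 < p.2 & forall x, p.1 x + p.2 <= 1]}.

(** The new slope makes some [Lf i] at least n in absolute value, and the new room is so small that
    later additions change this [Lf i] by at most 1. *)
Let refines (n : nat) (p q : state) := [/\ (sval q).2 <= (sval p).2 / 2,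
  forall x, (sval p).1 x <= (sval q).1 x <= (sval p).1 x + (sval p).2 / 2 &
  exists i, n%:R <= `|Lf i (sval q).1| /\ Nl i * (sval q).2 <= 1].

(* Gliding hump: if the bound fails, add to S_n an ever smaller multiple of a slope G which
   makes Lf i large for some i; Lf i is too large on the limit of the S_n. *)
Lemma slopes_uniform_bound : exists C : R, forall G i, slopes M G -> `|Lf i G| <= C.
Proof.
apply: contrapT => H.
have {}H (C : R) : exists G i, slopes M G /\ C < `|Lf i G|.
  apply: contrapT => H'; apply: H; exists C => G i sG.
  by rewrite leNgt; apply/negP => CL; apply: H'; exists G, i.
have step n (p : state) : exists q : state, refines n p q.
  case: p => -[S c] [/= sS c0 Sc].
  have [D LD] := Lfin sS.
  (* Adding (c/2) G to S changes [Lf i] by more than n + D, of which [Lf i S] can cancel at most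
     D. *)
  have [G [i [sG LG]]] := H ((n%:R + D) / (c / 2)).
  have c2 : 0 < c / 2 by rewrite divr_gt0.
  pose S' x := S x + c / 2 * G x; pose c' := Num.min (c / 2) (Nl i + 1)^-1.
  have Ni : 0 < Nl i + 1 by rewrite ltr_wpDl.
  have c'0 : 0 < c' by rewrite lt_min c2 invr_gt0.
  have sS' : slopes M S' by apply: (slopesD sS sG (ltW c2) (ltW c0) Sc); lra.
  have SS' x : S x <= S' x <= S x + c / 2.
    have [_ _ _ /(_ x)/andP[g0 g1]] := sG.
    have h0 : 0 <= c / 2 * G x by rewrite mulr_ge0// ltW.
    have h1 : c / 2 * G x <= c / 2 by rewrite -[leRHS]mulr1 ler_wpM2l// ltW.
    by rewrite /S' lerDl h0 lerD2l.
  have Sc' x : S' x + c' <= 1.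
    have /andP[_ h] := SS' x; have := Sc x; have : c' <= c / 2 by rewrite ge_min lexx.
    lra.
  exists (exist _ (S', c') (And3 sS' c'0 Sc')); split => /=.
  - by rewrite ge_min lexx.
  - exact: SS'.
  - exists i; split.
      rewrite Llin//; move: LG; rewrite ltr_pdivrMr// => LG.
      have := ler_normB (Lf i S + c / 2 * Lf i G) (Lf i S); rewrite addrAC subrr add0r.
      by rewrite normrM (gtr0_norm c2); have := LD i; lra.
    rewrite (@le_trans _ _ (Nl i * (Nl i + 1)^-1))//.
      by rewrite ler_wpM2l// ge_min lexx orbT.
    by rewrite ler_pdivrMr// mul1r lerDl.
have inv0 : [/\ slopes M ((fun=> 0 : R), 1 : R).1, 0 < ((fun x : R => 0 : R), 1 : R).2 &
    forall x : R, ((fun=> 0 : R), 1 : R).1 x + ((fun x : R => 0 : R), 1 : R).2 <= 1].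
  split; [|exact: ltr01|by move=> x; rewrite /= add0r].
  split=> /= [x|x y _|x _|x] //; [exact: cvg_cst|by rewrite lexx ler01].
pose st0 : state := exist _ ((fun=> 0), 1) inv0.
pose next n p : state := projT1 (cid (step n p)).
pose st := fix st n := if n is m.+1 then next m (st m) else st0.
have stP n : refines n (st n) (st n.+1) by exact: (projT2 (cid (step n (st n)))).
pose S n := (sval (st n)).1; pose c n := (sval (st n)).2.
have inv n : [/\ slopes M (S n), 0 < c n & forall x, S n x + c n <= 1] by exact: (proj2_sig (st n)).
have cS n : c n.+1 <= c n / 2 by have [] := stP n.
have Sm n x : S n x <= S n.+1 x by have [_ /(_ x)/andP[]] := stP n.
have Sd n x : S n.+1 x + c n.+1 <= S n x + c n.
  by have [h1 /(_ x)/andP[_ h2] _] := stP n; rewrite -/(c n) -/(c n.+1) -/(S n) -/(S n.+1) in h1 h2; lra.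
have Smono m n x : (m <= n)%N -> S m x <= S n x.
  by apply: (@homo_leq _ (fun n => S n x) <=%R) => //; [move=> ? ? ?; exact: le_trans].
have Sdec m n x : (m <= n)%N -> S n x + c n <= S m x + c m.
  move=> mn; have := @homo_leq _ (fun n => S n x + c n) (fun u v => v <= u); apply => //.
  by move=> ? ? ? h1 h2; exact: le_trans h2 h1.
have c0 n : 0 < c n by have [] := inv n.
have ub n k x : S k x <= S n x + c n.
  have [kn|/ltnW nk] := leqP k n; first by rewrite (le_trans (Smono _ _ x kn))// lerDl ltW.
  by rewrite (le_trans _ (Sdec _ _ x nk))// lerDl ltW.
pose G x := sup (range (fun n => S n x)).
have SG n x : S n x <= G x <= S n x + c n.
  apply/andP; split.
    apply: ub_le_sup; last by exists n.
    by exists (S n x + c n) => _ [k _ <-]; exact: ub.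
  by apply: ge_sup; [exists (S 0%N x), 0%N|move=> _ [k _ <-]; exact: ub].
have clim : c @ \oo --> 0.
  have cle n : c n <= 2^-1 ^+ n.
    elim: n => [|n IH]; first by rewrite expr0.
    by rewrite (le_trans (cS n))// exprSr ler_wpM2r.
  apply: (squeeze_cvgr (f := fun=> 0) (h := fun n => 2^-1 ^+ n)).
  - by apply: nearW => n; rewrite ltW//= cle.
  - exact: cvg_cst.
  - by apply: cvg_expr; rewrite gtr0_norm// invf_lt1// ltr1n.
have sG : slopes M G by apply: uniform_limit_slopes clim SG => n; have [] := inv n.
have [D LD] := Lfin sG.
(* On the limit every [Lf i] is at most D in absolute value, but the one of stage n is at least n -
   1; with n > D + 1 this is a contradiction. *)
pose n := (Num.truncn (D + 1)).+1.
have [_ _ [i [ni Ni]]] := stP n.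
have sSn : slopes M (S n.+1) by have [] := inv n.+1.
have := Llip i sSn sG (ltW (c0 n.+1)).
have dist x : `|S n.+1 x - G x| <= c n.+1.
  by have /andP[h1 h2] := SG n.+1 x; rewrite distrC ger0_norm ?subr_ge0//; lra.
move=> /(_ dist) LL.
have := LD i; have := ler_normD (Lf i (S n.+1) - Lf i G) (Lf i G); rewrite subrK.
have : D + 1 < n%:R by exact: truncnS_gt.
move: ni Ni LL; rewrite -/(S n.+1) -/(c n.+1); lra.
Qed.

End UniformBoundedness.
End GlidingHump.

(** * Antiderivatives and C^1 approximation of Kruzhkov entropies *)

Section Primitive.
Variable R : realType.
Variable M : R.
Hypothesis M0 : 0 <= M.
Implicit Types (f g F G : R -> R) (x k b d B : R).

(** Picked by choice, with the zero function as default; vanishing to the left of -M makes the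
    antiderivative unique, and uniqueness yields linearity. *)
Definition prim f : R -> R :=
  xget (fun=> 0) [set F | (forall x : R, is_derive x 1 F (f x)) /\ forall x, x <= - M -> F x = 0].

Definition left_null f := continuous f /\ forall x, x <= - M -> f x = 0.

Lemma primP f : left_null f ->
  (forall x : R, is_derive x 1 (prim f) (f x)) /\ forall x, x <= - M -> prim f x = 0.
Proof.
move=> [cf f0]; have [F dF F0] := antiderivative cf f0.
by apply: (@xgetPex _ (fun=> 0) [set F | (forall x : R, is_derive x 1 F (f x)) /\
  forall x, x <= - M -> F x = 0]); exists F.
Qed.

Lemma prim_le (F F' f f' : R -> R) x B : (forall x : R, is_derive x 1 F (f x)) ->
  (forall x : R, is_derive x 1 F' (f' x)) -> F (- M) = F' (- M) -> `|x| <= M ->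
  (forall w, `|w| <= M -> `|f w - f' w| <= B) -> `|F x - F' x| <= 2 * M * B.
Proof.
move=> dF dF' F0; rewrite ler_norml => /andP[x1 x2] fB.
have B0 : 0 <= B by apply: le_trans (fB 0 _); rewrite ?normr0.
move: x1; rewrite le_eqVlt => /predU1P[<-|x1].
  by rewrite F0 subrr normr0 !mulr_ge0.
have dD (t : R) : is_derive t 1 (fun t => F t - F' t) (f t - f' t) by exact: is_deriveB.
have [c /andP[c1 c2]] := mvt dD x1; rewrite F0 subrr subr0 => ->.
rewrite normrM mulrC ler_pM//; last by apply: fB; rewrite ler_norml; lra.
by rewrite ger0_norm; lra.
Qed.

Lemma prim_eq F f x : left_null f -> (forall x : R, is_derive x 1 F (f x)) ->
  (forall x, x <= - M -> F x = 0) -> prim f x = F x.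
Proof.
move=> nf dF F0; have [dP P0] := primP nf.
have [xM|Mx] := leP x (- M); first by rewrite P0// F0.
have dD (t : R) : is_derive t 1 (fun t => prim f t - F t) (f t - f t) by exact: is_deriveB.
have [c _] := mvt dD Mx; rewrite /= (P0 (- M))// (F0 (- M))// !subrr subr0 mul0r => /eqP.
by rewrite subr_eq0 => /eqP.
Qed.

Lemma left_nullD f g b : left_null f -> left_null g -> left_null (fun x => f x + b * g x).
Proof.
move=> [cf f0] [cg g0]; split.
- move=> x; apply: cvgD; first exact: cf.
  by apply: cvgM; [exact: cvg_cst|exact: cg].
- by move=> x xM; rewrite f0// g0// mulr0 addr0.
Qed.

Lemma prim_lin f g b x : left_null f -> left_null g ->
  prim (fun x => f x + b * g x) x = prim f x + b * prim g x.
Proof.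
move=> nf ng; have [df f0] := primP nf; have [dg g0] := primP ng.
apply: (@prim_eq (fun x => prim f x + b * prim g x)).
- exact: left_nullD.
- by move=> t tM; rewrite f0// g0// mulr0 addr0.
Qed.

(** The derivative of a C^1 approximation of (v - k)^+. *)
Definition ramp k d x : R := Num.max 0 (Num.min ((x - k) / d) 1).

Lemma ramp_le k d x : 0 < d -> x <= k -> ramp k d x = 0.
Proof.
move=> d0 xk; rewrite /ramp max_l// ge_min; apply/orP; left.
by rewrite ler_pdivrMr// mul0r subr_le0.
Qed.

Lemma ramp_ge k d x : 0 < d -> k + d <= x -> ramp k d x = 1.
Proof.
move=> d0 kx; rewrite /ramp min_r ?max_r//.
by rewrite ler_pdivlMr// mul1r lerBrDl.
Qed.

Lemma ramp01 k d x : 0 <= ramp k d x <= 1.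
Proof. by rewrite /ramp le_max lexx/= ge_max ler01 ge_min lexx orbT. Qed.

Lemma ramp_slopes k d : 0 < d -> - M <= k -> slopes M (ramp k d).
Proof.
move=> d0 kM; split.
- move=> x; rewrite /ramp; apply: (@continuous_max _ _ (fun=> 0) (fun x => Num.min ((x - k) / d) 1) x).
    exact: cvg_cst.
  apply: (@continuous_min _ _ (fun x => (x - k) / d) (fun=> 1) x); last exact: cvg_cst.
  by apply: cvgM; [apply: cvgB; [exact: cvg_id|exact: cvg_cst]|exact: cvg_cst].
- move=> x y xy; rewrite /ramp ge_max le_max lexx/= le_max; apply/orP; right.
  by rewrite le_min !ge_min lexx orbT andbT ler_pM2r ?invr_gt0// lerD2r xy.
- by move=> x xM; rewrite ramp_le// (le_trans xM).
- by move=> x; exact: ramp01.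
Qed.

(** Both functions vanish up to k and have the same derivative beyond k + d, so their difference
    builds up over a length d only. It is used with h = id for the entropy and with h = a for the
    flux. *)
Lemma prim_ramp_near (h h' : R -> R) k d B x : 0 < d -> `|k| <= M -> `|x| <= M ->
  (forall x : R, is_derive x 1 h (h' x)) -> continuous h' ->
  (forall x, `|x| <= M -> `|h' x| <= B) ->
  `|prim (fun x => ramp k d x * h' x) x - (h (Num.max x k) - h k)| <= d * B.
Proof.
move=> d0 kM xM dh ch hB.
have [k1 k2] : - M <= k /\ k <= M by apply/andP; rewrite -ler_norml.
have [x1 x2] : - M <= x /\ x <= M by apply/andP; rewrite -ler_norml.
have B0 : 0 <= B by apply: le_trans (hB 0 _); rewrite ?normr0.
have nf : left_null (fun x => ramp k d x * h' x).
  have [cr _ r0 _] := ramp_slopes d0 k1; split.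
    by move=> t; apply: cvgM; [exact: cr|exact: ch].
  by move=> t tM; rewrite r0// mul0r.
have [dF F0] := primP nf; set F := prim _ in dF F0 *.
have Fk t : t <= k -> F t = 0.
  move=> tk; have [tM|Mt] := leP t (- M); first exact: F0.
  have [c /andP[_ ct]] := mvt dF Mt; rewrite (F0 (- M))// subr0 => ->.
  by rewrite ramp_le ?mul0r// (le_trans (ltW ct)).
have [xk|kx] := leP x k; first by rewrite Fk// !subrr normr0 mulr_ge0// ltW.
pose E t := F t - h t.
have dE (t : R) : is_derive t 1 E (ramp k d t * h' t - h' t) by exact: is_deriveB.
have Ek : E k = - h k by rewrite /E Fk// sub0r.
pose p := Num.min x (k + d).
have kp : k < p by rewrite lt_min kx ltrDl.
have -> : F x - (h x - h k) = (E x - E p) + (E p - E k).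
  by rewrite subrKA Ek /E opprK; ring.
have -> : E x - E p = 0.
  rewrite /p; have [xkd|kdx] := leP x (k + d); first by rewrite subrr.
  have [c /andP[kc _] ->] := mvt dE kdx.
  by rewrite ramp_ge ?mul1r ?subrr ?mul0r// ltW.
rewrite add0r; have [c /andP[kc cp] ->] := mvt dE kp.
have px : p <= x by rewrite ge_min lexx.
have pd : p - k <= d by rewrite lerBlDl ge_min lexx orbT.
rewrite normrM mulrC (ger0_norm (ltW _)) ?subr_gt0// ler_pM// ?subr_ge0 ?(ltW kp)//.
have cM : `|c| <= M by rewrite ler_norml; apply/andP; split; lra.
have /andP[r0 r1] := ramp01 k d c.
rewrite -{2}[h' c]mul1r -mulrBl normrM -[leRHS]mul1r ler_pM//; last exact: hB.
by rewrite ler_norml; apply/andP; split; lra.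
Qed.

End Primitive.

(** * Convexity from a nondecreasing derivative *)

Section Convexity.
Variable R : realType.
Implicit Types (f F : R -> R) (x y : R).

Lemma tangent_le F f : (forall x : R, is_derive x 1 F (f x)) -> {homo f : x y / x <= y} ->
  forall x y, F x + f x * (y - x) <= F y.
Proof.
move=> dF mf x y; have [->|] := eqVneq x y; first by rewrite subrr mulr0 addr0.
rewrite neq_lt => /orP[xy|yx].
- have [c /andP[xc _] E] := mvt dF xy; have := mf _ _ (ltW xc).
  by rewrite -(ler_pM2r (x := y - x)) ?subr_gt0//; lra.
- have [c /andP[_ cx] E] := mvt dF yx; have := mf _ _ (ltW cx).
  by rewrite -(ler_pM2r (x := x - y)) ?subr_gt0//; lra.
Qed.

(** The two tangent inequalities at the convex combination average to the claim, since the linear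
    terms cancel. *)
Lemma nondecreasing_derive_convex F f : (forall x : R, is_derive x 1 F (f x)) ->
  {homo f : x y / x <= y} -> convex_function (E := R^o) setT F.
Proof.
move=> dF mf t x y _ _.
have p0 : 0 <= t%:num by [].
have p1 : 0 <= 1 - t%:num by rewrite subr_ge0.
set p := t%:num in p0 p1 *.
have Ep (u v : R) : convex.conv t (u : R^o) (v : R^o) = p * u + (1 - p) * v by exact: convRE.
have -> : convex.conv t x y = p * x + (1 - p) * y :> R by exact: Ep.
rewrite Ep; set z := p * x + _.
have /(ler_wpM2l p0) Tx := tangent_le dF mf z x.
have /(ler_wpM2l p1) Ty := tangent_le dF mf z y.
have : p * (F z + f z * (x - z)) + (1 - p) * (F z + f z * (y - z)) = F z by rewrite /z; ring.
lra.
Qed.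

Lemma derive_lipschitz F f (M B : R) : (forall x : R, is_derive x 1 F (f x)) ->
  (forall x : R, `|x| <= M -> `|f x| <= B) ->
  forall x y, `|x| <= M -> `|y| <= M -> `|F x - F y| <= B * `|x - y|.
Proof.
move=> dF fB; have lt x y : `|x| <= M -> `|y| <= M -> x < y -> `|F y - F x| <= B * `|y - x|.
  move=> + + xy; rewrite 2!ler_norml => /andP[x1 x2] /andP[y1 y2].
  have [c /andP[c1 c2] ->] := mvt dF xy; rewrite normrM ler_wpM2r// fB// ler_norml.
  by apply/andP; split; lra.
move=> x y xM yM; have [xy|yx|->] := ltgtP x y; last by rewrite !subrr normr0 mulr0.
  by rewrite distrC (distrC x); exact: lt.
exact: lt.
Qed.

End Convexity.

(** * A bound on divergences uniform in the entropy *)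

Section EntropyBound.
Variable R : realType.
Notation mu2 := ((@lebesgue_measure R) \x (@lebesgue_measure R))%E.
Notation H := (@halfplane R).
Variables (a a' : R -> R) (M B L : R) (u W : R * R -> R) (S : set (R * R)).
Hypotheses (M0 : 0 <= M) (da : forall x : R, is_derive x 1 a (a' x)) (ca' : continuous a').
Hypotheses (B0 : 0 <= B) (aB : forall x, `|x| <= M -> `|a' x| <= B).
Hypotheses (mW : measurable_fun setT W) (WM : forall z, `|W z| <= M).
Hypotheses (mu_ : measurable_fun H u)
  (uW : mu2.-negligible [set z | H z /\ u z <> W z]).
Hypotheses (cS : closed S) (SH : S `<=` H) (SL : S `<=` cube L).
Implicit Types (f F G : R -> R) (phi psi : R * R -> R) (z : R * R) (A : bool -> R * R -> R)
  (C d k m N x : R) (c b : bool).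

Definition gradI phi := I2 (fun z => `|pderiv true phi z| + `|pderiv false phi z|).

Lemma gradI_ge0 phi : 0 <= gradI phi.
Proof. by apply: I2_ge0 => z; rewrite addr_ge0. Qed.

Lemma bcs_grad phi : tst phi -> bcs (fun z => `|pderiv true phi z| + `|pderiv false phi z|).
Proof. by move=> tp; apply: bcsD; apply: bcs_norm; apply: tst_bcs; exact: tst_pderiv. Qed.

Lemma pair2_le A phi C : (forall c, bcs (A c)) -> tst phi -> (forall c z, `|A c z| <= C) ->
  `|pair2 A phi| <= C * gradI phi.
Proof.
move=> bA tp AC; have bg := bcs_grad tp.
rewrite /gradI -(I2Z C bg); apply: le_norm_I2; [exact: pair2_integrand|exact: bcsZ|move=> z].
rewrite (le_trans (ler_normD _ _))// !normrM mulrDr.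
by rewrite lerD// ler_wpM2r.
Qed.

Lemma pair2_lin A A' phi (b : R) : (forall c, bcs (A c)) -> (forall c, bcs (A' c)) -> tst phi ->
  pair2 (fun c z => A c z + b * A' c z) phi = pair2 A phi + b * pair2 A' phi.
Proof.
move=> bA bA' tp; have i1 := pair2_integrand bA tp; have i2 := pair2_integrand bA' tp.
rewrite /pair2 -(I2Z b i2) -I2D; [|exact: i1|exact: bcsZ].
by congr I2; apply/funext => z; ring.
Qed.

Lemma pair2Zr A phi C : (forall c, bcs (A c)) -> tst phi ->
  pair2 A (fun z => C * phi z) = C * pair2 A phi.
Proof.
move=> bA tp; rewrite /pair2 -(I2Z C (pair2_integrand bA tp)).
congr I2; apply/funext => z.
have E c : pderiv c (fun z => C * phi z) = fun z => C * pderiv c phi z.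
  by apply: has_pdE; apply: has_pdZ; exact: (smooth2_has_pd c tp.1).
by rewrite !E; ring.
Qed.

Lemma tstZ phi C : tst phi -> tst (fun z => C * phi z).
Proof.
by move=> [sp [K pK]]; split; [exact: smooth2Z|exists K => z /pK ->; rewrite mulr0].
Qed.

Lemma pderiv_support phi b z : smooth2 phi -> (forall z, ~ S z -> phi z = 0) -> ~ S z ->
  pderiv b phi z = 0.
Proof.
move=> sp pS Sz.
have := is_derive_line z 0 (smooth2_has_pd b sp); rewrite scale0r addr0 => -[_ <-].
suff d0 : is_derive (0 : R) 1 (fun s : R => phi (z + s *: ev R b)) 0 by have [_ ->] := d0.
apply: (@near_eq_is_derive R R R (fun=> 0)).
have : nbhs z (~` S) by apply: open_nbhs_nbhs; split => //; exact/closed_openC.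
move=> /nbhs_ballP[e /= e0 eS]; apply/nbhs_ballP; exists e => // s.
rewrite /ball/= sub0r normrN => se; apply/esym/pS/eS.
rewrite -ball_normE /ball_/= opprD addrA subrr sub0r normrN norm_ev//.
Qed.

(* The entropy with derivative G and its flux, evaluated at W and cut off outside the cube. *)
Definition cutf (G : R -> R) c z : R :=
  \1_(cube L) z * prim M (fun x => if c then G x else G x * a' x) (W z).

Let left_null_c G c : slopes M G -> left_null M (fun x => if c then G x else G x * a' x).
Proof.
move=> [cG _ G0 _]; case: c; first by split.
split; first by move=> x; apply: cvgM; [exact: cG|exact: ca'].
by move=> x xM; rewrite G0// mul0r.
Qed.

Let is_derive0 (x : R) : is_derive x 1 (fun=> 0 : R) (0 : R).
Proof. exact: is_derive_cst. Qed.

Lemma prim_measurable f : left_null M f -> measurable_fun setT (fun z => prim M f (W z)).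
Proof.
move=> nf; have [dF _] := primP nf.
apply: (measurableT_comp (f := prim M f)) => //.
apply: continuous_measurable_fun => x.
by apply/differentiable_continuous/derivable1_diffP; have [] := dF x.
Qed.

Lemma cutf_sub_le S1 S2 d c z : slopes M S1 -> slopes M S2 -> 0 <= d ->
  (forall x, `|S1 x - S2 x| <= d) -> `|cutf S1 c z - cutf S2 c z| <= 2 * M * ((1 + B) * d).
Proof.
move=> s1 s2 d0 dS; have [d1 z1] := primP (left_null_c c s1); have [d2 z2] := primP (left_null_c c s2).
rewrite /cutf -mulrBr normrM -[leRHS]mul1r ler_pM//.
  by rewrite /indic; case: (_ \in _); rewrite ?normr1 ?normr0.
apply: (prim_le M0 d1 d2) => //; first by rewrite z1// z2.
have Bd : 0 <= B * d by rewrite mulr_ge0.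
move=> w wM; case: c {d1 z1 d2 z2}; first by rewrite (le_trans (dS w))//; lra.
rewrite -mulrBl normrM mulrC (le_trans (ler_pM _ _ (aB wM) (dS w)))//; lra.
Qed.

Lemma bcs_cutf G c : slopes M G -> bcs (cutf G c).
Proof.
move=> sG; have nG := left_null_c c sG; have [dG zG] := primP nG.
apply: bcsMl; first exact: bcs_cube.
split; first exact: prim_measurable.
exists (2 * M * (1 + B)) => z; rewrite -[prim M _ _]subr0.
apply: (prim_le M0 dG is_derive0) => //; first by rewrite zG.
have [_ _ _ G1] := sG; have Bw : `|W z| <= M := WM z.
move=> w wM; rewrite subr0; have /andP[g0 g1] := G1 w.
have gn : `|G w| <= 1 by rewrite ger0_norm.
case: c {nG dG zG}; first by rewrite (le_trans gn)// lerDl.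
rewrite normrM (le_trans (ler_pM _ _ gn (aB wM)))// mul1r; lra.
Qed.

Lemma cutf_lin S1 S2 (b : R) c z : slopes M S1 -> slopes M S2 ->
  cutf (fun x => S1 x + b * S2 x) c z = cutf S1 c z + b * cutf S2 c z.
Proof.
move=> s1 s2; rewrite /cutf; set F := (X in prim M X).
have -> : F = fun x => (if c then S1 x else S1 x * a' x) + b * (if c then S2 x else S2 x * a' x).
  by apply/funext => x; rewrite /F; case: c {F} => //; ring.
rewrite (prim_lin _ _ (left_null_c c s1) (left_null_c c s2)); ring.
Qed.

Hypothesis Hent : forall eta : R -> R, convex_function (E := R^o) setT eta -> C1 eta ->
  forall q : R -> R, (forall v, derivable q v 1 /\ derive1 q v = derive1 eta v * derive1 a v) ->
  entropy_measure eta q u.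

Lemma compactS : compact S.
Proof. exact: subclosed_compact cS (@compact_cube R L) SL. Qed.

Lemma measurable_halfplane : measurable H.
Proof.
apply: open2_measurable.
have -> : H = fst @^-1` [set x | 0 < x] by [].
by apply: open_comp; [move=> z _; exact: cvg_fst|exact: open_gt].
Qed.

Lemma test_integral_le (m : {measure set (R * R) -> \bar R}) phi : tst phi ->
  (forall z, ~ S z -> phi z = 0) -> (forall z, `|phi z| <= 1) ->
  (`|\int[m]_(z in H) (phi z)%:E| <= m S)%E.
Proof.
move=> tp pS p1; have mH := measurable_halfplane.
have mS := compact2_measurable compactS.
have mp : measurable_fun setT phi by case: (tst_bcs tp).
have mpH : measurable_fun H (EFin \o phi).
  by apply/measurable_EFinP; exact: measurable_funTS.
apply: le_trans (le_abse_integral m mH mpH) _.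
apply: (@le_trans _ _ (\int[m]_(z in H) (\1_S z)%:E)%E); last first.
  by rewrite integral_indic// le_measure// ?inE//; exact: measurableI.
apply: ge0_le_integral => //.
- exact: measurableT_comp mpH.
- by apply/measurable_EFinP; exact: measurable_indic.
- move=> z _; rewrite lee_fin /indic; have [/=|Sz] := boolP (z \in S).
    by move=> _; exact: p1.
  have nS : ~ S z by move=> /mem_set; rewrite (negbTE Sz).
  by rewrite pS// normr0.
Qed.

(** [S] lies in the cube and in the half-plane, where u = W almost everywhere; a test function
    supported in [S] sees neither the cut-off nor the change of representative. *)
Lemma pair2_cutfE G phi : slopes M G -> tst phi -> (forall z, ~ S z -> phi z = 0) ->
  ((pair2 (cutf G) phi)%:E = \int[leb2 (R := R)]_(z in H)
    ((prim M G (u z) * pderiv true phi z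
      + prim M (fun x => G x * a' x) (u z) * pderiv false phi z)%:E))%E.
Proof.
move=> sG tp pS; have mH := measurable_halfplane.
have bG c := bcs_cutf c sG; have bf := pair2_integrand bG tp.
have intf := bcs_integrable bf.
rewrite /pair2 I2E /Rintegral fineK; last exact: integrable_fin_num.
have pd0 b z : ~ S z -> pderiv b phi z = 0 by move=> Sz; exact: pderiv_support tp.1 pS Sz.
have -> : (\int[mu2]_z (cutf G true z * pderiv true phi z + cutf G false z * pderiv false phi z)%:E
  = \int[mu2]_(z in H) (cutf G true z * pderiv true phi z + cutf G false z * pderiv false phi z)%:E)%E.
  rewrite [RHS]integral_mkcond; apply: eq_integral => z _; rewrite patchE.
  case: ifPn => // Hz; have Sz : ~ S z by move=> /SH /mem_set; rewrite (negbTE Hz).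
  by rewrite !pd0// !mulr0 addr0.
have mprim f : left_null M f -> measurable_fun H (fun z => prim M f (u z)).
  move=> nf; have [dF _] := primP nf.
  apply: (measurableT_comp (f := prim M f)) => //.
  apply: continuous_measurable_fun => x.
  by apply/differentiable_continuous/derivable1_diffP; have [] := dF x.
have mpd b : measurable_fun H (pderiv b phi).
  by apply: measurable_funTS; case: (tst_bcs (tst_pderiv b tp)).
apply: ae_eq_integral => //.
- by apply: measurable_funTS; exact: measurable_int intf.
- apply/measurable_EFinP; apply: measurable_funD; (apply: measurable_funM; last exact: mpd).
    exact: mprim (left_null_c true sG).
  exact: mprim (left_null_c false sG).
- have [N [mN N0 NE]] := uW; exists N; split => // z Nz; apply: NE.
  apply: contrapT => Hz; apply: Nz => hz; congr EFin.
  have -> : u z = W z by apply: contrapT => uz; apply: Hz.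
  have [Sz|Sz] := pselect (S z); last by rewrite !pd0// !mulr0.
  have L1 : \1_(cube L) z = 1 :> R by rewrite /indic mem_set//; exact: SL.
  by rewrite /cutf L1 !mul1r.
Qed.

Lemma C1_prim f : left_null M f -> C1 (prim M f) /\ derive1 (prim M f) = f.
Proof.
move=> nf; have [dF _] := primP nf.
have E : derive1 (prim M f) = f.
  by apply/funext => x; rewrite derive1E; have [_ ->] := dF x.
split => //; split; first by move=> x; have [] := dF x.
by rewrite E; case: nf.
Qed.

(** The constant is the mass that the two parts of the measure of this entropy give to [S]; it
    depends on [G]. *)
Lemma pair2_cutf_bound G : slopes M G -> exists C : R, forall phi, tst phi ->
  (forall z, ~ S z -> phi z = 0) -> (forall z, `|phi z| <= 1) -> `|pair2 (cutf G) phi| <= C.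
Proof.
move=> sG; have nG := left_null_c true sG; have nq := left_null_c false sG.
have [CG dG] := C1_prim nG; have [Cq dq] := C1_prim nq.
have cvx : convex_function (E := R^o) setT (prim M G).
  by apply: (nondecreasing_derive_convex (primP nG).1); case: sG.
have da1 : derive1 a = a' by apply/funext => x; rewrite derive1E; have [_ ->] := da x.
have Hq v : derivable (prim M (fun x => G x * a' x)) v 1 /\
    derive1 (prim M (fun x => G x * a' x)) v = derive1 (prim M G) v * derive1 a v.
  by split; [exact: Cq.1|rewrite da1 dG dq].
have [mup [mum [fp fm E]]] := Hent cvx CG Hq.
have fin (m : {measure set (R * R) -> \bar R}) : locally_finite_on H m -> (m S < +oo)%E.
  by apply => //; exact: compactS.
exists (fine (mup S) + fine (mum S)) => phi tp pS p1.
have tphi : test_fun H phi by split; [exact: tp.1|exists S; split => //; exact: compactS].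
(* Finite mass makes the extended real integral a real number, so the entropy equation becomes one
   between reals. *)
have bound (m : {measure set (R * R) -> \bar R}) : locally_finite_on H m ->
    exists2 r : R, (\int[m]_(z in H) (phi z)%:E = r%:E)%E & `|r| <= fine (m S).
  move=> /fin mS; have := test_integral_le m tp pS p1.
  have -> : m S = (fine (m S))%:E by rewrite fineK// ge0_fin_numE.
  case: (\int[m]_(z in H) _)%E => [r| |] //=; rewrite lee_fin => rm.
  by exists r.
have [r1 E1 r1S] := bound _ fp; have [r2 E2 r2S] := bound _ fm.
have := E _ tphi; rewrite -pair2_cutfE// E1 E2 -EFinB => -[->].
by rewrite (le_trans (ler_normB _ _))// lerD.
Qed.

Let unit_tests := {phi : R * R -> R |
  [/\ tst phi, forall z, ~ S z -> phi z = 0 & forall z, `|phi z| <= 1]}.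

(** The functionals of the gliding hump are indexed by the test functions bounded by 1. Their
    Lipschitz constants in the slope involve the gradient of the test function; this is harmless,
    since [Nl] may depend on the index. *)
Lemma pair2_cutf_uniform_bound : exists2 C : R, 0 <= C & forall G phi, slopes M G -> tst phi ->
  (forall z, ~ S z -> phi z = 0) -> (forall z, `|phi z| <= 1) -> `|pair2 (cutf G) phi| <= C.
Proof.
pose Lf (i : unit_tests) G := pair2 (cutf G) (sval i).
have [||||C HC] := @slopes_uniform_bound R M unit_tests Lf
    (fun i => 2 * M * (1 + B) * gradI (sval i)).
- by move=> i; rewrite !mulr_ge0// ?gradI_ge0// addr_ge0.
- move=> [phi [tp pS p1]] S1 S2 b s1 s2; rewrite /Lf/= -pair2_lin//; last 2 first.
  + by move=> c; exact: bcs_cutf.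
  + by move=> c; exact: bcs_cutf.
  by congr pair2; apply/funext => c; apply/funext => z; exact: cutf_lin.
- move=> [phi [tp pS p1]] S1 S2 d s1 s2 d0 dS; rewrite /Lf/=.
  have b1 c := bcs_cutf c s1; have b2 c := bcs_cutf c s2.
  rewrite -(pair2Bl b1 b2 tp).
  have -> : 2 * M * (1 + B) * gradI phi * d = 2 * M * ((1 + B) * d) * gradI phi by ring.
  apply: pair2_le => // [c|c z]; first exact: bcsB.
  exact: cutf_sub_le.
- move=> G sG; have [C HC] := pair2_cutf_bound sG; exists C.
  by move=> [phi [tp pS p1]]; exact: HC.
exists (`|C|) => // G phi sG tp pS p1; rewrite (le_trans _ (ler_norm C))//.
exact: (HC G (exist _ phi (And3 tp pS p1))).
Qed.

Lemma tbound_cutf : exists2 C : R, 0 <= C & forall G, slopes M G -> tbound S C (cutf G).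
Proof.
have [C C0 HC] := pair2_cutf_uniform_bound; exists C => // G sG phi m tp pS pm.
have m0 : 0 <= m := le_trans (normr_ge0 _) (pm 0).
have bG c := bcs_cutf c sG.
apply/ler_addgt0Pr => e e0.
(* m may be 0, hence the small addition before dividing by it. *)
pose s := m + e / (C + 1).
have C1 : 0 < C + 1 by rewrite ltr_wpDl.
have eC : 0 < e / (C + 1) by rewrite divr_gt0.
have s0 : 0 < s by rewrite ltr_wpDl.
have := HC G (fun z => s^-1 * phi z) sG (tstZ _ tp).
rewrite pair2Zr// normrM gtr0_norm ?invr_gt0// ler_pdivrMl// => H1.
apply: (@le_trans _ _ (s * C)).
  apply: H1 => z; first by move=> Sz; rewrite pS ?mulr0.
  rewrite normrM gtr0_norm ?invr_gt0// ler_pdivrMl// mulr1 (le_trans (pm z))//.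
  by rewrite lerDl ltW.
rewrite /s mulrDl [m * C]mulrC lerD2l mulrAC ler_pdivrMr// ler_pM2l//.
by rewrite lerDl.
Qed.

(** The entropy with slope [ramp k d] is within O(d) of Kruzhkov's, and [N] serves all slopes at
    once. The error involves the gradient of [phi], so d is chosen after [phi]. *)
Lemma tbound_entf : exists N : R, forall k, `|k| <= M -> tbound S N (entf a W L k).
Proof.
have [N N0 HN] := tbound_cutf; exists N => k kM phi m tp pS pm.
have caB : continuous a.
  by move=> x; apply/differentiable_continuous/derivable1_diffP; have [] := da x.
have Lam := derive_lipschitz da aB.
have bE c : bcs (entf a W L k c) by exact: (bcs_entf _ caB Lam mW WM).
have g0 := gradI_ge0 phi.
apply/ler_addgt0Pr => e e0.
pose d := e / ((1 + B) * gradI phi + 1).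
have Q0 : 0 < (1 + B) * gradI phi + 1 by rewrite ltr_wpDl// mulr_ge0// addr_ge0.
have d0 : 0 < d by rewrite divr_gt0.
have sr : slopes M (ramp k d) by apply: ramp_slopes => //; move: kM; rewrite ler_norml => /andP[].
have br c := bcs_cutf c sr.
have near c z : `|entf a W L k c z - cutf (ramp k d) c z| <= d * (1 + B).
  rewrite /entf /cutf -mulrBr normrM -[leRHS]mul1r ler_pM//.
    by rewrite /indic; case: (_ \in _); rewrite ?normr1 ?normr0.
  rewrite distrC /ent; case: c.
    have -> : (fun x : R => if true then ramp k d x else ramp k d x * a' x)
        = fun x => ramp k d x * (fun=> 1 : R) x by apply/funext => x; rewrite mulr1.
    apply: (@le_trans _ _ (d * 1)); last by rewrite ler_wpM2l ?(ltW d0)// lerDl.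
    apply: (prim_ramp_near M0 (h := id)) => //; first by move=> x; exact: cvg_cst.
    by move=> x _; rewrite normr1.
  apply: (@le_trans _ _ (d * B)); last by rewrite ler_wpM2l ?(ltW d0)// lerDr.
  exact: (prim_ramp_near M0 (h := a) (h' := a') d0 kM (WM z) da ca' aB).
have := pair2_le (fun c => bcsB (bE c) (br c)) tp near.
rewrite (pair2Bl bE br tp) => h1.
have := HN _ sr phi m tp pS pm => h2.
have h3 : d * (1 + B) * gradI phi <= e.
  rewrite /d -mulrA mulrAC ler_pdivrMr// ler_pM2l// lerDl//.
have := ler_normD (pair2 (entf a W L k) phi - pair2 (cutf (ramp k d)) phi) (pair2 (cutf (ramp k d)) phi).
rewrite subrK => h4; apply: (le_trans h4); rewrite addrC lerD//.
exact: le_trans h1 h3.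
Qed.

End EntropyBound.

(** * Boxes in the half-plane and cut-off functions *)

Section Box.
Variable R : realType.
Notation H := (@halfplane R).
Implicit Types (z w h : R * R) (r s t : R) (b : bool).

Lemma norm_fst_le z : `|z.1| <= `|z|.
Proof. by rewrite prod_normE/= le_max lexx. Qed.

Lemma norm_snd_le z : `|z.2| <= `|z|.
Proof. by rewrite prod_normE/= le_max lexx orbT. Qed.

(** The parameter [r] enlarges the compact set t0 <= z.1, |z| <= L by r in the maximum norm. *)
Definition box t0 L r : set (R * R) := [set z | t0 - r <= z.1 /\ `|z| <= L + r].

Lemma box_near t0 L r s z w : box t0 L r w -> `|z - w| <= s -> box t0 L (r + s) z.
Proof.
move=> [w1 wL] zw; have := norm_fst_le (z - w); rewrite /=; split.
  by have := ler_norm (w.1 - z.1); rewrite distrC; move: zw; lra.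
by have := ler_normD (z - w) w; rewrite subrK; lra.
Qed.

Lemma box_closed t0 L r : closed (box t0 L r).
Proof.
have -> : box t0 L r = (fst @^-1` [set x | t0 - r <= x]) `&` cube (L + r) by [].
apply: closedI; first by apply: closed_comp => [z _|]; [exact: cvg_fst|exact: closed_ge].
by apply: compact_closed; [exact: norm_hausdorff|exact: compact_cube].
Qed.

Lemma box_cube t0 L r : box t0 L r `<=` cube (L + r).
Proof. by move=> z []. Qed.

Lemma box_halfplane t0 L r : r < t0 -> box t0 L r `<=` H.
Proof. by move=> rt z [z1 _]; rewrite /halfplane/=; lra. Qed.

Lemma measurable_box t0 L r : measurable (box t0 L r).
Proof.
by apply: compact2_measurable; apply: subclosed_compact (@box_cube _ _ _);
  [exact: box_closed|exact: compact_cube].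
Qed.

Lemma bcs_box t0 L r : bcs (\1_(box t0 L r)).
Proof.
split.
- by apply: measurable_indic; exact: measurable_box.
- by exists 1 => z; rewrite indicE; case: (_ \in _); rewrite ?normr1 ?normr0.
- exists (L + r) => z Lz; rewrite indicE memNset// => -[_]; apply/negP; by rewrite -ltNge.
Qed.

Lemma compact_sub_box (K : set (R * R)) : compact K -> K `<=` H ->
  exists t0 L : R, [/\ 0 < t0, 0 < L & K `<=` box t0 L 0].
Proof.
move=> cK KH; have [->|/set0P K0] := eqVneq K set0; first by exists 1, 1; split.
have cf : {within K, continuous (@fst R R)}.
  by apply: continuous_subspaceT => z; exact: cvg_fst.
have cn : {within K, continuous (fun z : R * R => `|z|)}.
  by apply: continuous_subspaceT => z; exact: norm_continuous.
have [c cK1 cm] := compact_EVT_min K0 cK cf; have [d dK1 dm] := compact_EVT_max K0 cK cn.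
exists c.1, (`|d| + 1); split; first by apply: KH; rewrite -in_setE.
  by rewrite ltr_wpDl.
move=> z Kz; split; first by rewrite subr0 cm// in_setE.
by rewrite addr0 (le_trans (dm _ _))// ?in_setE// lerDl.
Qed.

(** A product of four steps of half-width kappa / 2, placed at the sides of the box enlarged by 5/2
    kappa: the whole transition lies between the enlargements by 2 kappa and 3 kappa. *)
Lemma box_cutoff t0 L kappa : 0 < t0 -> 0 < L -> 0 < kappa -> exists psi : R * R -> R,
  [/\ tst psi, forall z, 0 <= psi z, forall z, ~ box t0 L (3 * kappa) z -> psi z = 0 &
    forall z, box t0 L (2 * kappa) z -> psi z = 1].
Proof.
move=> t00 L0 k0; have e0 : 0 < kappa / 2 by rewrite divr_gt0.
have [T [r sT]] := smooth_step e0.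
have T01 := is_step_bound _ sT.
have sm := is_step_smooth1 sT; have [_ [_ _ _ T0 T1]] := sT.
pose m := L + 5 / 2 * kappa.
pose ramp2 l (x : R) := T (1 * x + - l) * T ((-1) * x + m).
have sr l : smooth1 (ramp2 l) by apply: smooth1M; exact: smooth1_affine.
have r0 l x : 0 <= ramp2 l x by rewrite mulr_ge0//; [have /andP[] := T01 (1 * x + - l)|have /andP[] := T01 ((-1) * x + m)].
have rl l x : x <= l - kappa / 2 -> ramp2 l x = 0 by move=> xl; rewrite /ramp2 T0 ?mul0r//; lra.
have rr l x : m + kappa / 2 <= x -> ramp2 l x = 0.
  by move=> mx; rewrite /ramp2 [X in _ * X]T0 ?mulr0//; lra.
have r1 l x : l + kappa / 2 <= x -> x <= m - kappa / 2 -> ramp2 l x = 1.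
  by move=> lx xm; rewrite /ramp2 !T1 ?mulr1//; lra.
have box3 z : ~ box t0 L (3 * kappa) z ->
    tens (ramp2 (t0 - 5 / 2 * kappa)) (ramp2 (- m)) z = 0.
  move=> nb; rewrite /tens.
  have [z1|z1] := leP z.1 (t0 - 3 * kappa); first by rewrite rl ?mul0r//; lra.
  have [z2|z2] := leP (L + 3 * kappa) z.1; first by rewrite rr ?mul0r// /m; lra.
  have [z3|z3] := leP z.2 (- (L + 3 * kappa)); first by rewrite [X in _ * X]rl ?mulr0// /m; lra.
  have [z4|z4] := leP (L + 3 * kappa) z.2; first by rewrite [X in _ * X]rr ?mulr0// /m; lra.
  exfalso; apply: nb; split; first exact: ltW.
  by rewrite prod_normE/= ge_max !ler_norml; apply/andP; split; apply/andP; split; lra.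
exists (tens (ramp2 (t0 - 5 / 2 * kappa)) (ramp2 (- m))); split.
- split; first exact: (tens_smooth2 (sr _) (sr _)).
  exists (L + 3 * kappa) => z Lz; apply: box3 => -[_]; apply/negP.
  by rewrite -ltNge.
- by move=> z; rewrite mulr_ge0.
- exact: box3.
- move=> z [z1 zL]; rewrite /tens.
  have := le_trans (norm_fst_le z) zL; have := le_trans (norm_snd_le z) zL.
  rewrite !ler_norml => /andP[a1 a2] /andP[a3 a4].
  by rewrite !r1 ?mulr1// /m; lra.
Qed.

End Box.

(** * From axis-parallel to arbitrary increments *)

Section AllDirections.
Variable R : realType.
Variables (W psi : R * R -> R) (t0 L kappa C : R).
Hypotheses (bW : bmf W) (bp : bcs psi) (p0 : forall z, 0 <= psi z).
Hypothesis p1 : forall z, box t0 L (2 * kappa) z -> psi z = 1.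
Hypothesis axis : forall y (t : R), 0 <= t -> t < kappa ->
  I2 (fun z => psi z * `|incr t y W z| ^+ 3) <= C * t.
Implicit Types (z w h : R * R) (r s t : R) (y : bool).

Lemma bmf_cube f : bmf f -> bmf (fun z : R * R => `|f z| ^+ 3).
Proof.
move=> [mf [D fD]]; have bn : bmf (fun z => `|f z|).
  split; [exact: (measurableT_comp _ mf)|exists D => z; rewrite normr_id; exact: fD].
by under eq_fun do rewrite !exprS expr0 mulr1; exact: bmfM bn (bmfM bn bn).
Qed.

Lemma bmf_increment h : bmf (fun z => W (z + h) - W z).
Proof. by apply: bmfB => //; exact: bmf_shift. Qed.

Lemma bcs_box_increment r h : bcs (fun z => \1_(box t0 L r) z * `|W (z + h) - W z| ^+ 3).
Proof. by apply: bcsMl; [exact: bcs_box|exact: bmf_cube (bmf_increment h)]. Qed.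

(** For negative t, the increment at z is minus the increment by -t at z + t; translating the
    integral by |t| reduces to a positive step, and the moved box is still inside the region where
    [psi] is 1. *)
Lemma box_axis r y t : r + `|t| <= 2 * kappa -> `|t| < kappa ->
  I2 (fun z => \1_(box t0 L r) z * `|incr t y W z| ^+ 3) <= C * `|t|.
Proof.
move=> rt tk; have bi s : bcs (fun z => psi z * `|incr s y W z| ^+ 3).
  by apply: bcsMl => //; apply: bmf_cube; exact: bmf_increment.
have box_psi z w : `|w - z| <= `|t| -> \1_(box t0 L r) z <= psi w.
  move=> zw; rewrite indicE; have [|_] := boolP (z \in _); last exact: p0.
  rewrite in_setE => /box_near/(_ zw) [b1 b2]; rewrite p1//; split; lra.
have [tp|tn] := leP 0 t.
  rewrite (ger0_norm tp) in tk *; apply: le_trans (axis y tp tk).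
  apply: le_I2; [exact: bcs_box_increment|exact: bi|move=> z].
  by rewrite ler_wpM2r ?exprn_ge0// box_psi// subrr normr0.
have nt : `|t| = - t by rewrite ltr0_norm.
rewrite nt in tk *; have t'0 : 0 <= - t by rewrite oppr_ge0 ltW.
apply: le_trans (axis y t'0 tk).
rewrite -(I2_shift ((- t) *: ev R y) (bcs_box_increment r _)).
apply: le_I2; [exact: bcs_shift (bcs_box_increment r _)|exact: bi|move=> z].
rewrite /incr scaleNr subrK distrC ler_wpM2r ?exprn_ge0// box_psi// opprD opprK addrA subrr add0r.
by rewrite norm_ev.
Qed.

(** After the triangle inequality, the difference of the two sides is 3 (|x| + |y|)(|x| - |y|)^2. *)
Lemma cube_add_le (x y : R) : `|x + y| ^+ 3 <= 4 * (`|x| ^+ 3 + `|y| ^+ 3).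
Proof.
apply: (@le_trans _ _ ((`|x| + `|y|) ^+ 3)); first by rewrite lerXn2r ?nnegrE ?addr_ge0// ler_normD.
have : 0 <= (`|x| + `|y|) * (`|x| - `|y|) ^+ 2 by rewrite mulr_ge0 ?addr_ge0// sqr_ge0.
have : (`|x| + `|y|) * (`|x| - `|y|) ^+ 2 * 3 = 4 * (`|x| ^+ 3 + `|y| ^+ 3) - (`|x| + `|y|) ^+ 3 by ring.
lra.
Qed.

(** The path goes through z + v, where [v] is the first component of the shift. The second leg
    starts at z + v, and a translation turns this into an enlargement of the box by |h.1|. *)
Lemma box_increment h : `|h.1| < kappa -> `|h.2| < kappa ->
  I2 (fun z => \1_(box t0 L 0) z * `|W (z + h) - W z| ^+ 3) <= 4 * C * (`|h.1| + `|h.2|).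
Proof.
move=> h1 h2; have n1 : 0 <= `|h.1| by []; have n2 : 0 <= `|h.2| by [].
pose v := h.1 *: ev R true.
have Eh z : z + h = z + v + h.2 *: ev R false.
  by rewrite /v add_evT add_evF/=; case: z h {h1 h2 n1 n2 v} => x y [].
have b1 := bcs_box_increment 0 v.
have bi : bmf (fun z => `|incr h.2 false W z| ^+ 3) by apply: bmf_cube; exact: bmf_increment.
have b2 : bcs (fun z => \1_(box t0 L 0) z * `|incr h.2 false W (z + v)| ^+ 3).
  by apply: bcsMl; [exact: bcs_box|exact: (bmf_shift v bi)].
apply: (@le_trans _ _ (I2 (fun z => 4 * (\1_(box t0 L 0) z * `|incr h.2 false W (z + v)| ^+ 3
    + \1_(box t0 L 0) z * `|W (z + v) - W z| ^+ 3)))).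
  apply: le_I2; [exact: bcs_box_increment|exact: bcsZ (bcsD b2 b1)|move=> z].
  rewrite -mulrDr [leRHS]mulrCA; apply: ler_wpM2l; first by rewrite indicE; case: (_ \in _).
  by rewrite Eh /incr -[X in `|X| ^+ _](subrKA (W (z + v))) cube_add_le.
rewrite (I2Z _ (bcsD b2 b1)) (I2D b2 b1) -mulrA ler_wpM2l// mulrDr addrC lerD//.
  by apply: box_axis => //; lra.
have b3 : bcs (fun z => \1_(box t0 L 0) (z - v) * `|incr h.2 false W z| ^+ 3).
  by apply: bcsMl => //; exact: bcs_shift (bcs_box t0 L 0).
have -> : (fun z => \1_(box t0 L 0) z * `|incr h.2 false W (z + v)| ^+ 3) =
    fun z => (fun z => \1_(box t0 L 0) (z - v) * `|incr h.2 false W z| ^+ 3) (z + v).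
  by apply/funext => z; rewrite /= addrK.
rewrite (I2_shift v b3).
apply: le_trans (box_axis (r := `|h.1|) false _ h2); last by lra.
apply: le_I2; [exact: b3|exact: bcs_box_increment|move=> z].
rewrite ler_wpM2r ?exprn_ge0//.
rewrite !indicE; have [|_] := boolP (z - v \in _); last by case: (_ \in _).
rewrite in_setE => zv; rewrite mem_set//.
have := box_near (z := z) (s := `|h.1|) zv; rewrite add0r; apply.
by rewrite opprD opprK addrA subrr add0r norm_ev.
Qed.

End AllDirections.

(** * Passage to a bounded representative *)

Section Transfer.
Variable R : realType.
Notation mu2 := ((@lebesgue_measure R) \x (@lebesgue_measure R))%E.
Notation H := (@halfplane R).
Implicit Types (u W g : R * R -> R) (K : set (R * R)) (z h : R * R) (M : R).

Definition clamp M (x : R) : R := Num.max (- M) (Num.min M x).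

Lemma clamp_le M x : 0 <= M -> `|clamp M x| <= M.
Proof.
move=> M0; rewrite ler_norml /clamp le_max lexx/= ge_max.
by rewrite ge_min lexx andbT; lra.
Qed.

Lemma clamp_id M x : `|x| <= M -> clamp M x = x.
Proof. by rewrite ler_norml /clamp => /andP[x1 x2]; rewrite min_r// max_r. Qed.

(** Boundedness of [u] holds only almost everywhere in the half-plane; clamping and extending by 0
    make it hold at every point of the plane. Adding 1 to |M0| makes M positive. *)
Lemma bounded_representative u : Linfty2 H u -> exists (M : R) (W : R * R -> R),
  [/\ 0 < M, measurable_fun setT W, forall z, `|W z| <= M &
    mu2.-negligible [set z | H z /\ u z <> W z]].
Proof.
move=> [mu_ [M0 nM]]; pose M := `|M0| + 1.
have M1 : 0 < M by rewrite ltr_wpDl.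
exists M, ((fun z => clamp M (u z)) \_ H); split => //.
- apply/(measurable_restrictT (fun z => clamp M (u z)) (@measurable_halfplane R)).
  apply: measurable_maxr; first exact: measurable_cst.
  by apply: measurable_minr => //; exact: measurable_cst.
- by move=> z; rewrite patchE; case: ifP => _; [apply: clamp_le|rewrite normr0]; exact: ltW.
- apply: negligibleS nM => z [Hz uz]; split => //; rewrite ltNge; apply/negP => uM.
  apply: uz; rewrite patchE mem_set// clamp_id//.
  by rewrite (le_trans uM)// (le_trans (ler_norm _))// lerDl.
Qed.

Lemma bcs_compact K : compact K -> bcs (\1_K).
Proof.
move=> cK; split.
- by apply: measurable_indic; exact: compact2_measurable.
- by exists 1 => z; rewrite indicE; case: (_ \in _); rewrite ?normr1 ?normr0.
- have /compact_bounded[B [_ /(_ (B + 1))]] := cK; rewrite ltrDl ltr01 => /(_ isT) KB.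
  exists (B + 1) => z Bz; rewrite indicE memNset// => /KB /=.
  by apply/negP; rewrite -ltNge.
Qed.

Lemma compact_integral K g : compact K -> bmf g ->
  (\int[leb2 (R := R)]_(z in K) (g z)%:E = (I2 (fun z => \1_K z * g z))%:E)%E.
Proof.
move=> cK bg; have bi := bcsMl (bcs_compact cK) bg.
rewrite I2E /Rintegral fineK; last exact: integrable_fin_num (bcs_integrable bi).
rewrite /leb2 [LHS]integral_mkcond; apply: eq_integral => z _; rewrite patchE indicE.
by case: ifP => _; rewrite ?mul1r ?mul0r.
Qed.

(** The bridge from the real powers and extended real integrals of the Besov condition to [I2] and
    natural powers. *)
Lemma compact_integral_ae K (u1 u2 g : R * R -> R) : compact K -> bmf g ->
  measurable_fun K u1 -> measurable_fun K u2 ->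
  mu2.-negligible [set z | K z /\ u1 z - u2 z <> g z] ->
  (\int[leb2 (R := R)]_(z in K) (`|u1 z - u2 z| `^ 3)%:E
   = (I2 (fun z => \1_K z * `|g z| ^+ 3))%:E)%E.
Proof.
move=> cK bg m1 m2 [N [mN N0 NE]]; have mK := compact2_measurable cK.
have bg3 := bmf_cube bg; rewrite -(compact_integral cK bg3).
have E z : `|u1 z - u2 z| `^ 3 = `|u1 z - u2 z| ^+ 3 by exact: powR_mulrn.
under eq_integral do rewrite E.
apply: ae_eq_integral => //.
- have mn : measurable_fun K (fun z => `|u1 z - u2 z|).
    by apply: (measurableT_comp (@normr_measurable _ _)); exact: measurable_funB.
  by apply/measurable_EFinP; exact: measurable_funX.
- by apply/measurable_EFinP; apply: measurable_funTS; case: bg3.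
- exists N; split => // z Nz; apply: NE; apply: contrapT => Kz; apply: Nz => kz.
  by congr (`|_| ^+ 3)%:E; apply: contrapT => d; apply: Kz.
Qed.

Lemma negligible_shift h (A : set (R * R)) : mu2.-negligible A ->
  mu2.-negligible ((fun z => z + h) @^-1` A).
Proof.
move=> [N [mN N0 AN]]; exists ((fun z => z + h) @^-1` N); split.
- by rewrite -[X in measurable X]setTI; exact: measurable_shift.
- by rewrite leb2_shift.
- by move=> z /AN.
Qed.

End Transfer.

(** * Assembly of the estimate *)

Lemma norm2_ge (R : realType) (h : R * R) : `|h.1| <= norm2 h /\ `|h.2| <= norm2 h.
Proof.
by split; rewrite /norm2 -sqrtr_sqr ler_wsqrtr// ?lerDl ?lerDr sqr_ge0.
Qed.

Lemma C2_slopes (R : realType) (a : R -> R) alpha0 : C2 a -> (forall v, alpha0 <= derive1n 2 a v) ->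
  [/\ forall x : R, is_derive x 1 a (derive1 a x), continuous (derive1 a) &
    slope_gap a alpha0].
Proof.
move=> [a1 [a2 _]] al.
have d1 (x : R) : is_derive x 1 a (derive1 a x).
  by rewrite derive1E; apply: derivableP; exact: a1.
have d2 (x : R) : is_derive x 1 (derive1 a) (derive1n 2 a x).
  have -> : derive1n 2 a x = 'D_1 (derive1 a) x by rewrite -derive1E.
  by apply: derivableP; exact: a2.
split; [exact: d1|by move=> x; apply/differentiable_continuous/derivable1_diffP; exact: a2|].
apply: (slope_gap_derive d1) => x y; rewrite le_eqVlt => /predU1P[->|xy].
  by rewrite !subrr mulr0.
by have [c _ ->] := mvt d2 xy; rewrite ler_wpM2r// subr_ge0 ltW.
Qed.

Lemma continuous_bounded_segment (R : realType) (f : R -> R) (M : R) : continuous f -> 0 <= M ->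
  exists2 B : R, 0 <= B & forall x, `|x| <= M -> `|f x| <= B.
Proof.
move=> cf M0; have MM : - M <= M by rewrite ge0_cp.
have cn : {within `[- M, M], continuous (fun x => `|f x|)}.
  apply: continuous_subspaceT => x; apply: continuous_comp; first exact: cf.
  exact: norm_continuous.
have [c _ cm] := EVT_max MM cn; exists (`|f c|) => // x; rewrite ler_norml => xM.
by apply: cm; rewrite in_itv.
Qed.

Theorem theorem1 (R : realType) (a : R -> R) (alpha0 : R) (uin : R -> R)
  (u : R * R -> R) :
  C2 a -> 0 < alpha0 -> (forall v, alpha0 <= derive1n 2 a v) ->
  Linfty1 uin ->
  Linfty2 (@halfplane R) u ->
  weak_solution a uin u ->
  (forall eta : R -> R,
     convex_function (E := R^o) setT eta -> C1 eta ->
     forall q : R -> R,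
       (forall v, derivable q v 1 /\ derive1 q v = derive1 eta v * derive1 a v) ->
       entropy_measure eta q u) ->
  Besov_loc (1 / 3) 3 (@halfplane R) u.
Proof.
move=> Ca al0 al _ Lu _ Hent.
have [da ca' ga] := C2_slopes Ca al.
have [M [W [M0 mW WM uW]]] := bounded_representative Lu.
have [B B0 aB] := continuous_bounded_segment ca' (ltW M0).
have [mu_ _] := Lu.
have bW : bmf W by split => //; exists M.
have muK K : compact K -> K `<=` @halfplane R -> measurable_fun K u.
  by move=> cK KH; exact: measurable_funS (@measurable_halfplane R) KH mu_.
split.
  split => // K cK KH.
  have m0 : measurable_fun K (fun=> 0 : R) by exact: measurable_cst.
  have := @compact_integral_ae R K u (fun=> 0) W cK bW (muK K cK KH) m0.
  under eq_integral do rewrite subr0.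
  move=> ->; first exact: ltry.
  by apply: negligibleS uW => z [Kz]; rewrite subr0; split => //; exact: KH.
move=> K cK KH.
have [t0 [L [t00 L0 KB]]] := compact_sub_box cK KH.
(* The set on which divergences are bounded reaches 4 kappa = t0 / 2 beyond the box, so it stays
   away from t = 0. *)
pose kappa := t0 / 8.
have k0 : 0 < kappa by rewrite divr_gt0.
have Ek : 8 * kappa = t0 by rewrite /kappa mulrC divfK.
have [psi [tpsi psi0 psiS psi1]] := box_cutoff t00 L0 k0.
have SH : box t0 L (3 * kappa + kappa) `<=` @halfplane R by apply: box_halfplane; lra.
have [N HN] := tbound_entf (ltW M0) da ca' B0 aB mW WM mu_ uW (@box_closed R _ _ _) SH
  (@box_cube R _ _ _) Hent.
have ca : continuous a by move=> x; apply/differentiable_continuous/derivable1_diffP; have [] := da x.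
have S0S z w : box t0 L (3 * kappa) w -> `|z - w| <= kappa -> box t0 L (3 * kappa + kappa) z.
  exact: box_near.
have [C0 HC0] := besov_axis M0 al0 ga ca B0 (derive_lipschitz da aB) mW WM tpsi psi0 psiS k0 S0S
  (@box_cube R _ _ _) HN.
pose C := `|C0|.
have HC y (t : R) : 0 <= t -> t < kappa -> I2 (fun z => psi z * `|incr t y W z| ^+ 3) <= C * t.
  by move=> t_0 tk; rewrite (le_trans (HC0 y t t_0 tk))// ler_wpM2r// ler_norm.
(* 8 C comes from 4 C (|h.1| + |h.2|), both components being at most the Euclidean norm; the 1
   ensures positivity. The radius kappa / 2 makes both components strictly smaller than kappa. *)
exists (8 * C + 1), (kappa / 2); split.
- by rewrite ltr_wpDl// mulr_ge0// normr_ge0.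
- by rewrite divr_gt0.
move=> h hk; have [h1 h2] := norm2_ge h.
have hk1 : `|h.1| < kappa by lra.
have hk2 : `|h.2| < kappa by lra.
have KhH z : K z -> halfplane (z + h).
  move=> /KB[z1 _]; rewrite /halfplane/=; have := ler_norm (- h.1); rewrite normrN; lra.
have muh : measurable_fun K (fun z => u (z + h)).
  apply: (measurable_comp (F := @halfplane R)) => //; first exact: measurable_halfplane.
    by move=> _ [z Kz <-]; exact: KhH.
  by apply: measurable_funTS; exact: measurable_shift.
have nE : ((@lebesgue_measure R) \x (@lebesgue_measure R))%E.-negligible
    [set z | K z /\ u (z + h) - u z <> W (z + h) - W z].
  apply: negligibleS (negligibleU uW (negligible_shift h uW)) => z [Kz d].
  have [uz|uz] := pselect (u z = W z); last by left; split => //; exact: KH.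
  by right; split; [exact: KhH|move=> E; apply: d; rewrite uz E].
rewrite (compact_integral_ae (u1 := fun z => u (z + h)) cK (bmf_increment bW h) muh (muK K cK KH) nE).
(* The exponent s p is (1/3) 3 = 1, so the right-hand side is linear in the norm of h. *)
rewrite lee_fin mul1r mulVf// powRr1 ?sqrtr_ge0//.
have bi := bcs_box_increment t0 L bW 0 h.
apply: (@le_trans _ _ (I2 (fun z => \1_(box t0 L 0) z * `|W (z + h) - W z| ^+ 3))).
  have bK := bcsMl (bcs_compact cK) (bmf_cube (bmf_increment bW h)).
  apply: (le_I2 bK bi) => z; rewrite ler_wpM2r ?exprn_ge0// !indicE; have [|_] := boolP (z \in K); last by case: (_ \in _).
  by rewrite in_setE => /KB Kz; rewrite mem_set.
have HB := box_increment bW (tst_bcs tpsi) psi0 psi1 HC hk1 hk2.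
apply: (le_trans HB).
have := normr_ge0 C0; rewrite -/C => c0.
have := ler_wpM2l c0 h1; have := ler_wpM2l c0 h2; have : 0 <= norm2 h by exact: sqrtr_ge0.
lra.
Qed.
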